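(* Fix $p\ge2$ and $\boldsymbol\theta_0\in\mathcal S^{p-1}$. Let $(\mathbf V_{0n})$ be a sequence of shape matrices of the form $\mathbf V_{0n}=\lambda_{n1}\boldsymbol\theta_0\boldsymbol\theta_0'+\sum_{j=2}^p\lambda_{nj}\boldsymbol\theta_{nj}\boldsymbol\theta_{nj}'$, where $\boldsymbol\theta_{n2},\dots,\boldsymbol\theta_{np}$ form an orthonormal basis of the orthogonal complement of $\boldsymbol\theta_0$ and $\lambda_{n1}>\lambda_{n2}\ge\dots\ge\lambda_{np}>0$. Assume there exists $\eta>0$ such that $\lambda_{n1}/\lambda_{n2}\ge1+\eta$ for all $n$ large enough. Then, under $\mathrm P^{(n)}_{\mathbf V_{0n}}$, $T_n(\tilde{\mathbf V}_{0n})=L_n+o_{\mathrm P}(1)$ as $n\to\infty$, where $$L_n:=\frac{np}{p+2}\big(\hat\lambda_{n1}\boldsymbol\theta_0'\hat{\mathbf V}_n^{-1}\boldsymbol\theta_0+\hat\lambda_{n1}^{-1}\boldsymbol\theta_0'\hat{\mathbf V}_n\boldsymbol\theta_0-2\big).$$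
   Context: $\mathcal S^{p-1}$ is the unit sphere of $\mathbb R^p$. A shape matrix is a symmetric positive definite $p\times p$ matrix with trace $p$. $\mathrm P^{(n)}_{\mathbf V}$ denotes the hypothesis under which $\mathbf U_{n1},\dots,\mathbf U_{nn}$ are i.i.d. with the angular Gaussian density $\mathbf u\mapsto \frac{\Gamma(p/2)}{2\pi^{p/2}(\det\mathbf V)^{1/2}}(\mathbf u'\mathbf V^{-1}\mathbf u)^{-p/2}$ on $\mathcal S^{p-1}$. $\mathbf S_n(\mathbf V):=\frac1n\sum_{i=1}^n\frac{\mathbf V^{-1/2}\mathbf U_{ni}\mathbf U_{ni}'\mathbf V^{-1/2}}{\|\mathbf V^{-1/2}\mathbf U_{ni}\|^2}$ and $T_n(\mathbf V):=np(p+2)\|(\mathbf I_p-\boldsymbol\theta_0\boldsymbol\theta_0')\mathbf S_n(\mathbf V)\boldsymbol\theta_0\|^2$. Tyler's M-estimator $\hat{\mathbf V}_n$ is the shape matrix satisfying $\mathbf S_n(\hat{\mathbf V}_n)=\frac1p\mathbf I_p$, with spectral decomposition $\hat{\mathbf V}_n=\sum_{j=1}^p\hat\lambda_{nj}\hat{\boldsymbol\theta}_{nj}\hat{\boldsymbol\theta}_{nj}'$, $\hat\lambda_{n1}\ge\dots\ge\hat\lambda_{np}$. For $j=2,\dots,p$, $\tilde{\boldsymbol\theta}_{nj}$ is obtained recursively by Gram–Schmidt: $\tilde{\boldsymbol\theta}_{nj}:=\frac{(\mathbf I_p-\boldsymbol\theta_0\boldsymbol\theta_0'-\sum_{k=2}^{j-1}\tilde{\boldsymbol\theta}_{nk}\tilde{\boldsymbol\theta}_{nk}')\hat{\boldsymbol\theta}_{nj}}{\|(\mathbf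 I_p-\boldsymbol\theta_0\boldsymbol\theta_0'-\sum_{k=2}^{j-1}\tilde{\boldsymbol\theta}_{nk}\tilde{\boldsymbol\theta}_{nk}')\hat{\boldsymbol\theta}_{nj}\|}$, and $\tilde{\mathbf V}_{0n}:=\hat\lambda_{n1}\boldsymbol\theta_0\boldsymbol\theta_0'+\sum_{j=2}^p\hat\lambda_{nj}\tilde{\boldsymbol\theta}_{nj}\tilde{\boldsymbol\theta}_{nj}'$. *)

(* Defs.v *)
From HB Require Import structures.
From mathcomp Require Import all_boot all_order all_algebra.
From mathcomp Require Import all_classical all_reals all_analysis.
Set Implicit Arguments. Unset Strict Implicit. Unset Printing Implicit Defensive.
Import Order.TTheory GRing.Theory Num.Theory.
Import numFieldNormedType.Exports.
Local Open Scope classical_set_scope.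
Local Open Scope ring_scope.

Section Defs.
Variable R : realType.

Definition vnorm (p : nat) (x : 'cV[R]_p) : R := Num.sqrt (\sum_k x k 0 ^+ 2).

Definition posdef (p : nat) (M : 'M[R]_p) : Prop :=
  M^T = M /\ forall x : 'cV[R]_p, x != 0 -> 0 < (x^T *m M *m x) 0 0.

Definition shape_mx (p : nat) (V : 'M[R]_p) : Prop := posdef V /\ \tr V = p%:R.

Definition is_isqrt (p : nat) (V M : 'M[R]_p) : Prop :=
  posdef M /\ M *m M *m V = 1%:M.

(* V^{-1/2}: the symmetric p.d. inverse square root (junk 0 if none exists) *)
Definition isqrtmx (p : nat) (V : 'M[R]_p) : 'M[R]_p :=
  match pselect (exists M, is_isqrt V M) with
  | left h => projT1 (cid h)
  | right _ => 0
  end.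

Definition Sn (p n : nat) (U : 'I_n -> 'cV[R]_p) (V : 'M[R]_p) : 'M[R]_p :=
  n%:R^-1 *: \sum_(i < n)
     ((vnorm (isqrtmx V *m U i) ^+ 2)^-1 *:
        ((isqrtmx V *m U i) *m (isqrtmx V *m U i)^T)).

Definition Tn (p n : nat) (th0 : 'cV[R]_p) (U : 'I_n -> 'cV[R]_p)
    (V : 'M[R]_p) : R :=
  (n%:R * p%:R * (p + 2)%:R) *
    vnorm ((1%:M - th0 *m th0^T) *m Sn U V *m th0) ^+ 2.

Definition tyler_spec (p n : nat) (U : 'I_n -> 'cV[R]_p) (Vh : 'M[R]_p)
    (lamh : 'I_p -> R) (thh : 'I_p -> 'cV[R]_p) : Prop :=
  (exists V : 'M[R]_p, shape_mx V /\ Sn U V = p%:R^-1 *: 1%:M) ->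
  [/\ shape_mx Vh, Sn U Vh = p%:R^-1 *: 1%:M,
      Vh = \sum_(j < p) lamh j *: (thh j *m (thh j)^T),
      (forall i j : 'I_p, (thh i)^T *m thh j = (i == j)%:R%:M)
    & (forall i j : 'I_p, (i <= j)%N -> lamh j <= lamh i)].

(* Gram-Schmidt: gs_list th0 thh m = [:: th~_2; ...; th~_{m+1}] (paper
   indices), where thh m is the paper's hat-theta_{n,m+1} *)
Fixpoint gs_list (p : nat) (th0 : 'cV[R]_p) (thh : nat -> 'cV[R]_p) (m : nat)
    : seq 'cV[R]_p :=
  match m with
  | 0 => [::]
  | m'.+1 =>
      let l := gs_list th0 thh m' in
      let v := (1%:M - th0 *m th0^T - \sum_(w <- l) w *m w^T) *m thh m'.+1 in
      rcons l ((vnorm v)^-1 *: v)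
  end.

(* th~_j for j : 'I_p.+1 (0-based, j >= 1) *)
Definition gs_vec (p : nat) (th0 : 'cV[R]_p.+1) (thh : 'I_p.+1 -> 'cV[R]_p.+1)
    (j : 'I_p.+1) : 'cV[R]_p.+1 :=
  last 0 (gs_list th0 (fun m => thh (inord m)) j).

Definition Vtilde (p : nat) (th0 : 'cV[R]_p.+1) (lamh : 'I_p.+1 -> R)
    (thh : 'I_p.+1 -> 'cV[R]_p.+1) : 'M[R]_p.+1 :=
  lamh ord0 *: (th0 *m th0^T) +
  \sum_(j < p.+1 | j != ord0)
     lamh j *: (gs_vec th0 thh j *m (gs_vec th0 thh j)^T).

Definition Ln (p n : nat) (th0 : 'cV[R]_p.+1) (Vh : 'M[R]_p.+1)
    (lamh : 'I_p.+1 -> R) : R :=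
  (n%:R * p.+1%:R / (p.+1 + 2)%:R) *
   (lamh ord0 * (th0^T *m invmx Vh *m th0) 0 0
    + (lamh ord0)^-1 * (th0^T *m Vh *m th0) 0 0 - 2).

Fixpoint iint (m : nat) : (('I_m -> R) -> \bar R) -> \bar R :=
  match m with
  | 0 => fun g => g (fun _ => 0)
  | m'.+1 => fun g =>
      (\int[lebesgue_measure]_x
         iint (fun y : 'I_m' -> R =>
                 g (fun i : 'I_m'.+1 =>
                      if unlift ord0 i is Some j then y j else x)))%E
  end.

(* integral w.r.t. the surface (Hausdorff) measure sigma on S^{p-1},
   realized as the cone measure: int g dsigma = p * int_{0<|x|<=1} g(x/|x|) dx *)
Definition sph_int (p : nat) (g : 'cV[R]_p -> R) : R :=
  fine (p%:R%:E *
    iint (fun y : 'I_p -> R =>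
      let x := \col_k y k in
      if (x != 0%R) && (vnorm x <= 1)%R then (g ((vnorm x)^-1 *: x))%:E
      else 0%E))%E.

(* angular Gaussian density on S^{p-1} w.r.t. sigma:
   Gamma(p/2)/(2 pi^{p/2}) (det V)^{-1/2} (u'V^{-1}u)^{-p/2};
   note Gamma(p/2)/(2 pi^{p/2}) = 1/sigma(S^{p-1}). *)
Definition ang_dens (p : nat) (V : 'M[R]_p) (u : 'cV[R]_p) : R :=
  (sph_int (fun _ : 'cV[R]_p => 1))^-1 * (Num.sqrt (\det V))^-1 *
  (Num.sqrt ((u^T *m invmx V *m u) 0 0)) ^- p.

(* P^{(n)}_V: U_1, ..., U_n i.i.d. with the angular Gaussian density.
   The joint law is characterized through products of bounded continuous
   nonnegative test functions. *)
Definition iid_angular_gaussian (d : measure_display) (T : measurableType d)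
    (P : probability T R) (p n : nat) (U : 'I_n -> T -> 'cV[R]_p)
    (V : 'M[R]_p) : Prop :=
  (forall i a b, measurable_fun setT (fun w => U i w a b)) /\
  forall f : 'I_n -> 'cV[R]_p -> R,
    (forall i, continuous (f i)) ->
    (forall i x, 0 <= f i x) ->
    (forall i, exists M : R, forall x, f i x <= M) ->
    (\int[P]_w (\prod_(i < n) f i (U i w))%:E =
       (\prod_(i < n) sph_int (fun u => f i u * ang_dens V u))%:E)%E.

(* X_n = o_P(1) (with outer probabilities, so no measurability of X_n is
   presupposed) *)
Definition oP1 (d : nat -> measure_display) (Omega : forall n, measurableType (d n))
    (P : forall n, probability (Omega n) R) (X : forall n, Omega n -> R) : Prop :=
  forall eps : R, 0 < eps ->
  exists E : forall n, set (Omega n),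
    (forall n, measurable (E n)) /\
    (forall n, [set w | eps < `|X n w|] `<=` E n) /\
    ((P n (E n)) @[n --> \oo] --> 0%E).

End Defs.

(* Main.v *)
(** After rescaling by [V0^(-1/2)] and renormalising, the [U_i] become unit
    vectors [W_i] with the moments of the uniform law on the sphere: an affine
    change of variables in gnomonic coordinates shows that the integral of
    [(u'Bu)^(-p/2)] over the sphere is proportional to [det(B)^(-1/2)], which
    for [B = V0^-1 + t aa'] becomes [E (1 + t (v'W)^2)^(-p/2) = (1 + t |v|^2)^(-1/2)],
    and expanding in [t] gives the fourth moments.  By Chebyshev, outside an
    event of vanishing probability the empirical fourth moments of the [W_i] are
    within [delta] of their expectations, where [n delta^3] tends to 0; what
    remains is a deterministic estimate on the complement.  There Tyler's
    equation has a solution (a contraction near the identity), every solution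
    is [O(delta)]-close to [V0] after rescaling by [V0^(-1/2)], and the
    eigenvalue gap makes the coefficients [c_k sqrt(l_1/l_k)], with
    [c_k = <thh_k, th0>], of order [delta].  Both [T_n] and [L_n] are, up to
    [O(n delta^3)], [n p/(p+2)] times the sum over [k >= 2] of the squares of
    [c_k (sqrt(l_k/l_1) - sqrt(l_1/l_k))]. *)
Require Import Defs.
From HB Require Import structures.
From mathcomp Require Import all_boot all_order all_algebra.
From mathcomp Require Import all_classical all_reals all_analysis.
From mathcomp Require Import measurable_realfun ring lra.
Set Implicit Arguments. Unset Strict Implicit. Unset Printing Implicit Defensive.
Import Order.TTheory GRing.Theory Num.Theory.
Import numFieldNormedType.Exports.
Local Open Scope classical_set_scope.
Local Open Scope ring_scope.

(** * Iterated Lebesgue integrals *)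

(** The eigenvalues of [V0 n] may degenerate as [n] grows, so compactness of the set of shapes is
    out of reach and every constant has to depend on the dimension and on [eta] only. Hence all
    comparisons are made after standardisation, and the coefficients of [th0] are controlled
    together with the weight [u ord0 / u k], which may be unbounded. The estimator is not assumed
    measurable; randomness is therefore confined to one measurable event about the data, and
    everything else holds pointwise off it. The error is cubic because [Tn] and [Ln] are quadratic
    in quantities of order [delta] and share their leading part, while Chebyshev's inequality asks
    for [n delta^2] to tend to infinity; [delta = n^(-3/8)] leaves room for both. Finally, the law
    of the sample is known only through products of bounded continuous test functions on the whole
    space, whereas the direction of a vector is discontinuous at the origin. Floored denominators
    and a bump function around the origin bridge this gap. *)

Section Iint.
Context {R : realType}.
Local Open Scope ereal_scope.
Local Notation mu := (@lebesgue_measure R).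

Lemma measurable_affine (a b : R) :
  measurable_fun setT (fun x : measurableTypeR R => (a * x + b)%R : measurableTypeR R).
Proof. by apply: measurable_funD => //; exact: measurable_funM. Qed.

(** Both sides are measures in [A]; by uniqueness of Lebesgue measure it is enough to compare them
    on half-open intervals. *)
Lemma lebesgue_measure_affine (a b : R) (A : set (measurableTypeR R)) : (0 < a)%R -> measurable A ->
  mu A = a%:E * mu ((fun x : measurableTypeR R => (a * x + b)%R : measurableTypeR R) @^-1` A).
Proof.
move=> a0 mA.
have a0' : (0 <= a)%R by exact: ltW.
have mphi := measurable_affine a b.
have H := @lebesgue_measure_unique R
  (mscale (NngNum a0') (pushforward mu (fun x : measurableTypeR R => (a * x + b)%R : measurableTypeR R))).
apply: (H _ _ A mA) => // _ [[c d] _ <-] /=.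
rewrite /mscale /= /pushforward.
have -> : (fun x : measurableTypeR R => (a * x + b)%R : measurableTypeR R) @^-1` [set` `]c, d]]%R
   = [set` `](c - b) / a, (d - b) / a]]%R.
  apply/seteqP; split => x /=; rewrite !in_itv /= ltr_pdivrMr// ler_pdivlMr//; lra.
rewrite !lebesgue_measure_itv /= !lte_fin ltr_pM2r ?invr_gt0// ltrBlDr subrK.
case: ifPn => _; last by rewrite mule0.
rewrite -!EFinD -EFinM; congr EFin; field; lra.
Qed.

Lemma ge0_integral_affine_pos (a b : R) (f : R -> \bar R) : (0 < a)%R ->
  measurable_fun setT f -> (forall x, 0 <= f x) ->
  \int[mu]_x f x = a%:E * \int[mu]_x f (a * x + b)%R.
Proof.
move=> a0 mf f0.
have a0' : (0 <= a)%R by exact: ltW.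
have mphi := measurable_affine a b.
have -> : \int[mu]_x f (a * x + b)%R =
  \int[pushforward mu (fun x : measurableTypeR R => (a * x + b)%R : measurableTypeR R)]_x f x.
  by rewrite ge0_integral_pushforward.
rewrite -[LHS](_ : \int[mscale (NngNum a0') (pushforward mu (fun x : measurableTypeR R => (a * x + b)%R : measurableTypeR R))]_x f x = _).
  by rewrite ge0_integral_mscale.
apply: eq_measure_integral => A mA _.
exact/esym/(lebesgue_measure_affine b a0 mA).
Qed.

Lemma ge0_integral_oppr (f : R -> \bar R) :
  measurable_fun setT f -> (forall x, 0 <= f x) ->
  \int[mu]_x f x = \int[mu]_x f (- x)%R.
Proof.
move=> mf f0.
have mo : measurable_fun setT (-%R : measurableTypeR R -> measurableTypeR R) by exact: oppr_measurable.
have -> : \int[mu]_x f (- x)%R =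
  \int[pushforward mu (-%R : _ -> measurableTypeR R)]_x f x.
  by rewrite ge0_integral_pushforward.
apply: eq_measure_integral => A mA _; rewrite -[LHS](lebesgue_measureN mA).
by [].
Qed.

Lemma ge0_integral_affine (a b : R) (f : R -> \bar R) : (a != 0)%R ->
  measurable_fun setT f -> (forall x, 0 <= f x) ->
  \int[mu]_x f x = `|a|%:E * \int[mu]_x f (a * x + b)%R.
Proof.
move=> a0 mf f0; have [ap|an|a00] := ltrgtP a 0%R; last by rewrite a00 eqxx in a0.
  rewrite ltr0_norm// ge0_integral_oppr// (@ge0_integral_affine_pos (- a) (- b))//; first last.
    - by apply: measurableT_comp => //; exact: oppr_measurable.
    - by rewrite oppr_gt0.
  by congr (_ * _); apply: eq_integral => x _; congr f; ring.
by rewrite gtr0_norm// (@ge0_integral_affine_pos a b).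
Qed.

(** The same case analysis as in [iint], so that [iintS] holds by conversion. *)
Definition fcons (m : nat) (x : R) (y : 'I_m -> R) : 'I_m.+1 -> R :=
  fun i => if unlift ord0 i is Some j then y j else x.

Lemma fcons0 m x (y : 'I_m -> R) : fcons x y ord0 = x.
Proof. by rewrite /fcons unlift_none. Qed.

Lemma fconsS m x (y : 'I_m -> R) j : fcons x y (lift ord0 j) = y j.
Proof. by rewrite /fcons liftK. Qed.

Lemma iintS m (g : ('I_m.+1 -> R) -> \bar R) :
  iint g = \int[mu]_x iint (fun y => g (fcons x y)).
Proof. by []. Qed.

(* Joint measurability in finitely many real variables, tested along all
   coordinatewise measurable maps: this is stable under composition and avoids
   putting a sigma-algebra on ['I_m -> R]. *)
Definition cyl_measurable m (g : ('I_m -> R) -> \bar R) :=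
  forall d (T : measurableType d) (y : T -> 'I_m -> R),
    (forall i, measurable_fun setT (y ^~ i)) ->
    measurable_fun setT (fun s => g (y s)).

Lemma eq_iint m (f g : ('I_m -> R) -> \bar R) : f =1 g -> iint f = iint g.
Proof. by move=> fg; congr iint; apply/funext. Qed.

Lemma iint_ge0 m (g : ('I_m -> R) -> \bar R) :
  (forall y, 0 <= g y) -> 0 <= iint g.
Proof.
elim: m g => [|m IH] g g0 /=; first exact: g0.
by apply: integral_ge0 => x _; apply: IH => y; exact: g0.
Qed.

Lemma measurable_fcons m d (T : measurableType d) (x : T -> R) (y : T -> 'I_m -> R) :
  measurable_fun setT x -> (forall i, measurable_fun setT (y ^~ i)) ->
  forall i, measurable_fun setT (fun s => fcons (x s) (y s) i).
Proof.
move=> mx my i; case: (unliftP ord0 i) => [j ->|->].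
  by under eq_fun do rewrite fconsS; exact: my.
by under eq_fun do rewrite fcons0.
Qed.

(** The parameters [x] are there for the induction, which turns the outermost integration variable
    into one more parameter before Tonelli integrates it out. *)
Lemma measurable_iint m n (g : ('I_n -> R) -> ('I_m -> R) -> \bar R) :
  (forall x y, 0 <= g x y) ->
  (forall d (T : measurableType d) (x : T -> 'I_n -> R) (y : T -> 'I_m -> R),
    (forall i, measurable_fun setT (x ^~ i)) ->
    (forall i, measurable_fun setT (y ^~ i)) ->
    measurable_fun setT (fun s => g (x s) (y s))) ->
  cyl_measurable (fun x => iint (g x)).
Proof.
elim: m n g => [|m IH] n g g0 mg d T x mx /=.
  by apply: mg => // i; exact: measurable_cst.
pose h := fun x' : 'I_n.+1 -> R =>
  iint (fun y => g (fun i => x' (lift ord0 i)) (fcons (x' ord0) y)).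
have mh : cyl_measurable h.
  apply: IH => [x' y|d' T' x' y mx' my]; first exact: g0.
  apply: mg => [i|i]; first exact: mx'.
  exact: measurable_fcons.
pose F := fun sz : T * measurableTypeR R => h (fcons sz.2 (x sz.1)).
have mF : measurable_fun setT F.
  apply: mh => i; apply: measurable_fcons => //= j.
  exact: (measurableT_comp (mx j)).
have F0 z : 0 <= F z by apply: iint_ge0 => y; exact: g0.
have := @measurable_fun_fubini_tonelli_F _ _ _ _ _ mu F mF F0.
rewrite /fubini_F; congr measurable_fun; apply/funext => s.
apply: eq_integral => z _; rewrite /F /h /= fcons0.
apply: eq_iint => y; congr g; apply/funext => i; rewrite ?fconsS//.
Qed.

Lemma cyl_measurable_fcons m (g : ('I_m.+1 -> R) -> \bar R) x :
  cyl_measurable g -> cyl_measurable (fun y => g (fcons x y)).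
Proof. by move=> mg d T y my; apply: mg; apply: measurable_fcons. Qed.

Lemma measurable_iint_fcons m (g : ('I_m.+1 -> R) -> \bar R) :
  (forall y, 0 <= g y) -> cyl_measurable g ->
  measurable_fun setT (fun x : measurableTypeR R => iint (fun y => g (fcons x y))).
Proof.
move=> g0 mg.
have := @measurable_iint m 1 (fun x y => g (fcons (x ord0) y)).
move=> /(_ _ _ _ _ (fun x _ => x)); apply => // d T x y mx my.
by apply: mg; apply: measurable_fcons.
Qed.

(** Tonelli swaps the two outermost integrals, and the induction hypothesis carries the variable
    further inwards. *)
Lemma iint_exchange m (g : ('I_m.+1 -> R) -> \bar R) :
  (forall y, 0 <= g y) -> cyl_measurable g ->
  iint g = iint (fun y => \int[mu]_x g (fcons x y)).
Proof.
elim: m g => [|m IH] g g0 mg; first by [].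
rewrite iintS.
transitivity (\int[mu]_x \int[mu]_z iint (fun y => g (fcons x (fcons z y)))).
  by [].
pose F := fun xz : measurableTypeR R * measurableTypeR R =>
  iint (fun y => g (fcons xz.1 (fcons xz.2 y))).
have F0 z : 0 <= F z by apply: iint_ge0.
have mF : measurable_fun setT F.
  (* [measurable_iint] takes its parameters as one vector, so the pair is packed into a point of
     dimension 2. *)
  pose G := fun s : measurableTypeR R * measurableTypeR R =>
    iint (fun y : 'I_m -> R => g (fcons (fcons s.1 (fcons s.2 (fun=> 0%R : R)) (@ord0 1))
      (fcons (fcons s.1 (fcons s.2 (fun=> 0%R : R)) (lift ord0 (@ord0 0))) y))).
  have <- : G = F by apply/funext => s; rewrite /G fcons0 fconsS fcons0.
  apply: (@measurable_iint m 2 (fun x y => g (fcons (x ord0) (fcons (x (lift ord0 ord0)) y)))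
    _ _ _ _ (fun s => fcons s.1 (fcons s.2 (fun=> 0%R)))) => //.
  - move=> d T x y mx my; apply: mg; apply: measurable_fcons => //.
    exact: measurable_fcons.
  - by move=> i; apply: measurable_fcons => //; apply: measurable_fcons.
have := @fubini_tonelli _ _ _ _ _ mu mu F mF F0.
rewrite /F /= => ->; apply: eq_integral => z _.
pose h := fun u : 'I_m.+1 -> R => g (fcons (u ord0) (fcons z (fun i => u (lift ord0 i)))).
have hE x y : h (fcons x y) = g (fcons x (fcons z y)).
  by rewrite /h fcons0; congr (g (fcons _ (fcons _ _))); apply/funext => i; rewrite fconsS.
transitivity (iint h).
  by rewrite iintS; apply: eq_integral => x _; apply: eq_iint => y; rewrite hE.
rewrite IH; first by apply: eq_iint => y; apply: eq_integral => x _; rewrite hE.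
  by move=> y; exact: g0.
move=> d T y my; apply: mg; apply: measurable_fcons => //.
by apply: measurable_fcons => // i; exact: my.
Qed.

End Iint.

(** * Changes of variables in iterated integrals *)

Section IintChange.
Context {R : realType}.
Local Open Scope ereal_scope.
Local Notation mu := (@lebesgue_measure R).

Lemma ge0_iintZl m (c : \bar R) (g : ('I_m -> R) -> \bar R) : 0 <= c ->
  (forall y, 0 <= g y) -> cyl_measurable g ->
  iint (fun y => c * g y) = c * iint g.
Proof.
elim: m g => [//|m IH] g c0 g0 mg.
rewrite !iintS -ge0_integralZl//.
- by apply: eq_integral => x _; rewrite IH//; exact: cyl_measurable_fcons.
- exact: measurable_iint_fcons.
- by move=> x _; exact: iint_ge0.
Qed.

Lemma measurable_sum_mul m d (T : measurableType d) (a : 'I_m -> R) (y : T -> 'I_m -> R) :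
  (forall i, measurable_fun setT (y ^~ i)) ->
  measurable_fun setT (fun s => \sum_j a j * y s j)%R.
Proof.
by move=> my; apply: measurable_sum => j; exact: measurable_funM.
Qed.

(** As [A] is lower triangular, the first output coordinate depends on the first input only. It is
    substituted in dimension one; for the remaining coordinates it merely changes the translation,
    from [b] to [b' x]. *)
Lemma iint_affine m (A : 'I_m -> 'I_m -> R) (b : 'I_m -> R) (g : ('I_m -> R) -> \bar R) :
  (forall i j : 'I_m, (i < j)%N -> A i j = 0%R) -> (forall i, A i i != 0%R) ->
  (forall y, 0 <= g y) -> cyl_measurable g ->
  iint g = (\prod_i `|A i i|)%:E * iint (fun z => g (fun i => b i + \sum_j A i j * z j)%R).
Proof.
elim: m A b g => [|m IH] A b g Atri A0 g0 mg.
  by rewrite big_ord0 mul1e /=; congr g; apply/funext => -[].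
pose A' := fun i j => A (lift ord0 i) (lift ord0 j).
pose b' := fun x i => (b (lift ord0 i) + A (lift ord0 i) ord0 * x)%R.
pose h := fun x y => g (fcons (A ord0 ord0 * x + b ord0)%R
   (fun i => (b' x i + \sum_j A' i j * y j)%R)).
have gE x y : g (fun i => b i + \sum_j A i j * (fcons x y) j)%R = h x y.
  rewrite /h; congr g; apply/funext => i.
  case: (unliftP ord0 i) => [k ->|->]; rewrite big_ord_recl fcons0.
    rewrite fconsS /b' addrA; congr (_ + _)%R.
    by apply: eq_bigr => j _; rewrite fconsS.
  rewrite fcons0 big1 ?addr0 1?addrC// => j _.
  by rewrite Atri ?mul0r.
have mh : forall d (T : measurableType d) (x : T -> R) (y : T -> 'I_m -> R),
    measurable_fun setT x ->
    (forall i, measurable_fun setT (y ^~ i)) ->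
    measurable_fun setT (fun s => h (x s) (y s)).
  move=> d T x y mx my; apply: mg; apply: measurable_fcons => [|i].
    by apply: measurable_funD => //; exact: measurable_funM.
  apply: measurable_funD; last exact: measurable_sum_mul.
  by apply: measurable_funD => //; exact: measurable_funM.
have mih : measurable_fun setT (fun x : measurableTypeR R => iint (h x)).
  have := @measurable_iint R m 1 (fun x y => h (x ord0) y).
  move=> /(_ _ _ _ _ (fun x _ => x)); apply => // [x y|d T x y mx my]; first exact: g0.
  exact: mh.
rewrite iintS (@ge0_integral_affine R (A ord0 ord0) (b ord0))//; last 2 first.
  - exact: measurable_iint_fcons.
  - by move=> x; exact: iint_ge0.
rewrite big_ord_recl EFinM -muleA; congr (_ * _).
rewrite iintS -ge0_integralZl_EFin//.
- apply: eq_integral => x _; under [in RHS]eq_iint do rewrite gE.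
  rewrite (IH A' (b' x))//.
  + by move=> i j ij; exact: Atri.
  + by move=> i; exact: A0.
  + exact: cyl_measurable_fcons.
- by move=> x _; apply: iint_ge0.
- by under eq_fun do (under eq_iint do rewrite gE).
- by apply: prodr_ge0.
Qed.

Lemma iint_scale m (s : R) (g : ('I_m -> R) -> \bar R) : (s != 0)%R ->
  (forall y, 0 <= g y) -> cyl_measurable g ->
  iint g = (`|s| ^+ m)%:E * iint (fun z => g (fun i => s * z i)%R).
Proof.
move=> s0 g0 mg.
rewrite (@iint_affine m (fun i j => if i == j then s else 0%R) (fun=> 0%R))//; last 2 first.
- by move=> i j ij; rewrite ifF//; apply/negbTE; rewrite neq_ltn ij.
- by move=> i; rewrite eqxx.
under eq_bigr do rewrite eqxx.
rewrite prodr_const card_ord; congr (_ * _); apply: eq_iint => z; congr g.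
apply/funext => i; rewrite add0r (bigD1 i)//= eqxx big1 ?addr0// => j ji.
by rewrite eq_sym (negbTE ji) mul0r.
Qed.

Lemma measurable_fun_invr d (T : measurableType d) (f : T -> R) :
  (forall x, 0 <= f x)%R -> measurable_fun setT f -> measurable_fun setT (fun x => (f x)^-1)%R.
Proof.
move=> f0 mf; under eq_fun do rewrite -powR_inv1//.
exact: (measurableT_comp (measurable_powR (-1))).
Qed.

Lemma measurable_fun_sqrtr d (T : measurableType d) (f : T -> R) :
  measurable_fun setT f -> measurable_fun setT (fun x => Num.sqrt (f x)).
Proof.
move=> mf; apply: measurableT_comp => //.
by apply: continuous_measurable_fun; exact: sqrt_continuous.
Qed.

(* Central projection from the hyperplane [x_0 = 1]: substituting [y = x z] in
   the inner variables turns radial integration into integration over [x_0]. *)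
Lemma iint_gnomonic m (F : ('I_m.+1 -> R) -> \bar R) :
  (forall y, 0 <= F y) -> cyl_measurable F ->
  iint F = iint (fun z : 'I_m -> R =>
    \int[mu]_x ((`|x| ^+ m)%:E * F (fcons x (fun i => x * z i)%R))).
Proof.
move=> F0 mF.
pose G := fun u : 'I_m.+1 -> R =>
  (`|u ord0| ^+ m)%:E * F (fcons (u ord0) (fun i => u ord0 * u (lift ord0 i))%R).
have GE x y : G (fcons x y) = (`|x| ^+ m)%:E * F (fcons x (fun i => x * y i)%R).
  rewrite /G fcons0; congr (_ * F (fcons _ _)).
  by apply/funext => i; rewrite fconsS.
have G0 u : 0 <= G u by rewrite mule_ge0// lee_fin exprn_ge0.
have mG : cyl_measurable G.
  move=> d T y my; apply: emeasurable_funM.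
    apply/measurable_EFinP; apply: measurable_funX.
    by apply: measurableT_comp => //; exact: my.
  apply: mF; apply: measurable_fcons => // i.
  by apply: measurable_funM; exact: my.
transitivity (iint G); last first.
  rewrite iint_exchange//; apply: eq_iint => z; apply: eq_integral => x _.
  by rewrite GE.
rewrite !iintS; apply: ge0_ae_eq_integral => //.
- exact: measurable_iint_fcons.
- exact: measurable_iint_fcons.
- by move=> x _; exact: iint_ge0.
- by move=> x _; exact: iint_ge0.
(* The substitution [y = x z] degenerates at [x = 0] only, a null set. *)
exists [set 0%R]; split; [exact: measurable_set1|exact: lebesgue_measure_set1|].
move=> x /= /not_implyP[_ hx]; apply: contrapT => x0; apply: hx.
have {}x0 : (x != 0)%R by apply/eqP.
rewrite (iint_scale x0)//; last exact: cyl_measurable_fcons.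
under [in RHS]eq_iint do rewrite GE.
rewrite [in RHS]ge0_iintZl//.
move=> d T y my; apply: mF; apply: measurable_fcons => // i.
by apply: measurable_funM.
Qed.

End IintChange.

(** * Integration over the sphere *)

Section Sphere.
Context {R : realType}.
Local Notation mu := (@lebesgue_measure R).

Definition sqnorm p (x : 'cV[R]_p) : R := \sum_k x k 0 ^+ 2.

Lemma sqnorm_ge0 p (x : 'cV[R]_p) : 0 <= sqnorm x.
Proof. by apply: sumr_ge0 => k _; exact: sqr_ge0. Qed.

Lemma sqnorm_eq0 p (x : 'cV[R]_p) : (sqnorm x == 0) = (x == 0).
Proof.
apply/eqP/eqP => [/psumr_eq0P x0|->]; last by rewrite /sqnorm big1// => k _; rewrite mxE expr0n.
apply/colP => k; rewrite mxE; apply/eqP; rewrite -sqrf_eq0; apply/eqP.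
by apply: x0 => // j _; exact: sqr_ge0.
Qed.

Lemma sqnorm_gt0 p (x : 'cV[R]_p) : (0 < sqnorm x) = (x != 0).
Proof. by rewrite lt0r sqnorm_eq0 sqnorm_ge0 andbT. Qed.

Lemma sqnormZ p (a : R) (x : 'cV[R]_p) : sqnorm (a *: x) = a ^+ 2 * sqnorm x.
Proof.
by rewrite /sqnorm mulr_sumr; apply: eq_bigr => k _; rewrite mxE exprMn.
Qed.

Lemma sqnormE p (x : 'cV[R]_p) : sqnorm x = (x^T *m x) 0 0.
Proof. by rewrite mxE; apply: eq_bigr => k _; rewrite mxE expr2. Qed.

Lemma vnormE p (x : 'cV[R]_p) : vnorm x = Num.sqrt (sqnorm x).
Proof. by []. Qed.

Lemma vnorm_ge0 p (x : 'cV[R]_p) : 0 <= vnorm x.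
Proof. exact: sqrtr_ge0. Qed.

Lemma vnorm_sq p (x : 'cV[R]_p) : vnorm x ^+ 2 = sqnorm x.
Proof. by rewrite vnormE sqr_sqrtr// sqnorm_ge0. Qed.

Lemma vnorm_gt0 p (x : 'cV[R]_p) : (0 < vnorm x) = (x != 0).
Proof. by rewrite vnormE sqrtr_gt0 sqnorm_gt0. Qed.

Lemma vnormZ p (a : R) (x : 'cV[R]_p) : vnorm (a *: x) = `|a| * vnorm x.
Proof. by rewrite !vnormE sqnormZ sqrtrM ?sqr_ge0// sqrtr_sqr. Qed.

Definition hplane m (z : 'I_m -> R) : 'cV[R]_m.+1 := \col_k fcons 1 z k.

Lemma hplane0 m (z : 'I_m -> R) : hplane z 0 0 = 1.
Proof. by rewrite mxE fcons0. Qed.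

Lemma hplane_neq0 m (z : 'I_m -> R) : hplane z != 0.
Proof. by apply/eqP => /colP/(_ 0)/eqP; rewrite hplane0 mxE oner_eq0. Qed.

Lemma col_fcons_scale m x (z : 'I_m -> R) :
  \col_k fcons x (fun i => x * z i) k = x *: hplane z.
Proof.
apply/colP => k; rewrite !mxE; case: (unliftP ord0 k) => [j ->|->].
  by rewrite !fconsS.
by rewrite !fcons0 mulr1.
Qed.

Lemma eq_sph_int p (f g : 'cV[R]_p -> R) :
  (forall u, vnorm u = 1 -> f u = g u) -> sph_int f = sph_int g.
Proof.
move=> fg; rewrite /sph_int; congr (fine (_ * _))%E; apply: eq_iint => y /=.
case: ifP => // /andP[x0 _]; rewrite fg// vnormZ.
have v0 : 0 < vnorm (\col_k y k) by rewrite vnorm_gt0.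
by rewrite ger0_norm ?invr_ge0 ?ltW// mulVf// gt_eqF.
Qed.

(** Integral along a line through the origin. It is the same factor for all homogeneous integrands,
    so it cancels whenever two spherical integrals are compared. *)
Definition radial_mass m : \bar R :=
  (\int[mu]_x (`|x| ^+ m * ((x != 0) && (`|x| <= 1))%:R)%:E)%E.

Lemma measurable_radial m (N : R) : measurable_fun setT
  (fun x : measurableTypeR R => (`|x| ^+ m * ((x != 0) && (`|x| * N <= 1))%:R)%:E).
Proof.
apply/measurable_EFinP; apply: measurable_funM.
  by apply: measurable_funX; exact: (measurableT_comp (@normr_measurable R setT)).
rewrite (_ : (fun x => _) = fun x : R => if (x != 0) && (`|x| * N <= 1) then 1 else 0); last first.
  by apply/funext => x; case: ifP.
apply: measurable_fun_ifT => //; apply: measurable_and.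
  by apply: measurable_neg; exact: measurable_fun_eqr.
by apply: measurable_fun_ler => //; apply: measurable_funM => //; exact: (measurableT_comp (@normr_measurable R setT)).
Qed.

Lemma radial_mass_scale m (N : R) : 0 < N ->
  (\int[mu]_x (`|x| ^+ m * ((x != 0) && (`|x| * N <= 1))%:R)%:E =
   (N ^- m.+1)%:E * radial_mass m)%E.
Proof.
move=> N0.
rewrite (@ge0_integral_affine R N^-1 0)//; last 2 first.
- by rewrite invr_neq0// gt_eqF.
- exact: measurable_radial.
rewrite exprS invfM EFinM -muleA ger0_norm ?invr_ge0 ?ltW//; congr (_ * _)%E.
rewrite -ge0_integralZl_EFin//.
- apply: eq_integral => x _; rewrite addr0 -EFinM; congr EFin.
  have nN : `|N^-1| = N^-1 by rewrite ger0_norm// invr_ge0 ltW.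
  have eN : N^-1 * `|x| * N = `|x| by rewrite mulrAC mulVf ?gt_eqF// mul1r.
  rewrite normrM nN eN.
  by rewrite mulf_eq0 invr_eq0 gt_eqF//= exprMn exprVn mulrA.
- by have := measurable_radial m 1; under eq_fun do rewrite mulr1.
- by rewrite invr_ge0 exprn_ge0// ltW.
Qed.

(** By homogeneity [h (x / |x|)] is [|x|^(m+1) h x]. Along the line through [hplane z], of norm [N],
    the factor [N^(m+1)] produced in this way cancels the one from truncating the radius at [1/N];
    what is left is an integral over the hyperplane [x_0 = 1]. *)
Lemma sph_int_homogeneous m (h : 'cV[R]_m.+1 -> R) :
  (forall x, 0 <= h x) -> cyl_measurable (fun y => (h (\col_k y k))%:E) ->
  (forall a x, a != 0 -> h (a *: x) = `|a| ^- m.+1 * h x) ->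
  sph_int h = fine (m.+1%:R%:E * (radial_mass m * iint (fun z => (h (hplane z))%:E)))%E.
Proof.
move=> h0 mh hh; rewrite /sph_int; congr (fine (_ * _))%E.
rewrite iint_gnomonic; last 2 first.
- by move=> y /=; case: ifP; rewrite ?lee_fin.
- move=> d T y my /=.
  have mn : measurable_fun setT (fun s => vnorm (\col_k y s k)).
    apply: measurable_fun_sqrtr; apply: measurable_sum => k.
    apply: measurable_funX.
    by rewrite (_ : (fun s => _) = y^~ k)//; apply/funext => s; rewrite mxE.
  rewrite (_ : (fun s => _) = (fun s => if (0 < vnorm (\col_k y s k)) && (vnorm (\col_k y s k) <= 1)
     then ((vnorm (\col_k y s k) ^+ m.+1)%:E * (h (\col_k y s k))%:E)%E else 0%E)); last first.
    apply/funext => s; rewrite vnorm_gt0; case: ifP => // /andP[x0 _].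
    rewrite hh ?invr_eq0 ?gt_eqF ?vnorm_gt0// ger0_norm ?invr_ge0 ?vnorm_ge0//.
    by rewrite exprVn invrK EFinM.
  apply: measurable_fun_ifT => //.
    by apply: measurable_and; [exact: measurable_fun_ltr|exact: measurable_fun_ler].
  apply: emeasurable_funM; last exact: mh.
  by apply/measurable_EFinP; exact: measurable_funX.
have mhp : cyl_measurable (fun z => (h (hplane z))%:E) := cyl_measurable_fcons 1 mh.
transitivity (iint (fun z => radial_mass m * (h (hplane z))%:E)%E); last first.
  apply: ge0_iintZl => // [|z]; last by rewrite lee_fin.
  apply: integral_ge0 => x _; by rewrite lee_fin mulr_ge0// exprn_ge0.
apply: eq_iint => z.
set N := vnorm (hplane z).
have N0 : 0 < N by rewrite vnorm_gt0 hplane_neq0.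
transitivity (\int[mu]_x ((N ^+ m.+1 * h (hplane z))%:E * (`|x| ^+ m * ((x != 0) && (`|x| * N <= 1))%:R)%:E))%E.
  apply: eq_integral => x _; rewrite col_fcons_scale vnormZ -/N.
  rewrite scaler_eq0 (negbTE (hplane_neq0 z)) orbF.
  case: ifP => [/andP[x0 xN]|_]; last by rewrite mule0 mulr0 mule0.
  rewrite mulr1 -!EFinM; congr EFin.
  have xN0 : `|x| * N != 0 by rewrite mulf_neq0// ?normr_eq0// gt_eqF.
  rewrite scalerA hh; last by rewrite mulf_neq0// invr_eq0.
  rewrite normrM normfV normrM normr_id (ger0_norm (ltW N0)) invfM mulrAC mulVf ?normr_eq0// mul1r.
  by rewrite exprVn invrK mulrC.
rewrite ge0_integralZl_EFin//.
- rewrite radial_mass_scale// muleA -EFinM muleC; congr (_ * _%:E)%E.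
  by rewrite mulrAC mulfV ?mul1r// expf_neq0// gt_eqF.
- exact: measurable_radial.
- by rewrite mulr_ge0// exprn_ge0// ltW.
Qed.

End Sphere.

(** * Cholesky factorisation *)

Section Cholesky.
Context {R : realType}.

Lemma quadE p (B : 'M[R]_p) (x y : 'cV[R]_p) :
  (x^T *m B *m y) 0 0 = \sum_i \sum_j x i 0 * B i j * y j 0.
Proof.
rewrite mxE exchange_big /=; apply: eq_bigr => j _.
by rewrite mxE mulr_suml; apply: eq_bigr => i _; rewrite mxE.
Qed.

(** The order [C^T *m C] with [C] lower triangular is the one that suits the hyperplane [x_0 = 1]:
    [C] multiplies the first coordinate by a constant. Accordingly the induction factors the lower
    right block and recovers the first column and the corner from it. *)
Lemma cholesky n (B : 'M[R]_n) : posdef B ->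
  exists C : 'M[R]_n, [/\ forall i j : 'I_n, (i < j)%N -> C i j = 0,
    forall i, 0 < C i i & C^T *m C = B].
Proof.
elim: n B => [|n IH] B [Bs Bp].
  by exists 0; split => [[]//|[]//|]; apply/matrixP => -[].
rewrite -[n.+1]/(1 + n)%N in B Bs Bp *.
pose B1 := drsubmx B.
have BE : B = block_mx (ulsubmx B) (dlsubmx B)^T (dlsubmx B) B1.
  by rewrite trmx_dlsub Bs submxK.
have B1p : posdef B1.
  split; first by rewrite /B1 trmx_drsub Bs.
  move=> x x0; have := Bp (col_mx 0 x); rewrite BE tr_col_mx mul_row_block mul_row_col.
  rewrite trmx0 !mul0mx !add0r mulmx0 add0r; apply.
  by apply: contra x0 => /eqP/(congr1 dsubmx); rewrite col_mxKd linear0 => ->.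
have [C1 [C1t C1p C1E]] := IH B1 B1p.
have C1u : C1 \in unitmx.
  rewrite unitmxE det_trig; last by apply/is_trig_mxP => i j; exact: C1t.
  by rewrite unitfE prodf_seq_neq0; apply/allP => i _; rewrite gt_eqF.
have [c C1c] : exists c, C1^T *m c = dlsubmx B.
  by exists ((invmx C1)^T *m dlsubmx B); rewrite mulmxA -trmx_mul mulVmx// trmx1 mul1mx.
pose s := B 0 0 - sqnorm c.
have s0 : 0 < s.
  (* The quadratic form of [B] at [(1, -y)] is the Schur complement [s]. *)
  pose y := invmx C1 *m c.
  have C1y : C1 *m y = c by rewrite /y mulmxA mulmxV// mul1mx.
  have := Bp (col_mx 1%:M (- y)); rewrite BE tr_col_mx mul_row_block mul_row_col.
  have yT : (- y)^T = - y^T by rewrite linearN.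
  have e1 : y^T *m dlsubmx B = c^T *m c by rewrite -C1c mulmxA -trmx_mul C1y.
  have e2 : (dlsubmx B)^T *m y = c^T *m c by rewrite -C1c trmx_mul trmxK -mulmxA C1y.
  have e3 : y^T *m B1 *m y = c^T *m c by rewrite -C1E -!mulmxA C1y mulmxA -trmx_mul C1y.
  rewrite yT trmx1 !mul1mx mulmx1 !(mulNmx, mulmxN) mulmxDl !(mulNmx, mulmxN) e1 e2 e3 subrr subr0.
  have -> : (ulsubmx B - c^T *m c) 0 0 = s.
    rewrite !mxE /s sqnormE mxE; congr (B _ _ - _); exact: val_inj.
  apply; apply/negP => /eqP/(congr1 usubmx); rewrite col_mxKu linear0 => /matrixP/(_ 0 0)/eqP.
  by rewrite !mxE eqxx oner_eq0.
exists (block_mx (Num.sqrt s)%:M 0 c C1); split.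
- move=> i j; rewrite -(splitK i) -(splitK j); move: (fintype.split i) (fintype.split j) => [i'|i'] [j'|j'] /=.
  + by rewrite !ord1.
  + by rewrite block_mxEur mxE.
  + by rewrite ord1.
  + by rewrite block_mxEdr ltn_add2l; exact: C1t.
- move=> i; rewrite -(splitK i); move: (fintype.split i) => [i'|i'] /=.
    by rewrite block_mxEul mxE ord1 eqxx sqrtr_gt0.
  by rewrite block_mxEdr.
- rewrite tr_block_mx mulmx_block trmx0 !mul0mx !add0r !mulmx0 !add0r C1E.
  rewrite [RHS]BE -C1c; congr block_mx; last by rewrite trmx_mul trmxK.
  apply/matrixP => i j; rewrite !ord1 tr_scalar_mx -scalar_mxM -expr2 sqr_sqrtr ?ltW//.
  rewrite mxE -sqnormE [X in X + _]mxE eqxx mulr1n /s subrK !mxE.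
  congr (B _ _); exact: val_inj.
Qed.

End Cholesky.

(** * Spherical integrals of powers of a quadratic form *)

Section QuadraticSphere.
Context {R : realType}.

(** The angular Gaussian density up to its normalising constant, with [B] in place of the inverse
    shape; it is homogeneous of degree [-p]. *)
Definition quad_weight p (B : 'M[R]_p) (x : 'cV[R]_p) : R :=
  Num.sqrt ((x^T *m B *m x) 0 0) ^- p.

Lemma quad_weight_ge0 p (B : 'M[R]_p) x : 0 <= quad_weight B x.
Proof. by rewrite /quad_weight invr_ge0 exprn_ge0// sqrtr_ge0. Qed.

Lemma quad_weightZ p (B : 'M[R]_p) a x :
  quad_weight B (a *: x) = `|a| ^- p * quad_weight B x.
Proof.
have aT : (a *: x)^T = a *: x^T by rewrite linearZ.
rewrite /quad_weight aT -scalemxAl -scalemxAr -scalemxAl scalerA mxE -expr2.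
by rewrite sqrtrM ?sqr_ge0// sqrtr_sqr exprMn invfM.
Qed.

Lemma measurable_quad_weight p (B : 'M[R]_p) :
  cyl_measurable (fun y => (quad_weight B (\col_k y k))%:E).
Proof.
move=> d T y my; apply/measurable_EFinP; apply: measurable_fun_invr.
  by move=> x; rewrite exprn_ge0// sqrtr_ge0.
apply: measurable_funX; apply: measurable_fun_sqrtr.
rewrite (_ : (fun s => _) = fun s => \sum_i \sum_j y s i * B i j * y s j); last first.
  apply/funext => s; rewrite quadE; apply: eq_bigr => i _; apply: eq_bigr => j _.
  by rewrite !mxE.
apply: measurable_sum => i; apply: measurable_sum => j.
by apply: measurable_funM => //; exact: measurable_funM.
Qed.

Lemma quad_weight_gram p (C : 'M[R]_p) x : quad_weight (C^T *m C) x = vnorm (C *m x) ^- p.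
Proof. by rewrite /quad_weight vnormE sqnormE trmx_mul !mulmxA. Qed.

(** At the infinities both sides are 0, the value of [fine] there; constants can thus be pulled out
    of spherical integrals without discussing integrability. *)
Lemma fine_mull (c : R) (x : \bar R) : 0 < c -> fine (c%:E * x)%E = c * fine x.
Proof.
move=> c0; case: x => [r//||] /=.
  by rewrite mulry gtr0_sg// mul1e/= mulr0.
by rewrite mulrNy gtr0_sg// mul1e/= mulr0.
Qed.

Lemma sph_int_quad m (B : 'M[R]_m.+1) : posdef B ->
  sph_int (quad_weight B) = (Num.sqrt (\det B))^-1 * sph_int (fun _ : 'cV[R]_m.+1 => 1).
Proof.
move=> /cholesky[C [Ct Cp CE]].
have detB : Num.sqrt (\det B) = \prod_i C i i.
  rewrite -CE det_mulmx det_tr det_trig; last by apply/is_trig_mxP => i j; exact: Ct.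
  by rewrite -expr2 sqrtr_sqr ger0_norm// prodr_ge0// => i _; exact: ltW.
have -> : sph_int (fun _ : 'cV[R]_m.+1 => 1) = sph_int (quad_weight (1%:M : 'M[R]_m.+1)).
  apply: eq_sph_int => u u1.
  by rewrite /quad_weight mulmx1 -sqnormE -vnormE u1 expr1n invr1.
rewrite !sph_int_homogeneous; do ?[by move=> x; exact: quad_weight_ge0|
  exact: measurable_quad_weight|by move=> a x _; exact: quad_weightZ].
pose A (i j : 'I_m) := C (lift ord0 i) (lift ord0 j) / C 0 0.
pose b i := C (lift ord0 i) ord0 / C 0 0.
pose T (z : 'I_m -> R) i := b i + \sum_j A i j * z j.
have C00 : 0 < C 0 0 by [].
(* Up to the scalar [C 0 0], the matrix [C] acts on the hyperplane as the affine map [T], whose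
   linear part is again lower triangular. *)
have CT z : C *m hplane z = C 0 0 *: hplane (T z).
  apply/colP => k; rewrite !mxE big_ord_recl.
  case: (unliftP ord0 k) => [j ->|->].
    rewrite fconsS /T !mxE fcons0 mulr1 mulrDr /b mulrCA mulfV ?gt_eqF// mulr1; congr (_ + _).
    rewrite mulr_sumr; apply: eq_bigr => l _; rewrite mxE fconsS /A.
    by rewrite mulrA mulrCA mulfV ?gt_eqF// mulr1.
  rewrite fcons0 !mxE fcons0 mulr1 big1 ?addr0// ?mulr1// => l _.
  by rewrite Ct// mul0r.
pose I := iint (fun z => (quad_weight (1%:M : 'M[R]_m.+1) (hplane (T z)))%:E).
have mh : cyl_measurable (fun z => (quad_weight (1%:M : 'M[R]_m.+1) (hplane z))%:E).
  exact: (cyl_measurable_fcons 1 (measurable_quad_weight _)).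
have -> : iint (fun z => (quad_weight (1%:M : 'M[R]_m.+1) (hplane z))%:E) =
   ((\prod_i `|A i i|)%:E * I)%E.
  rewrite (@iint_affine R m A b)//.
  - by move=> i j ij; rewrite /A Ct ?mul0r.
  - by move=> i; rewrite /A mulf_neq0// ?invr_eq0 gt_eqF.
  - by move=> z; rewrite lee_fin quad_weight_ge0.
have -> : iint (fun z => (quad_weight B (hplane z))%:E) = ((C 0 0 ^- m.+1)%:E * I)%E.
  rewrite -ge0_iintZl; last 3 first.
  - by rewrite lee_fin invr_ge0 exprn_ge0// ltW.
  - by move=> z; rewrite lee_fin quad_weight_ge0.
  - move=> d S y my; apply: mh => i; apply: measurable_funD => //.
    exact: measurable_sum_mul.
  apply: eq_iint => z; rewrite -EFinM; congr EFin.
  rewrite -CE quad_weight_gram CT vnormZ exprMn invfM ger0_norm ?ltW//; congr (_ * _).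
  by rewrite /quad_weight mulmx1 vnormE sqnormE.
(* The factor from homogeneity, divided by the Jacobian of [T], is the inverse of the determinant of
   [C]. *)
have -> : C 0 0 ^- m.+1 = (\prod_i C i i)^-1 * \prod_i `|A i i|.
  rewrite big_ord_recl /A.
  under [X in _ * X]eq_bigr do rewrite ger0_norm ?divr_ge0// ?ltW//.
  rewrite prodf_div prodr_const card_ord invfM mulrA -[RHS]mulrA -mulrA.
  rewrite (mulrA _^-1 (\prod_(i < m) _)) mulVf; last first.
    by rewrite prodf_seq_neq0; apply/allP => i _; rewrite gt_eqF.
  by rewrite mul1r exprS invfM.
rewrite detB EFinM -!muleA !(muleCA _ ((\prod_i C i i)^-1)%:E) fine_mull//.
by rewrite invr_gt0 prodr_gt0.
Qed.

End QuadraticSphere.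

(** * Tyler's equation when the fourth moments are nearly uniform *)

Section Average.
Context {R : realFieldType} (n : nat).
Implicit Types f g : 'I_n -> R.

Definition avg f : R := n%:R^-1 * \sum_i f i.

Lemma eq_avg f g : f =1 g -> avg f = avg g.
Proof. by move=> fg; rewrite /avg (eq_bigr g). Qed.

Lemma avgD f g : avg (fun i => f i + g i) = avg f + avg g.
Proof. by rewrite /avg big_split mulrDr. Qed.

Lemma avgZ c f : avg (fun i => c * f i) = c * avg f.
Proof. by rewrite /avg -mulr_sumr mulrCA. Qed.

Lemma avgN f : avg (fun i => - f i) = - avg f.
Proof. by rewrite /avg sumrN mulrN. Qed.

Lemma avgB f g : avg (fun i => f i - g i) = avg f - avg g.
Proof. by rewrite avgD avgN. Qed.

Lemma avg_sum (I : Type) (r : seq I) (P : pred I) (F : I -> 'I_n -> R) :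
  avg (fun i => \sum_(j <- r | P j) F j i) = \sum_(j <- r | P j) avg (F j).
Proof. by rewrite /avg exchange_big mulr_sumr. Qed.

Lemma ler_avg f g : (forall i, f i <= g i) -> avg f <= avg g.
Proof.
by move=> fg; rewrite /avg ler_wpM2l ?invr_ge0 ?ler0n//; apply: ler_sum.
Qed.

Lemma avg_cst c : (0 < n)%N -> avg (fun=> c) = c.
Proof.
by move=> n0; rewrite /avg sumr_const card_ord -[c *+ n]mulr_natl mulKf// pnatr_eq0 -lt0n.
Qed.

Lemma ler_norm_avg f c : 0 <= c -> (forall i, `|f i| <= c) -> `|avg f| <= c.
Proof.
move=> c0 fc; have [n0|n0] := posnP n.
  by rewrite /avg (_ : n%:R = 0) ?invr0 ?mul0r ?normr0// n0.
rewrite -[leRHS](avg_cst c n0) /avg normrM ger0_norm ?invr_ge0//.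
by rewrite ler_wpM2l ?invr_ge0//; apply: le_trans (ler_norm_sum _ _ _) (ler_sum _ _).
Qed.
End Average.

(** * Cauchy-Schwarz, the entrywise norm and quadratic forms *)

Section Basics.
Context {R : realType}.

(** Lagrange's identity: the double sum of squares is twice the difference of the two sides. *)
Lemma cauchy_schwarz (I : finType) (a b : I -> R) :
  (\sum_i a i * b i) ^+ 2 <= (\sum_i a i ^+ 2) * (\sum_i b i ^+ 2).
Proof.
have : 0 <= \sum_i \sum_j (a i * b j - a j * b i) ^+ 2.
  by apply: sumr_ge0 => i _; apply: sumr_ge0 => j _; exact: sqr_ge0.
have -> : \sum_i \sum_j (a i * b j - a j * b i) ^+ 2 =
    2 * ((\sum_i a i ^+ 2) * (\sum_i b i ^+ 2) - (\sum_i a i * b i) ^+ 2); last lra.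
transitivity (\sum_i \sum_j (a i ^+ 2 * b j ^+ 2 + b i ^+ 2 * a j ^+ 2 - 2 * (a i * b i) * (a j * b j))).
  by apply: eq_bigr => i _; apply: eq_bigr => j _; ring.
under eq_bigr do rewrite sumrB big_split /= -!mulr_sumr.
rewrite sumrB big_split /= -!mulr_suml -mulr_sumr; ring.
Qed.

Definition l1 p q (A : 'M[R]_(p, q)) : R := \sum_i \sum_j `|A i j|.

Definition quad p (A : 'M[R]_p) (x : 'cV[R]_p) : R := (x^T *m A *m x) 0 0.

Lemma l1_ge0 p q (A : 'M[R]_(p, q)) : 0 <= l1 A.
Proof. by apply: sumr_ge0 => i _; apply: sumr_ge0. Qed.

Lemma norm_le_l1 p q (A : 'M[R]_(p, q)) i j : `|A i j| <= l1 A.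
Proof.
rewrite /l1 (bigD1 i)//= (bigD1 j)//= -addrA lerDl addr_ge0//.
  exact: sumr_ge0.
by apply: sumr_ge0 => k _; exact: sumr_ge0.
Qed.

Lemma l1M p q s (A : 'M[R]_(p, q)) (B : 'M[R]_(q, s)) : l1 (A *m B) <= l1 A * l1 B.
Proof.
rewrite /l1 mulr_suml; apply: ler_sum => i _.
apply: (@le_trans _ _ (\sum_j \sum_k `|A i k| * `|B k j|)).
  apply: ler_sum => j _; rewrite mxE; apply: le_trans (ler_norm_sum _ _ _) _.
  by apply: ler_sum => k _; rewrite normrM.
rewrite exchange_big mulr_suml; apply: ler_sum => k _ /=.
rewrite -mulr_sumr ler_wpM2l//.
rewrite (bigD1 k)//= lerDl; apply: sumr_ge0 => j _; exact: sumr_ge0.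
Qed.

Lemma l1_sq p (A : 'M[R]_p) : l1 A ^+ 2 <= p%:R ^+ 2 * \sum_i \sum_j A i j ^+ 2.
Proof.
rewrite /l1 pair_big /= [X in _ * X]pair_big /=.
have := @cauchy_schwarz ('I_p * 'I_p)%type (fun=> 1) (fun ij => `|A ij.1 ij.2|).
have -> : \sum_(ij : 'I_p * 'I_p) 1 * `|A ij.1 ij.2| = \sum_ij `|A ij.1 ij.2|.
  by apply: eq_bigr => ij _; rewrite mul1r.
have -> : \sum_(ij : 'I_p * 'I_p) (1 : R) ^+ 2 = \sum_(ij : 'I_p * 'I_p) 1.
  by apply: eq_bigr => ij _; rewrite expr1n.
have -> : \sum_(ij : 'I_p * 'I_p) `|A ij.1 ij.2| ^+ 2 = \sum_ij A ij.1 ij.2 ^+ 2.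
  by apply: eq_bigr => ij _; rewrite real_normK ?num_real.
by rewrite sumr_const card_prod card_ord natrM -expr2.
Qed.

Lemma quad_sum p (A : 'M[R]_p) (x : 'cV[R]_p) :
  quad A x = \sum_i \sum_j A i j * (x i 0 * x j 0).
Proof.
by rewrite /quad quadE; apply: eq_bigr => i _; apply: eq_bigr => j _; ring.
Qed.

Lemma quadD p (A B : 'M[R]_p) x : quad (A + B) x = quad A x + quad B x.
Proof. by rewrite /quad mulmxDr mulmxDl mxE. Qed.

Lemma quadZ p c (A : 'M[R]_p) x : quad (c *: A) x = c * quad A x.
Proof. by rewrite /quad -scalemxAr -scalemxAl mxE. Qed.

Lemma quadB p (A B : 'M[R]_p) x : quad (A - B) x = quad A x - quad B x.
Proof. by rewrite -scaleN1r quadD quadZ mulN1r. Qed.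

Lemma quad1 p (x : 'cV[R]_p) : quad 1%:M x = sqnorm x.
Proof. by rewrite /quad mulmx1 -sqnormE. Qed.

Lemma quad_gram p q (N : 'M[R]_(q, p)) x : quad (N^T *m N) x = sqnorm (N *m x).
Proof. by rewrite sqnormE /quad trmx_mul !mulmxA. Qed.

Lemma quad_delta p a b (x : 'cV[R]_p) : quad (delta_mx a b) x = x a 0 * x b 0.
Proof.
rewrite quad_sum (bigD1 a)//= (bigD1 b)//= mxE !eqxx mul1r.
rewrite big1 ?addr0 => [|j jb]; last by rewrite mxE (negbTE jb) andbF mul0r.
rewrite big1 ?addr0// => i ia; rewrite big1// => j _.
by rewrite mxE (negbTE ia) mul0r.
Qed.

Lemma l1_delta p (a b : 'I_p) : l1 (delta_mx a b) = 1.
Proof.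
rewrite /l1 (bigD1 a)//= (bigD1 b)//= mxE !eqxx normr1.
rewrite big1 ?addr0 => [|j jb]; last by rewrite mxE (negbTE jb) andbF normr0.
rewrite big1 ?addr0// => i ia; rewrite big1// => j _.
by rewrite mxE (negbTE ia) normr0.
Qed.

Lemma unit_entry p (x : 'cV[R]_p) a : sqnorm x = 1 -> `|x a 0| <= 1.
Proof.
move=> x1; rewrite -(@ler_sqr _ _ 1) ?nnegrE// expr1n.
rewrite real_normK ?num_real// -x1 /sqnorm (bigD1 a)//= lerDl.
by apply: sumr_ge0 => k _; exact: sqr_ge0.
Qed.

Lemma quad_le_l1 p (A : 'M[R]_p) x : sqnorm x = 1 -> `|quad A x| <= l1 A.
Proof.
move=> x1; rewrite quad_sum; apply: le_trans (ler_norm_sum _ _ _) _; apply: ler_sum => i _.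
apply: le_trans (ler_norm_sum _ _ _) _; apply: ler_sum => j _.
by rewrite !normrM ler_piMr// mulr_ile1// unit_entry.
Qed.

End Basics.

(** * Averages of quadratic forms under nearly uniform fourth moments *)

Section FourthMoments.
Context {R : realType} (p n : nat) (W : 'I_n -> 'cV[R]_p).

Definition m4 a b c d : R := avg (fun i => W i a 0 * W i b 0 * (W i c 0 * W i d 0)).

(* Fourth moments of the uniform distribution on the unit sphere. *)
Definition kap (a b c d : 'I_p) : R :=
  ((a == b)%:R * (c == d)%:R + (a == c)%:R * (b == d)%:R + (a == d)%:R * (b == c)%:R)
    / (p%:R * (p%:R + 2)).

Hypothesis W1 : forall i, sqnorm (W i) = 1.
Variable delta : R.
Hypothesis Wd : forall a b c d, `|m4 a b c d - kap a b c d| <= delta.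

Lemma sum_delta (F : 'I_p -> R) a : \sum_b (a == b)%:R * F b = F a.
Proof.
rewrite (bigD1 a)//= eqxx mul1r big1 ?addr0// => b ba.
by rewrite eq_sym (negbTE ba) mul0r.
Qed.

(** Both quadratic forms are expanded into entries, and each product of four coordinates costs at
    most [delta]. The last two double sums agree for symmetric matrices, but the bound is also
    applied to [delta_mx a b] and to outer products of distinct vectors. *)
Lemma avg_quad4 (A B : 'M[R]_p) :
  `|avg (fun i => quad A (W i) * quad B (W i)) -
    (\tr A * \tr B + \sum_a \sum_b A a b * B a b + \sum_a \sum_b A a b * B b a)
      / (p%:R * (p%:R + 2))| <= delta * (l1 A * l1 B).
Proof.
have -> : avg (fun i => quad A (W i) * quad B (W i)) =
    \sum_a \sum_b \sum_c \sum_d A a b * B c d * m4 a b c d.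
  under eq_avg => i.
    rewrite !quad_sum mulr_suml; under eq_bigr => a _.
      rewrite mulr_suml; under eq_bigr => b _.
        rewrite mulr_sumr; under eq_bigr => c _.
          rewrite mulr_sumr; under eq_bigr => d _.
            rewrite (_ : _ * _ = A a b * B c d * (W i a 0 * W i b 0 * (W i c 0 * W i d 0))); last ring.
          over.
        over.
      over.
    over.
  over.
  rewrite avg_sum; apply: eq_bigr => a _; rewrite avg_sum; apply: eq_bigr => b _.
  rewrite avg_sum; apply: eq_bigr => c _; rewrite avg_sum; apply: eq_bigr => d _.
  by rewrite avgZ.
have -> : (\tr A * \tr B + \sum_a \sum_b A a b * B a b + \sum_a \sum_b A a b * B b a)
    / (p%:R * (p%:R + 2)) = \sum_a \sum_b \sum_c \sum_d A a b * B c d * kap a b c d.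
  under [RHS]eq_bigr => a _.
    under eq_bigr => b _.
      have -> : \sum_c \sum_d A a b * B c d * kap a b c d =
        ((a == b)%:R * (A a b * \tr B) + A a b * B a b + A a b * B b a) / (p%:R * (p%:R + 2)).
        rewrite /kap.
        transitivity (\sum_c \sum_d
           (((a == b)%:R * (A a b / (p%:R * (p%:R + 2)))) * ((c == d)%:R * B c d) +
            (a == c)%:R * (A a b / (p%:R * (p%:R + 2)) * ((b == d)%:R * B c d)) +
            (b == c)%:R * (A a b / (p%:R * (p%:R + 2)) * ((a == d)%:R * B c d)))).
          by apply: eq_bigr => c _; apply: eq_bigr => d _; ring.
        under eq_bigr do rewrite !big_split /= -!mulr_sumr !sum_delta.
        rewrite !big_split /= -!mulr_sumr !sum_delta /mxtrace; ring.
      over.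
    rewrite -mulr_suml !big_split /= sum_delta.
    over.
  rewrite -mulr_suml !big_split /= -mulr_suml /mxtrace; ring.
rewrite -sumrB mulrC /l1 mulr_suml mulr_suml; apply: le_trans (ler_norm_sum _ _ _) _.
apply: ler_sum => a _; rewrite -sumrB mulr_suml mulr_suml; apply: le_trans (ler_norm_sum _ _ _) _.
apply: ler_sum => b _; rewrite -sumrB mulr_sumr mulr_suml; apply: le_trans (ler_norm_sum _ _ _) _.
apply: ler_sum => c _; rewrite -sumrB mulr_sumr mulr_suml; apply: le_trans (ler_norm_sum _ _ _) _.
by apply: ler_sum => d _; rewrite -mulrBr !normrM ler_wpM2l// mulr_ge0.
Qed.

(** On unit vectors [quad 1%:M] is 1, so second moments are the case [B = 1%:M] of [avg_quad4]; the
    factor [p] is the entrywise norm of the identity. *)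
Lemma avg_quad2 (A : 'M[R]_p) : (0 < p)%N ->
  `|avg (fun i => quad A (W i)) - \tr A / p%:R| <= p%:R * delta * l1 A.
Proof.
move=> p0; have := avg_quad4 A 1%:M.
have -> : l1 (1%:M : 'M[R]_p) = p%:R.
  rewrite /l1; under eq_bigr => i _.
    rewrite (bigD1 i)//= big1 => [|j ji]; first by rewrite mxE eqxx normr1 addr0; over.
    by rewrite mxE eq_sym (negbTE ji) normr0.
  by rewrite sumr_const card_ord.
under eq_avg do rewrite quad1 W1 mulr1.
have e1 : \sum_a \sum_b A a b * (1%:M : 'M[R]_p) a b = \tr A.
  apply: eq_bigr => a _; rewrite -[RHS](sum_delta (A a)); apply: eq_bigr => b _.
  by rewrite mxE mulrC.
have e2 : \sum_a \sum_b A a b * (1%:M : 'M[R]_p) b a = \tr A.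
  apply: eq_bigr => a _; rewrite -[RHS](sum_delta (A a)); apply: eq_bigr => b _.
  by rewrite mxE mulrC eq_sym.
rewrite e1 e2 mxtrace1.
have p0' : (p%:R : R) != 0 by rewrite pnatr_eq0 -lt0n.
have p2' : (p%:R + 2 : R) != 0 by rewrite gt_eqF// ltr_wpDl.
have -> : (\tr A * p%:R + \tr A + \tr A) / (p%:R * (p%:R + 2)) = \tr A / p%:R.
  by field; rewrite p0' p2'.
by rewrite mulrA mulrAC (mulrC delta).
Qed.

End FourthMoments.

(** * A priori closeness of solutions to the identity *)

Section TylerClose.
Context {R : realType} (p n : nat) (W : 'I_n -> 'cV[R]_p).
Hypothesis W1 : forall i, sqnorm (W i) = 1.
Variable delta : R.
Hypothesis Wd : forall a b c d, `|m4 W a b c d - kap a b c d| <= delta.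
Hypotheses (n0 : (0 < n)%N) (p0 : (0 < p)%N).

(** Expand the squared norm of [Y x - (x'Yx) x], which is nonnegative. *)
Lemma sqr_quad_le (Y : 'M[R]_p) x : Y^T = Y -> sqnorm x = 1 ->
  quad Y x ^+ 2 <= quad (Y *m Y) x.
Proof.
move=> Ys x1; have := sqnorm_ge0 (Y *m x - quad Y x *: x).
have vT : (Y *m x - quad Y x *: x)^T = (Y *m x)^T - quad Y x *: x^T.
  by rewrite linearB /= linearZ.
rewrite sqnormE vT mulmxBl !mulmxBr.
have -> : (Y *m x)^T *m (quad Y x *: x) = (quad Y x ^+ 2)%:M.
  by rewrite -scalemxAr trmx_mul Ys [x^T *m Y *m x]mx11_scalar scale_scalar_mx -expr2.
have -> : (quad Y x *: x^T) *m (Y *m x) = (quad Y x ^+ 2)%:M.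
  by rewrite -scalemxAl mulmxA [x^T *m Y *m x]mx11_scalar scale_scalar_mx -expr2.
have -> : (quad Y x *: x^T) *m (quad Y x *: x) = (quad Y x ^+ 2)%:M.
  rewrite -scalemxAl -scalemxAr [x^T *m x]mx11_scalar -sqnormE x1.
  by rewrite scalerA scale_scalar_mx mulr1 -expr2.
rewrite subrr subr0 mxE -sqnormE -quad_gram Ys !mxE eqxx mulr1n; lra.
Qed.

(* With [X = 1 + Y], the hypothesis on [avg] bounds the average of
   [W'Y^2W - (W'YW)^2], which is comparable to the squared norm of [Y] because
   the fourth moments are nearly uniform. *)
Lemma tyler_close (X : 'M[R]_p) :
  X^T = X -> \tr X = p%:R -> (forall i, 0 < quad X (W i)) -> l1 X <= p%:R ^+ 2 ->
  avg (fun i => quad (X *m X) (W i) / quad X (W i)) = 1 ->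
  delta <= (2 * (p%:R + 1) * (p%:R + 2) * p%:R ^+ 2)^-1 ->
  l1 (X - 1%:M) <= 2 * (p%:R + 2) * p%:R ^+ 5 * delta.
Proof.
move=> Xs Xt Xp Xl Xa dl.
set P := (p%:R : R) in Xt Xl dl *.
have P1 : 1 <= P by rewrite /P ler1n.
have d0 : 0 <= delta.
  by apply: le_trans (Wd (Ordinal p0) (Ordinal p0) (Ordinal p0) (Ordinal p0)).
pose Y := X - 1%:M.
have XE : X = 1%:M + Y by rewrite /Y addrC subrK.
have Ys : Y^T = Y by rewrite /Y linearB /= Xs trmx1.
have Yc a b : Y a b = Y b a by have /matrixP/(_ b a) := Ys; rewrite [LHS]mxE.
have Yt : \tr Y = 0 by rewrite /Y linearB /= mxtrace1 Xt subrr.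
have qX i : quad X (W i) = 1 + quad Y (W i) by rewrite XE quadD quad1 W1.
have qXX i : quad (X *m X) (W i) = quad (Y *m Y) (W i) + 2 * quad Y (W i) + 1.
  by rewrite XE mulmxDl !mulmxDr !mul1mx mulmx1 !quadD quad1 W1; ring.
pose q i := quad (Y *m Y) (W i). pose y i := quad Y (W i).
have qy i : y i ^+ 2 <= q i by exact: sqr_quad_le.
have step : avg (fun i => q i - y i ^+ 2) <= P ^+ 2 * - avg y.
  (* Averaging [(1 + 2 y + q) / (1 + y) - 1 = y + (q - y^2) / (1 + y)], whose mean is 0 by
     hypothesis. *)
  have e : avg (fun i => (q i - y i ^+ 2) / (1 + y i)) = - avg y.
    apply/eqP; rewrite -subr_eq0 opprK -avgD; apply/eqP.
    transitivity (avg (fun i => quad (X *m X) (W i) / quad X (W i) - 1)).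
      apply: eq_avg => i; rewrite qXX qX -/(q i) -/(y i).
      have : 1 + y i != 0 by rewrite /y -qX gt_eqF.
      by move=> h; field.
    by rewrite avgB Xa avg_cst// subrr.
  rewrite -e -avgZ; apply: ler_avg => i.
  have h1 : 0 < 1 + y i by rewrite /y -qX.
  have h2 : 1 + y i <= P ^+ 2.
    by rewrite /y -qX; apply: le_trans Xl; apply: le_trans (quad_le_l1 _ (W1 i)); exact: ler_norm.
  rewrite mulrA ler_pdivlMr// mulrC ler_wpM2r// subr_ge0; exact: qy.
set N := l1 Y; have N0 : 0 <= N by exact: l1_ge0.
pose F := \sum_a \sum_b Y a b ^+ 2.
have NF : N ^+ 2 <= P ^+ 2 * F := l1_sq Y.
have avy : `|avg y| <= P * delta * N.
  by have := avg_quad2 W1 Wd Y p0; rewrite Yt mul0r subr0.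
have avq : F / P - P * delta * N ^+ 2 <= avg q.
  have := avg_quad2 W1 Wd (Y *m Y) p0.
  have -> : \tr (Y *m Y) = F.
    by apply: eq_bigr => a _; rewrite mxE; apply: eq_bigr => b _; rewrite (Yc b a) expr2.
  rewrite ler_distl => /andP[h _]; apply: le_trans h; rewrite lerD2l lerN2.
  by rewrite ler_wpM2l ?mulr_ge0//?(le_trans ler01)// expr2 l1M.
have avyy : avg (fun i => y i ^+ 2) <= 2 * F / (P * (P + 2)) + delta * N ^+ 2.
  have := avg_quad4 Wd Y Y; rewrite Yt mul0r add0r.
  have -> : \sum_a \sum_b Y a b * Y a b = F by [].
  have -> : \sum_a \sum_b Y a b * Y b a = F.
    by apply: eq_bigr => a _; apply: eq_bigr => b _; rewrite (Yc b a) expr2.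
  rewrite ler_distl => /andP[_ h].
  apply: le_trans h _; rewrite -expr2 (_ : F + F = 2 * F)//; ring.
(* Under exactly uniform moments the average of [q - y^2] is [F / P - 2 F / (P (P + 2))], that is
   [F / (P + 2)]. On the other side [- avg y] is of order [delta N] because [Y] has trace 0. *)
have main : F / (P + 2) - (P + 1) * delta * N ^+ 2 <= P ^+ 3 * delta * N.
  have h1 : P ^+ 2 * - avg y <= P ^+ 3 * delta * N.
    have : - avg y <= P * delta * N by apply: le_trans avy; rewrite -normrN ler_norm.
    have P20 : 0 <= P ^+ 2 by exact: sqr_ge0.
    by move=> /(ler_wpM2l P20) h; apply: le_trans h _; rewrite le_eqVlt; apply/orP; left; apply/eqP; ring.
  rewrite avgB in step.
  have : F / (P + 2) = F / P - 2 * F / (P * (P + 2)) by field; apply/andP; split; apply/eqP; lra.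
  by move=> ->; lra.
have [N00|N00] := eqVneq N 0; first by rewrite N00; rewrite !mulr_ge0 ?exprn_ge0//; lra.
have {}N0 : 0 < N by rewrite lt0r N00.
have F1 : N ^+ 2 / (P ^+ 2 * (P + 2)) <= F / (P + 2).
  have P2p : 0 < P ^+ 2 by rewrite exprn_gt0//; lra.
  rewrite invfM mulrA; apply: ler_wpM2r; first by rewrite invr_ge0; lra.
  by rewrite ler_pdivrMr// mulrC.
(* The smallness of [delta] lets the moment error absorb at most half of the quadratic term;
   dividing the remaining half by [N] gives a bound linear in [delta]. *)
have dl2 : (P + 1) * delta <= (2 * (P + 2) * P ^+ 2)^-1.
  have h : 0 < P + 1 by lra.
  move: dl => /(ler_wpM2l (ltW h)) dl; apply: le_trans dl _.
  rewrite le_eqVlt; apply/orP; left; apply/eqP; field.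
  by repeat (apply/andP; split); apply/eqP; lra.
have : N ^+ 2 * (2 * (P + 2) * P ^+ 2)^-1 <= P ^+ 3 * delta * N.
  apply: le_trans main.
  have : (P + 1) * delta * N ^+ 2 <= (2 * (P + 2) * P ^+ 2)^-1 * N ^+ 2 by rewrite ler_wpM2r ?sqr_ge0.
  have : N ^+ 2 / (P ^+ 2 * (P + 2)) = 2 * (N ^+ 2 * (2 * (P + 2) * P ^+ 2)^-1).
    by field; repeat (apply/andP; split); apply/eqP; lra.
  lra.
rewrite expr2 -mulrA [P ^+ 3 * _ * N]mulrC ler_pM2l//.
rewrite ler_pdivrMr; last by rewrite !mulr_gt0 ?exprn_gt0//; lra.
by move=> h; apply: le_trans h _; rewrite le_eqVlt; apply/orP; left; apply/eqP; ring.
Qed.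

End TylerClose.

(** Matrices as a complete normed space, the setting of the fixed point theorem applied to
    [tylerPhi]. *)
HB.instance Definition _ (R : realType) (m n : nat) :=
  Uniform_isComplete.Build 'M[R]_(m.+1, n.+1) (@mx_complete R m.+1 n.+1).

(** * A contraction for Tyler's equation near the identity *)

Section TylerExists.
Context {R : realType}.

Lemma mx_norm_entry m n (A : 'M[R]_(m.+1, n.+1)) i j : `|A i j| <= `|A|.
Proof. by rewrite -[`|A|]/(mx_norm A) mx_normrE; exact: (le_bigmax _ (fun x => `|A x.1 x.2|) (i, j)). Qed.

Lemma mx_norm_le m n (A : 'M[R]_(m.+1, n.+1)) c : 0 <= c ->
  (forall i j, `|A i j| <= c) -> `|A| <= c.
Proof. by move=> c0 h; rewrite -[`|A|]/(mx_norm A) mx_normrE; apply: bigmax_le. Qed.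

Lemma l1_le_norm m (A : 'M[R]_m.+1) : l1 A <= m.+1%:R ^+ 2 * `|A|.
Proof.
rewrite /l1 (@le_trans _ _ (\sum_(i < m.+1) \sum_(j < m.+1) `|A|))//.
  by apply: ler_sum => i _; apply: ler_sum => j _; exact: mx_norm_entry.
by rewrite !sumr_const !card_ord -mulrnA -[`|A| *+ _]mulr_natl natrM expr2.
Qed.

Lemma quad_le_l1_gen p (A : 'M[R]_p) x : `|quad A x| <= l1 A * sqnorm x.
Proof.
rewrite quad_sum; apply: le_trans (ler_norm_sum _ _ _) _; rewrite /l1 mulr_suml; apply: ler_sum => i _.
apply: le_trans (ler_norm_sum _ _ _) _; rewrite mulr_suml; apply: ler_sum => j _.
rewrite normrM ler_wpM2l//.
have e k : x k 0 ^+ 2 <= sqnorm x.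
  rewrite /sqnorm (bigD1 k)//= lerDl; apply: sumr_ge0 => l _; exact: sqr_ge0.
have := e i; have := e j; rewrite ler_norml.
have := sqr_ge0 (x i 0 + x j 0); have := sqr_ge0 (x i 0 - x j 0).
by rewrite !sqrrD => ? ? ? ?; apply/andP; split; lra.
Qed.

Lemma ler_norm_half (u v x y c : R) : `|u - x| <= c -> `|v - y| <= c ->
  `|(u + v) / 2 - (x + y) / 2| <= c.
Proof. by rewrite !ler_norml => /andP[? ?] /andP[? ?]; apply/andP; split; lra. Qed.

(** Over the common denominator [Q >= 1/2] the remainder has numerator at most
    [2 N * 3 rho + 2 rho N = 8 rho N], whence the 16. *)
Lemma ratio_linearization (al be w sB sD N rho : R) : 0 <= N -> rho <= 1/4 ->
  `|w| <= 1 -> `|sD| <= N -> `|al - be| <= N -> `|al| <= rho -> `|be| <= rho -> `|sB| <= rho ->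
  `|(w + (sB + sD)) / (1 + al) - (w + sB) / (1 + be) - (sD - w * (al - be))| <= 16 * rho * N.
Proof.
move=> N0 r4 w1 sD1 d1 al1 be1 sB1.
have r0 : 0 <= rho by exact: le_trans al1.
set d := al - be in d1 *.
have alE : al = be + d by rewrite /d addrC subrK.
have /andP[al1' al2] : - rho <= al <= rho by rewrite -ler_norml.
have /andP[be1' be2] : - rho <= be <= rho by rewrite -ler_norml.
have a0 : 0 < 1 + al by lra.
have b0 : 0 < 1 + be by lra.
pose Q := (1 + al) * (1 + be).
have Q12 : 1 / 2 <= Q by rewrite /Q; nra.
have Q0 : 0 < Q by lra.
pose e := sD * be - sB * d.
have -> : (w + (sB + sD)) / (1 + al) - (w + sB) / (1 + be) - (sD - w * d) =
   ((sD - w * d) * (1 - Q) + e) / Q.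
  by rewrite /Q /e alE; field; rewrite -alE !gt_eqF.
have dd : `|w * d| <= N by rewrite normrM (le_trans _ d1)// ler_piMl.
have m1 : `|sD - w * d| <= 2 * N by apply: le_trans (ler_normB _ _) _; lra.
have Q1 : `|1 - Q| <= 3 * rho by rewrite /Q ler_norml; apply/andP; split; nra.
have e1 : `|e| <= 2 * rho * N.
  apply: le_trans (ler_normB _ _) _; rewrite !normrM.
  have : `|sD| * `|be| <= N * rho by rewrite ler_pM.
  have : `|sB| * `|d| <= rho * N by rewrite ler_pM.
  lra.
rewrite normrM normfV (gtr0_norm Q0) ler_pdivrMr//.
apply: le_trans (ler_normD _ _) _; rewrite normrM.
have : `|sD - w * d| * `|1 - Q| <= 2 * N * (3 * rho) by rewrite ler_pM.
have : 16 * rho * N * (1 / 2) <= 16 * rho * N * Q by rewrite ler_wpM2l// !mulr_ge0.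
lra.
Qed.

Lemma quad_delta_mul p (D : 'M[R]_p) a b w :
  quad (delta_mx a b *m D) w = w a 0 * \sum_c D b c * w c 0.
Proof.
have dE i j : (delta_mx a b *m D) i j = (i == a)%:R * D b j.
  rewrite mxE (bigD1 b)//= big1 ?addr0 => [|c cb]; first by rewrite mxE eqxx andbT.
  by rewrite mxE (negbTE cb) andbF mul0r.
rewrite quad_sum (bigD1 a)//= [X in _ + X]big1 ?addr0 => [|i ia]; last first.
  by rewrite big1// => j _; rewrite dE (negbTE ia) !mul0r.
by rewrite mulr_sumr; apply: eq_bigr => j _; rewrite dE eqxx mul1r; ring.
Qed.

Lemma mxtrace_delta_mul p (D : 'M[R]_p) a b : \tr (delta_mx a b *m D) = D b a.
Proof.
rewrite /mxtrace (bigD1 a)//= [X in _ + X]big1 ?addr0 => [|j ja]; last first.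
  by rewrite mxE big1// => c _; rewrite mxE (negbTE ja) mul0r.
rewrite mxE (bigD1 b)//= big1 ?addr0 => [|c cb]; first by rewrite mxE !eqxx mul1r.
by rewrite mxE (negbTE cb) andbF mul0r.
Qed.

Lemma mxtrace_delta p (a b : 'I_p) : \tr (delta_mx a b : 'M[R]_p) = (a == b)%:R.
Proof. by rewrite -[delta_mx a b]mulmx1 mxtrace_delta_mul mxE eq_sym. Qed.

Context (m n : nat) (W : 'I_n -> 'cV[R]_m.+1).
Let P : R := m.+1%:R.
Hypothesis W1 : forall i, sqnorm (W i) = 1.
Variable delta : R.
Hypothesis Wd : forall a b c d, `|m4 W a b c d - kap a b c d| <= delta.
Hypotheses (n0 : (0 < n)%N).

(** Entry [(a, b)] of the symmetric part of [w (A w)']. *)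
Definition tylerS (A : 'M[R]_m.+1) a b (w : 'cV[R]_m.+1) : R :=
  (quad (delta_mx a b *m A) w + quad (delta_mx b a *m A) w) / 2.

(** For a unit vector [w] and [X = 1 + A], entry [(a, b)] of the symmetric part of
    [w (X w)' / w'Xw]. Symmetrising makes every fixed point of [tylerPhi] a symmetric matrix; the
    antisymmetric part of the equation is recovered afterwards. *)
Definition tylerT (A : 'M[R]_m.+1) a b (w : 'cV[R]_m.+1) : R :=
  (w a 0 * w b 0 + tylerS A a b w) / (1 + quad A w).

(* A Newton step at the identity: its linear part vanishes when the fourth
   moments are exactly those of the uniform distribution on the sphere. *)
Definition tylerPhi (A : 'M[R]_m.+1) : 'M[R]_m.+1 := \matrix_(a, b)
  ((A a b + A b a) / 2 - (P + 2) * (avg (fun i => tylerT A a b (W i)) - (a == b)%:R / P)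
   - (a == b)%:R * \tr A / P).

(** Radius of the ball of the contraction. With [rho = P^2 r], a bound of the entrywise norm on that
    ball, the remainder of [ratio_linearization] contributes exactly 1/4 to the Lipschitz
    constant. *)
Let r : R := (64 * (P + 2) * P ^+ 4)^-1.

Lemma tylerSD A B a b w : tylerS (A + B) a b w = tylerS A a b w + tylerS B a b w.
Proof. by rewrite /tylerS !mulmxDr !quadD; field. Qed.

Lemma tylerS_le A a b w : sqnorm w = 1 -> `|tylerS A a b w| <= l1 A.
Proof.
move=> w1; rewrite /tylerS normrM [`|2^-1|]ger0_norm ?invr_ge0// ler_pdivrMr//.
apply: le_trans (ler_normD _ _) _.
have h c d : `|quad (delta_mx c d *m A) w| <= l1 A.
  by apply: le_trans (quad_le_l1 _ w1) _; apply: le_trans (l1M _ _) _; rewrite l1_delta mul1r.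
have := h a b; have := h b a; lra.
Qed.

(** The constant 1/2 is 1/4 from the nonlinearity, by the choice of [r], plus 1/4 from the deviation
    of the moments, by the bound on [delta]. *)
Lemma tylerPhi_lip A B : `|A| <= r -> `|B| <= r ->
  delta <= (4 * (P + 2) * (P + 1) * P ^+ 2)^-1 ->
  `|tylerPhi A - tylerPhi B| <= 1 / 2 * `|A - B|.
Proof.
move=> Ar Br dl; have P1 : 1 <= P by rewrite /P ler1n.
set D := A - B. have AE : A = B + D by rewrite /D addrC subrK.
apply: mx_norm_le => [|a b]; first by rewrite mulr_ge0.
pose N := l1 D; have N0 : 0 <= N := l1_ge0 _.
pose rho := P ^+ 2 * r.
have ND : N <= P ^+ 2 * `|D| := l1_le_norm D.
have P20 : 0 <= P ^+ 2 by exact: sqr_ge0.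
have lA : l1 A <= rho by apply: le_trans (l1_le_norm A) _; rewrite ler_wpM2l.
have lB : l1 B <= rho by apply: le_trans (l1_le_norm B) _; rewrite ler_wpM2l.
have rhoE : (P + 2) * (16 * rho) * P ^+ 2 = 1 / 4.
  by rewrite /rho /r; field; apply/andP; split; apply/eqP; lra.
have rho0 : 0 <= rho by apply: le_trans lA; exact: l1_ge0.
have rho4 : rho <= 1 / 4.
  have : 1 <= (P + 2) * 16 * P ^+ 2 by nra.
  move=> /(ler_wpM2r rho0); rewrite mul1r; move: rhoE.
  rewrite (_ : (P + 2) * (16 * rho) * P ^+ 2 = (P + 2) * 16 * P ^+ 2 * rho); last ring.
  lra.
clearbody rho.
(* Derivative of [tylerT] at [A = 0] in the direction [D]. *)
pose m0 i := tylerS D a b (W i) - W i a 0 * W i b 0 * quad D (W i).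
have lin : `|avg (fun i => tylerT A a b (W i)) - avg (fun i => tylerT B a b (W i)) - avg m0| <= 16 * rho * N.
  rewrite -!avgB; apply: ler_norm_avg => [|i]; first by rewrite !mulr_ge0.
  rewrite /tylerT {1}AE tylerSD /m0.
  have -> : quad D (W i) = quad A (W i) - quad B (W i) by rewrite -quadB.
  apply: ratio_linearization => //.
  - by rewrite normrM mulr_ile1// unit_entry.
  - exact: tylerS_le.
  - by rewrite -quadB quad_le_l1.
  - by apply: le_trans lA; exact: quad_le_l1.
  - by apply: le_trans lB; exact: quad_le_l1.
  - by apply: le_trans lB; exact: tylerS_le.
have avS : `|avg (fun i => tylerS D a b (W i)) - (D a b + D b a) / (2 * P)| <= P * delta * N.
  have h c d : `|avg (fun i => quad (delta_mx c d *m D) (W i)) - D d c / P| <= P * delta * N.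
    have := avg_quad2 W1 Wd (delta_mx c d *m D) (ltn0Sn m).
    rewrite mxtrace_delta_mul => h; apply: le_trans h _.
    rewrite ler_wpM2l ?mulr_ge0//; first by apply: le_trans (Wd 0 0 0 0).
    by apply: le_trans (l1M _ _) _; rewrite l1_delta mul1r.
  have e : avg (fun i => tylerS D a b (W i)) = (avg (fun i => quad (delta_mx a b *m D) (W i)) +
     avg (fun i => quad (delta_mx b a *m D) (W i))) / 2.
    by rewrite -avgD mulrC -avgZ; apply: eq_avg => i; rewrite /tylerS mulrC.
  have := h a b; have := h b a; rewrite e.
  have -> : (D a b + D b a) / (2 * P) = (D b a / P + D a b / P) / 2.
    by field; apply/eqP; lra.
  by move=> hba hab; exact: (ler_norm_half hab hba).
have av4 : `|avg (fun i => W i a 0 * W i b 0 * quad D (W i)) -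
    ((a == b)%:R * \tr D + D a b + D b a) / (P * (P + 2))| <= delta * N.
  have := avg_quad4 Wd (delta_mx a b) D; rewrite l1_delta mul1r mxtrace_delta.
  under eq_avg do rewrite quad_delta.
  have sd (F : 'I_m.+1 -> 'I_m.+1 -> R) : \sum_c \sum_d (delta_mx a b : 'M[R]_m.+1) c d * F c d = F a b.
    rewrite (bigD1 a)//= (bigD1 b)//= mxE !eqxx mul1r.
    rewrite big1 ?addr0 => [|j jb]; last by rewrite mxE (negbTE jb) andbF mul0r.
    rewrite big1 ?addr0// => i ia; rewrite big1// => j _.
    by rewrite mxE (negbTE ia) mul0r.
  by rewrite (sd D) (sd (fun c d => D d c)).
rewrite !mxE.
(* Since [1 / (2 P) - 1 / (P (P + 2)) = 1 / (2 (P + 2))], the uniform value of the mean of [m0],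
   times [P + 2], is the symmetric part of [D] minus its trace part. This cancels the other terms of
   [tylerPhi], so that only errors are left. *)
have -> : ((A a b + A b a) / 2 - (P + 2) * (avg (fun i => tylerT A a b (W i)) - (a == b)%:R / P)
   - (a == b)%:R * \tr A / P) - ((B a b + B b a) / 2 -
   (P + 2) * (avg (fun i => tylerT B a b (W i)) - (a == b)%:R / P) - (a == b)%:R * \tr B / P) =
   - (P + 2) * ((avg (fun i => tylerT A a b (W i)) - avg (fun i => tylerT B a b (W i)) - avg m0) +
     (avg (fun i => tylerS D a b (W i)) - (D a b + D b a) / (2 * P)) -
     (avg (fun i => W i a 0 * W i b 0 * quad D (W i)) -
    ((a == b)%:R * \tr D + D a b + D b a) / (P * (P + 2)))).
  rewrite {1}/m0 avgB AE linearD /= !mxE.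
  by field; apply/andP; split; apply/eqP; lra.
rewrite normrM [`|- (P + 2)|]normrN [`|P + 2|]ger0_norm; last lra.
have -> : 1 / 2 * `|D| = (P + 2) * (1 / 2 * `|D| / (P + 2)) by field; apply/eqP; lra.
rewrite ler_wpM2l//; first lra.
apply: (@le_trans _ _ (16 * rho * N + P * delta * N + delta * N)).
  apply: le_trans (ler_normB _ _) _; apply: lerD => //.
  by apply: le_trans (ler_normD _ _) _; exact: lerD.
rewrite ler_pdivlMr; last lra.
have dl2 : (P + 2) * (P + 1) * delta * P ^+ 2 <= 1 / 4.
  have h : 0 <= (P + 2) * (P + 1) * P ^+ 2 by rewrite !mulr_ge0//; lra.
  move: dl => /(ler_wpM2l h) dl; rewrite mulrAC; apply: le_trans dl _.
  by rewrite le_eqVlt; apply/orP; left; apply/eqP; field; repeat (apply/andP; split); apply/eqP; lra.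
have d0 : 0 <= delta by apply: le_trans (Wd 0 0 0 0).
have : ((P + 2) * (16 * rho) + (P + 2) * (P + 1) * delta) * N <=
   ((P + 2) * (16 * rho) + (P + 2) * (P + 1) * delta) * (P ^+ 2 * `|D|).
  by rewrite ler_wpM2l// addr_ge0// !mulr_ge0//; lra.
have : ((P + 2) * (16 * rho) * P ^+ 2 + (P + 2) * (P + 1) * delta * P ^+ 2) * `|D| <= 1 / 2 * `|D|.
  by rewrite ler_wpM2r//; lra.
lra.
Qed.

Lemma tylerPhi0 : `|tylerPhi 0| <= (P + 2) * (P * delta).
Proof.
have P1 : 1 <= P by rewrite /P ler1n.
have d0 : 0 <= delta by apply: le_trans (Wd 0 0 0 0).
apply: mx_norm_le => [|a b]; first by rewrite !mulr_ge0//; lra.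
rewrite !mxE linear0 mulr0 mul0r subr0 addr0 mul0r add0r normrN normrM ger0_norm; last lra.
rewrite ler_wpM2l//; first lra.
have := avg_quad2 W1 Wd (delta_mx a b) (ltn0Sn m); rewrite mxtrace_delta l1_delta mulr1.
congr (`|avg _ - _| <= _); apply/funext => i.
rewrite /tylerT /tylerS !mulmx0 quad_delta.
have -> : quad 0 (W i) = 0 by rewrite /quad mulmx0 mul0mx mxE.
by rewrite !addr0 mul0r addr0 divr1.
Qed.

(** The ball is stable because 0 moves by at most [r / 2] and distances to 0 are halved. *)
Lemma tyler_fixpoint : delta <= (4 * (P + 2) * (P + 1) * P ^+ 2)^-1 ->
  (P + 2) * (P * delta) <= r / 2 ->
  exists2 A, `|A| <= r & A = tylerPhi A.
Proof.
move=> d1 d2; have P1 : 1 <= P by rewrite /P ler1n.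
have r0 : 0 < r by rewrite /r invr_gt0 !mulr_gt0 ?exprn_gt0//; lra.
pose U := [set A : 'M[R]_m.+1 | `|A| <= r].
have Uf : set_fun U U tylerPhi.
  move=> A; rewrite /U /= => Ar; have z0 : `|0 : 'M[R]_m.+1| <= r by rewrite normr0 ltW.
  have := tylerPhi_lip Ar z0 d1; rewrite subr0 => h.
  have := ler_normD (tylerPhi A - tylerPhi 0) (tylerPhi 0); rewrite subrK.
  have := tylerPhi0; lra.
have Uc : is_contraction [fun of mkfun Uf].
  have h12 : 0 <= 1 / 2 :> R by lra.
  exists (NngNum h12); split => /=; first lra.
  move=> [A B] /= [Ar Br]; exact: tylerPhi_lip.
have [|//|A Ar AE] := banach_fixed_point Uc.
- have -> : U = closed_ball_ Num.Def.normr 0 r.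
    by apply/seteqP; split => A /=; rewrite /closed_ball_ /= sub0r normrN.
  exact: closed_closed_ball_.
- by exists 0; rewrite /U /= normr0 ltW.
- by exists A.
Qed.

End TylerExists.

(** * From the symmetrised equation to the full one *)

Section Sylvester.
Context {R : realType}.

Lemma add_halves (x : R) : (x + x) / 2 = x.
Proof. by field. Qed.

Lemma posdef_quad_gt0 p (X : 'M[R]_p) x : posdef X -> x != 0 -> 0 < quad X x.
Proof. by case=> _; exact. Qed.

Lemma posdef_quad_ge0 p (X : 'M[R]_p) x : posdef X -> 0 <= quad X x.
Proof.
move=> Xp; have [->|x0] := eqVneq x 0; last exact: ltW (posdef_quad_gt0 Xp x0).
by rewrite /quad mulmx0 mxE.
Qed.

Lemma posdef_quad_eq0 p (X : 'M[R]_p) x : posdef X -> quad X x = 0 -> x = 0.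
Proof.
move=> Xp q0; apply: contraPP q0 => /eqP x0; apply/eqP; rewrite gt_eqF//.
exact: posdef_quad_gt0.
Qed.

Lemma mxtrace_quad p q (X : 'M[R]_p) (N : 'M[R]_(p, q)) :
  \tr (N^T *m X *m N) = \sum_j quad X (col j N).
Proof.
apply: eq_bigr => j _; rewrite /quad tr_col -row_mul [LHS]mxE [RHS]mxE.
by apply: eq_bigr => i _; rewrite !mxE.
Qed.

Lemma posdef_trace_eq0 p q (X : 'M[R]_p) (N : 'M[R]_(p, q)) : posdef X ->
  \tr (N^T *m X *m N) <= 0 -> N = 0.
Proof.
move=> Xp; rewrite mxtrace_quad => h.
have /psumr_eq0P e : \sum_j quad X (col j N) = 0.
  by apply/eqP; rewrite eq_le h sumr_ge0// => j _; exact: posdef_quad_ge0.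
apply/matrixP => i j; rewrite mxE.
have /(posdef_quad_eq0 Xp)/colP/(_ i) := e (fun j _ => posdef_quad_ge0 _ Xp) j isT.
by rewrite !mxE.
Qed.

(* A fixed point of [tylerPhi] only controls the symmetric part of [S *m X]. *)
Lemma sylvester_scalar p (S X : 'M[R]_p) c : S^T = S -> posdef X ->
  S *m X + X *m S = (2 * c)%:M -> S *m X = c%:M.
Proof.
move=> Ss Xp; have Xs := Xp.1; move=> h.
pose N := S *m X - c%:M.
have NT : N^T = - N.
  have h2 : (2 * c)%:M = c%:M + c%:M :> 'M[R]_p by rewrite -raddfD /= mulr_natl mulr2n.
  rewrite /N linearB /= trmx_mul Xs Ss tr_scalar_mx; apply/eqP.
  by rewrite -addr_eq0 addrACA (addrC (X *m S)) h h2 -opprD subrr.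
have XN : X *m N = - (N *m X).
  rewrite /N mulmxBl mulmxBr mul_mx_scalar mul_scalar_mx.
  have -> : X *m (S *m X) = (2 * c) *: X - S *m X *m X.
    by rewrite mulmxA; have := congr1 (fun M => M *m X) h; rewrite mulmxDl mul_scalar_mx => <-; rewrite addrC addKr.
  by apply/matrixP => i j; rewrite !mxE; lra.
(* As [X N = - N X], the trace of [N'XN] is minus that of [N X N']; both are traces of nonnegative
   forms. *)
have N0 : N = 0.
  apply: (posdef_trace_eq0 Xp).
  rewrite -mulmxA XN mulmxN linearN /= oppr_le0 mxtrace_mulC.
  have := mxtrace_quad X N^T; rewrite trmxK => ->.
  by apply: sumr_ge0 => j _; exact: posdef_quad_ge0.
by apply/eqP; rewrite -subr_eq0 -/N N0.
Qed.

End Sylvester.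

(** * Existence of a solution *)

Section TylerEquation.
Context {R : realType} (m n : nat) (W : 'I_n -> 'cV[R]_m.+1).
Let P : R := m.+1%:R.
Hypothesis W1 : forall i, sqnorm (W i) = 1.
Variable delta : R.
Hypothesis Wd : forall a b c d, `|m4 W a b c d - kap a b c d| <= delta.
Hypotheses (n0 : (0 < n)%N).
Let r : R := (64 * (P + 2) * P ^+ 4)^-1.

Lemma tylerT_sym (A : 'M[R]_m.+1) a b w : tylerT A a b w = tylerT A b a w.
Proof. by rewrite /tylerT /tylerS [w a 0 * _]mulrC [quad _ w + _]addrC. Qed.

(** The matrix [w (X w)' / w'Xw] has trace 1. This is what forces fixed points of [tylerPhi] to have
    trace 0. *)
Lemma tylerT_tr (A : 'M[R]_m.+1) w : sqnorm w = 1 -> 1 + quad A w != 0 ->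
  \sum_a tylerT A a a w = 1.
Proof.
move=> w1 q0; rewrite /tylerT -mulr_suml big_split /=.
have -> : \sum_(i < m.+1) w i 0 * w i 0 = 1 by rewrite -w1; apply: eq_bigr => i _; rewrite expr2.
have -> : \sum_i tylerS A i i w = quad A w.
  rewrite quad_sum; apply: eq_bigr => a _; rewrite /tylerS add_halves quad_delta_mul mulr_sumr.
  by apply: eq_bigr => b _; ring.
by rewrite mulfV.
Qed.

Lemma tyler_exists : delta <= (4 * (P + 2) * (P + 1) * P ^+ 2)^-1 ->
  (P + 2) * (P * delta) <= r / 2 ->
  exists X : 'M[R]_m.+1, posdef X /\
   (\matrix_(a, b) avg (fun i => W i a 0 * W i b 0 / quad X (W i))) *m X = (P^-1)%:M.
Proof.
move=> d1 d2; have P1 : 1 <= P by rewrite /P ler1n.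
have [A Ar AE] := tyler_fixpoint W1 Wd d1 d2.
have Aab a b : A a b = (A a b + A b a) / 2 - (P + 2) * (avg (fun i => tylerT A a b (W i)) - (a == b)%:R / P)
   - (a == b)%:R * \tr A / P by rewrite {1}AE mxE.
have As : A^T = A.
  apply/matrixP => a b; rewrite mxE Aab [RHS]Aab (addrC (A b a)) (eq_sym b).
  have -> // : avg (fun i => tylerT A b a (W i)) = avg (fun i => tylerT A a b (W i)).
  by apply: eq_avg => i; exact: tylerT_sym.
have Ac a b : A a b = A b a by have /matrixP/(_ b a) := As; rewrite [LHS]mxE.
have lA : l1 A <= 1 / 4.
  apply: le_trans (l1_le_norm A) _.
  apply: (@le_trans _ _ (P ^+ 2 * r)); first by rewrite ler_wpM2l ?sqr_ge0.
  rewrite /r ler_pdivrMr; last by rewrite !mulr_gt0 ?exprn_gt0//; lra.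
  have P20 : 0 <= P ^+ 2 := sqr_ge0 _.
  have : P ^+ 2 * 1 <= P ^+ 2 * (16 * (P + 2) * P ^+ 2) by rewrite ler_wpM2l//; nra.
  lra.
pose X := 1%:M + A.
have qX x : quad X x = sqnorm x + quad A x by rewrite quadD quad1.
have Xp : posdef X.
  split; first by rewrite /X linearD /= trmx1 As.
  move=> x x0; rewrite -/(quad X x) qX.
  have := quad_le_l1_gen A x; have := sqnorm_gt0 x; rewrite x0 ler_norml => s0 /andP[h _].
  have : l1 A * sqnorm x <= 1 / 4 * sqnorm x by rewrite ler_wpM2r// sqnorm_ge0.
  lra.
have q0 i : 1 + quad A (W i) != 0.
  rewrite -[X in X + _](W1 i) -qX gt_eqF// posdef_quad_gt0//.
  by rewrite -sqnorm_gt0 W1.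
(* Tracing the fixed point equation, the middle term vanishes by [tylerT_tr] and there remains
   [tr A = tr A - tr A]. *)
have trA : \tr A = 0.
  have : \tr A = \sum_a ((A a a + A a a) / 2 - (P + 2) * (avg (fun i => tylerT A a a (W i)) - 1 / P)
     - 1 * \tr A / P).
    by apply: eq_bigr => a _; rewrite {1}Aab eqxx.
  rewrite !sumrB -mulr_sumr sumrB -avg_sum.
  rewrite (eq_avg (g := fun=> 1)) => [|i]; last exact: tylerT_tr.
  have sc (x : R) : \sum_(i < m.+1) x = P * x.
    by rewrite sumr_const card_ord -[x *+ _]mulr_natl.
  rewrite avg_cst// !sc.
  have -> : \sum_(i < m.+1) (A i i + A i i) / 2 = \tr A.
    by apply: eq_bigr => i _; rewrite add_halves.
  have -> : P * (1 / P) = 1 by field; apply/eqP; lra.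
  have -> : P * (1 * \tr A / P) = \tr A by field; apply/eqP; lra.
  lra.
have avT a b : avg (fun i => tylerT A a b (W i)) = (a == b)%:R / P.
  have := Aab a b; rewrite trA (Ac b a) add_halves mulr0 mul0r subr0 => h.
  apply/eqP; rewrite -subr_eq0; apply/eqP.
  have : (P + 2) * (avg (fun i => tylerT A a b (W i)) - (a == b)%:R / P) = 0.
    by have := congr1 (fun t => A a b - t) h; rewrite /= subrr subKr => <-.
  by move/eqP; rewrite mulf_eq0 => /orP[/eqP ?|/eqP//]; exfalso; lra.
exists X; split => //.
pose S : 'M[R]_m.+1 := \matrix_(a, b) avg (fun i => W i a 0 * W i b 0 / quad X (W i)).
rewrite -/S; apply: sylvester_scalar => //.
  by apply/matrixP => a b; rewrite !mxE; apply: eq_avg => i; rewrite (mulrC (W i b 0)).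
have SA a b : (S *m A) a b = avg (fun i => quad (delta_mx a b *m A) (W i) / (1 + quad A (W i))).
  rewrite mxE; under eq_bigr => c _ do rewrite mxE mulrC -avgZ.
  rewrite -avg_sum; apply: eq_avg => i; rewrite quad_delta_mul mulr_sumr mulr_suml.
  by apply: eq_bigr => c _; rewrite qX W1 (Ac c b); ring.
have AS a b : (A *m S) a b = (S *m A) b a.
  have -> : A *m S = (S *m A)^T.
    rewrite trmx_mul As; congr (_ *m _).
    by apply/matrixP => c d; rewrite !mxE; apply: eq_avg => i; rewrite (mulrC (W i c 0)).
  by rewrite mxE.
apply/matrixP => a b; rewrite /X mulmxDr mulmxDl mulmx1 mul1mx.
have addE (B C : 'M[R]_m.+1) : (B + C) a b = B a b + C a b by rewrite mxE.
rewrite !addE AS [RHS]mxE.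
have := avT a b.
(* The averages of [tylerT] are the entries of the symmetric part of [S X]; these are now known, and
   [sylvester_scalar] does the rest. *)
have -> : avg (fun i => tylerT A a b (W i)) = S a b + ((S *m A) a b + (S *m A) b a) / 2.
  rewrite !SA [_ / 2]mulrC -avgD -avgZ mxE -avgD; apply: eq_avg => i.
  by rewrite qX W1 /tylerT /tylerS; field; exact: q0.
move: (S a b) ((S *m A) a b) ((S *m A) b a) => x y z h.
by rewrite -[RHS]mulr_natr mulrAC -[RHS]mulrA -h; field.
Qed.

End TylerEquation.

(** * Square roots, spectral sums and Gram-Schmidt *)

Section Sqrt.
Context {R : realType}.

Lemma continuous_sumr (T : topologicalType) (I : Type) (s : seq I) (F : I -> T -> R) :
  (forall i, continuous (F i)) -> continuous (fun x => \sum_(i <- s) F i x).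
Proof.
move=> cF; elim: s => [|i s IH] x.
  by under eq_fun do rewrite big_nil; exact: cvg_cst.
by under eq_fun do rewrite big_cons; apply: cvgD; [exact: cF|exact: IH].
Qed.

Lemma sqnorm0 p : sqnorm (0 : 'cV[R]_p) = 0.
Proof. by apply/eqP; rewrite sqnorm_eq0. Qed.

Lemma continuous_quad_row n (V : 'M[R]_n) : continuous (fun x : 'rV[R]_n => quad V x^T).
Proof.
rewrite (_ : (fun x => _) = fun x : 'rV[R]_n => \sum_i \sum_j V i j * (x 0 i * x 0 j)); last first.
  by apply/funext => x; rewrite quad_sum; apply: eq_bigr => i _; apply: eq_bigr => j _; rewrite !mxE.
apply: continuous_sumr => i; apply: continuous_sumr => j x.
have ci l : {for x, continuous (fun y : 'rV[R]_n => y 0 l)} by exact: coord_continuous.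
exact: (cvgM (cvg_cst (V i j)) (cvgM (ci i) (ci j))).
Qed.

(** Compactness of the unit sphere, then homogeneity of the form. Row vectors are used because the
    extreme value theorem is applied in that form. *)
Lemma max_quad n (V : 'M[R]_n.+1) : exists v : 'cV[R]_n.+1, sqnorm v = 1 /\
  forall x, quad V x <= quad V v * sqnorm x.
Proof.
pose A := [set x : 'rV[R]_n.+1 | sqnorm x^T = 1].
have cA : compact A.
  apply: bounded_closed_compact.
    exists 1; split => // M M1 x /= x1; apply: (le_trans _ (ltW M1)).
    rewrite -[`|x|]/(mx_norm x) mx_normrE; apply: bigmax_le => // -[i j] _ /=.
    by have := unit_entry j x1; rewrite mxE ord1.
  rewrite (_ : A = (fun x => quad 1%:M x^T) @^-1` [set 1]); last first.
    by apply/seteqP; split => x /=; rewrite /A /= quad1.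
  apply: closed_comp; first by move=> x _; exact: continuous_quad_row.
  exact: closed_eq.
have A0 : A !=set0.
  exists (delta_mx 0 0); rewrite /A /= trmx_delta sqnormE trmx_delta mul_delta_mx.
  by rewrite mxE !eqxx.
have [|c + cm] := EVT_max_rV A0 cA (f := fun x => quad V x^T).
  by apply: continuous_subspaceT; exact: continuous_quad_row.
rewrite inE /A /= => c1.
exists c^T; split => // x.
have [->|x0] := eqVneq x 0.
  by rewrite sqnorm0 mulr0 /quad mulmx0 mxE.
have s0 : 0 < sqnorm x by rewrite sqnorm_gt0.
pose y := (vnorm x)^-1 *: x.
have yA : y^T \in A.
  rewrite inE /A /= trmxK sqnormZ exprVn vnorm_sq mulVf// gt_eqF//.
have := cm _ yA; rewrite trmxK /y.
have qZ (a : R) (z : 'cV[R]_n.+1) : quad V (a *: z) = a ^+ 2 * quad V z.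
  by rewrite !quad_sum mulr_sumr; apply: eq_bigr => i _; rewrite mulr_sumr; apply: eq_bigr => j _; rewrite !mxE; ring.
by rewrite qZ exprVn vnorm_sq mulrC ler_pdivrMr.
Qed.

Lemma bilin_quad p (V : 'M[R]_p) x y t : V^T = V ->
  quad V (x + t *: y) = quad V x + 2 * t * (y^T *m V *m x) 0 0 + t ^+ 2 * quad V y.
Proof.
move=> Vs; have aT : (x + t *: y)^T = x^T + t *: y^T by rewrite linearD linearZ.
have e : (x^T *m V *m y) 0 0 = (y^T *m V *m x) 0 0.
  rewrite !quadE exchange_big; apply: eq_bigr => i _; apply: eq_bigr => j _.
  by have /matrixP/(_ i j) := Vs; rewrite mxE => ->; ring.
have addE (A B : 'M[R]_1) : (A + B) 0 0 = A 0 0 + B 0 0 by rewrite mxE.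
have scaleE a (A : 'M[R]_1) : (a *: A) 0 0 = a * A 0 0 by rewrite mxE.
rewrite /quad aT !mulmxDl !mulmxDr -?scalemxAl -?scalemxAr -?scalemxAl.
rewrite !(addE, scaleE) e; ring.
Qed.

Lemma eq0_of_linear_bound (a b : R) : (forall t, 0 <= t * a + t ^+ 2 * b) -> a = 0.
Proof.
move=> h; have [//|a0] := eqVneq a 0.
(* With [c > |b|], the value at [t = - a / (2 c)] is a positive multiple of [b - 2 c] as soon as [a]
   is nonzero, hence negative. *)
pose c := 1 + `|b|; have c0 : 0 < c by rewrite /c ltr_pwDl.
have := h (- a / (2 * c)); have bc : b <= c by rewrite /c; have := ler_norm b; lra.
have -> : - a / (2 * c) * a + (- a / (2 * c)) ^+ 2 * b = a ^+ 2 / (4 * c ^+ 2) * (b - 2 * c).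
  by field; rewrite gt_eqF.
have a2 : 0 < a ^+ 2 by rewrite exprn_even_gt0.
have : 0 < a ^+ 2 / (4 * c ^+ 2) by apply: divr_gt0 => //; apply: mulr_gt0 => //; exact: exprn_gt0.
by move=> h1; rewrite pmulr_rge0// => h2; exfalso; lra.
Qed.

(** At a maximiser [v] of the Rayleigh quotient the form of [L = l - V] is nonnegative and vanishes
    at [v]. Perturbing [v] in the direction [V v - l v] then shows that this residual is 0. *)
Lemma sym_eigenvector n (V : 'M[R]_n.+1) : V^T = V ->
  exists (v : 'cV[R]_n.+1) (l : R), sqnorm v = 1 /\ V *m v = l *: v.
Proof.
move=> Vs; have [v [v1 vm]] := max_quad V.
exists v, (quad V v); split => //.
apply/eqP; rewrite -subr_eq0; apply/eqP.
set l := quad V v in vm *.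
set z := V *m v - l *: v.
pose L := l *: 1%:M - V.
have Ls : L^T = L by rewrite /L linearB /= linearZ /= trmx1 Vs.
have L0 x : 0 <= quad L x by rewrite /L quadB quadZ quad1 subr_ge0.
have Lv : quad L v = 0 by rewrite /L quadB quadZ quad1 v1 mulr1 subrr.
have LE : L *m v = - z by rewrite /L mulmxBl -scalemxAl mul1mx /z opprB.
have /eq0_of_linear_bound : forall t, 0 <= t * (2 * (z^T *m L *m v) 0 0) + t ^+ 2 * quad L z.
  move=> t; have := L0 (v + t *: z); rewrite bilin_quad// Lv add0r.
  by rewrite mulrA (mulrC t).
rewrite -mulmxA LE mulmxN mxE -sqnormE => /eqP.
by rewrite mulf_eq0 pnatr_eq0 /= oppr_eq0 sqnorm_eq0 => /eqP.
Qed.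

Lemma householder n (v : 'cV[R]_n.+1) : sqnorm v = 1 ->
  exists H : 'M[R]_n.+1, [/\ H^T = H, H *m H = 1%:M & H *m delta_mx 0 0 = v].
Proof.
move=> v1; pose e : 'cV[R]_n.+1 := delta_mx 0 0.
have e1 : sqnorm e = 1 by rewrite sqnormE trmx_delta mul_delta_mx mxE !eqxx.
have [ve|ve] := eqVneq v e.
  by exists 1%:M; split; rewrite ?trmx1 ?mul1mx.
pose u := v - e. have u0 : sqnorm u != 0 by rewrite sqnorm_eq0 subr_eq0.
pose H := 1%:M - (2 / sqnorm u) *: (u *m u^T).
have uu : u^T *m u = (sqnorm u)%:M by rewrite [LHS]mx11_scalar -sqnormE.
exists H; split.
- by rewrite /H linearB /= linearZ /= trmx1 trmx_mul trmxK.
- rewrite /H mulmxBl !mulmxBr !mul1mx mulmx1 -!scalemxAl -!scalemxAr.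
  rewrite mulmxA -(mulmxA u) uu mul_mx_scalar -scalemxAl !scalerA.
  apply/matrixP => i j; rewrite !mxE; field; exact: u0.
- have ue : u^T *m e = (- (sqnorm u / 2))%:M.
    rewrite [LHS]mx11_scalar; congr (_%:M).
    have uT : u^T = v^T - e^T by rewrite /u linearB.
    have hs : sqnorm u = sqnorm v + sqnorm e - 2 * (v^T *m e) 0 0.
      rewrite /sqnorm mxE mulr_sumr -big_split -sumrB /=; apply: eq_bigr => k _.
      by rewrite /u !mxE; ring.
    have hu : (u^T *m e) 0 0 = (v^T *m e) 0 0 - sqnorm e.
      by rewrite sqnormE uT mulmxBl mxE [X in _ + X]mxE.
    rewrite hs hu v1 e1; lra.
  rewrite /H mulmxBl mul1mx -scalemxAl -mulmxA ue mul_mx_scalar scalerA.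
  have -> : 2 / sqnorm u * - (sqnorm u / 2) = -1 by field; exact: u0.
  by rewrite scaleN1r opprK addrC subrK.
Qed.

(** Deflation: a Householder reflection moves an eigenvector to the first coordinate, the conjugated
    matrix splits into blocks of sizes 1 and [n], and the induction hypothesis treats the second. *)
Lemma posdef_isqrt n (V : 'M[R]_n) : posdef V -> exists M, is_isqrt V M.
Proof.
elim: n V => [|n IH] V Vp.
  exists 1%:M; split; last by apply/matrixP => -[].
  by split => [|x]; [rewrite trmx1|rewrite (flatmx0 x) eqxx].
have [v [l [v1 Vv]]] := sym_eigenvector Vp.1.
have [H [Hs HH Hv]] := householder v1.
have l0 : 0 < l.
  have := posdef_quad_gt0 Vp (_ : v != 0); rewrite -sqnorm_gt0 v1 => /(_ ltr01).
  by rewrite /quad -mulmxA Vv -scalemxAr mxE -sqnormE v1 mulr1.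
have HVp : posdef (H *m V *m H).
  split; first by rewrite !trmx_mul Hs Vp.1 mulmxA.
  move=> x x0; have := posdef_quad_gt0 Vp (_ : H *m x != 0).
  rewrite /quad trmx_mul Hs !mulmxA; apply.
  by apply: contra_neq x0 => Hx; rewrite -[x]mul1mx -HH -mulmxA Hx mulmx0.
have HVe : H *m V *m H *m delta_mx 0 0 = l *: (delta_mx 0 0 : 'cV[R]_n.+1).
  by rewrite -mulmxA Hv -mulmxA Vv -scalemxAr -Hv mulmxA HH mul1mx.
move: HVp HVe; set B := H *m V *m H => Bp Be.
have BV : V = H *m B *m H by rewrite /B -!mulmxA HH mulmx1 !mulmxA HH mul1mx.
clearbody B; move: H Hs HH {Hv} B Bp Be BV; rewrite -[n.+1]/(1 + n)%N => H Hs HH B Bp Be BV.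
pose B1 := drsubmx B.
have B0 : forall i, B i 0 = l * (i == 0)%:R.
  move=> i; have /matrixP/(_ i 0) := Be; rewrite !mxE eqxx andbT => <-.
  rewrite (bigD1 0)//= big1 ?addr0 => [|j j0]; first by rewrite mxE !eqxx mulr1.
  by rewrite mxE (negbTE j0) mulr0.
have BE : B = block_mx l%:M 0 0 B1.
  have l00 : lshift n (0 : 'I_1) = 0 by exact: val_inj.
  have r0 j : (rshift 1 j == 0) = false by apply/negbTE.
  have dl : dlsubmx B = 0.
    by apply/matrixP => i j; rewrite !ord1 !mxE l00 B0 r0 mulr0.
  rewrite -[LHS]submxK; congr block_mx => //.
    by apply/matrixP => i j; rewrite !ord1 !mxE l00 B0 eqxx mulr1.
  by rewrite -[LHS]trmxK trmx_ursub Bp.1 dl trmx0.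
have B1p : posdef B1.
  split; first by rewrite /B1 trmx_drsub Bp.1.
  move=> x x0; have := Bp.2 (col_mx 0 x); rewrite BE tr_col_mx mul_row_block mul_row_col.
  rewrite trmx0 !mul0mx !add0r mulmx0 add0r; apply.
  by apply: contra x0 => /eqP/(congr1 dsubmx); rewrite col_mxKd linear0 => ->.
have [M1 [M1p M1E]] := IH B1 B1p.
pose s := (Num.sqrt l)^-1. have s0 : 0 < s by rewrite invr_gt0 sqrtr_gt0.
pose D := block_mx (s%:M : 'M[R]_1) 0 0 M1.
have Dp : posdef D.
  split; first by rewrite tr_block_mx !trmx0 tr_scalar_mx M1p.1.
  move=> x; rewrite -[x]vsubmxK; set a := usubmx x; set b := dsubmx x => x0.
  rewrite tr_col_mx mul_row_block mul_row_col !mulmx0 addr0 add0r mul_mx_scalar -scalemxAl !mxE.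
  have h1 : 0 <= s * \sum_j a^T 0 j * a j 0.
    by rewrite mulr_ge0 ?(ltW s0)// sumr_ge0// => j _; rewrite mxE -expr2 sqr_ge0.
  have h2 := posdef_quad_ge0 b M1p.
  have : 0 < s * sqnorm a + quad M1 b.
    have [b0|b0] := eqVneq b 0; last by rewrite ltr_wpDl ?posdef_quad_gt0// mulr_ge0 ?sqnorm_ge0// ltW.
    rewrite ltr_pwDl// mulr_gt0// sqnorm_gt0; apply: contra_neq x0 => ->; rewrite b0.
    by rewrite col_mx0.
  by rewrite sqnormE /quad !mxE.
exists (H *m D *m H); split.
  split; first by rewrite !trmx_mul Hs Dp.1 mulmxA.
  move=> x x0; have := posdef_quad_gt0 Dp (_ : H *m x != 0).
  rewrite /quad trmx_mul Hs !mulmxA; apply.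
  by apply: contra_neq x0 => Hx; rewrite -[x]mul1mx -HH -mulmxA Hx mulmx0.
have DDB : D *m D *m B = 1%:M.
  rewrite BE /D !mulmx_block !(mul0mx, mulmx0, addr0, add0r) M1E -!scalar_mxM -expr2.
  rewrite exprVn sqr_sqrtr ?ltW// mulVf ?gt_eqF// -scalar_mx_block//.
rewrite BV -!mulmxA (mulmxA H H) HH mul1mx !mulmxA -(mulmxA _ H H) HH mulmx1.
by rewrite -!mulmxA (mulmxA D D) (mulmxA _ B) DDB mul1mx HH.
Qed.

End Sqrt.

(** * Inner products and orthonormal expansions *)

Section Dot.
Context {R : realType}.

Definition dot p (u v : 'cV[R]_p) : R := (u^T *m v) 0 0.

Lemma dotE p (u v : 'cV[R]_p) : dot u v = \sum_k u k 0 * v k 0.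
Proof. by rewrite /dot mxE; apply: eq_bigr => k _; rewrite mxE. Qed.

Lemma dotC p (u v : 'cV[R]_p) : dot u v = dot v u.
Proof. by rewrite !dotE; apply: eq_bigr => k _; rewrite mulrC. Qed.

Lemma dotDr p (u v w : 'cV[R]_p) : dot u (v + w) = dot u v + dot u w.
Proof. by rewrite /dot mulmxDr mxE. Qed.

Lemma dotZr p a (u v : 'cV[R]_p) : dot u (a *: v) = a * dot u v.
Proof. by rewrite /dot -scalemxAr mxE. Qed.

Lemma dotNr p (u v : 'cV[R]_p) : dot u (- v) = - dot u v.
Proof. by rewrite -scaleN1r dotZr mulN1r. Qed.

Lemma dotBr p (u v w : 'cV[R]_p) : dot u (v - w) = dot u v - dot u w.
Proof. by rewrite dotDr dotNr. Qed.

Lemma dot_sumr p I (s : seq I) (P : pred I) (F : I -> 'cV[R]_p) u :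
  dot u (\sum_(i <- s | P i) F i) = \sum_(i <- s | P i) dot u (F i).
Proof. by rewrite /dot mulmx_sumr summxE. Qed.

Lemma dotDl p (u v w : 'cV[R]_p) : dot (v + w) u = dot v u + dot w u.
Proof. by rewrite dotC dotDr !(dotC u). Qed.

Lemma dotZl p a (u v : 'cV[R]_p) : dot (a *: v) u = a * dot v u.
Proof. by rewrite dotC dotZr dotC. Qed.

Lemma dotBl p (u v w : 'cV[R]_p) : dot (v - w) u = dot v u - dot w u.
Proof. by rewrite dotC dotBr !(dotC u). Qed.

Lemma dot_sqnorm p (u : 'cV[R]_p) : dot u u = sqnorm u.
Proof. by rewrite /dot sqnormE. Qed.

Lemma dot_mulmx p q (A : 'M[R]_(p, q)) u v : dot u (A *m v) = dot (A^T *m u) v.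
Proof. by rewrite /dot trmx_mul trmxK mulmxA. Qed.

Lemma quad_dot p (A : 'M[R]_p) x : quad A x = dot x (A *m x).
Proof. by rewrite /quad /dot mulmxA. Qed.

Lemma outer_mul p (u v w : 'cV[R]_p) : (u *m v^T) *m w = dot v w *: u.
Proof. by rewrite -mulmxA [v^T *m w]mx11_scalar mul_mx_scalar. Qed.

Lemma cauchy_schwarz_dot p (u v : 'cV[R]_p) : dot u v ^+ 2 <= sqnorm u * sqnorm v.
Proof. by rewrite dotE; exact: cauchy_schwarz. Qed.

Lemma sqnormBZ p a (x y : 'cV[R]_p) :
  sqnorm (x - a *: y) = sqnorm x - 2 * a * dot x y + a ^+ 2 * sqnorm y.
Proof. by rewrite -!dot_sqnorm dotBr !dotBl !dotZr !dotZl (dotC y); ring. Qed.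

End Dot.

Section Spectral.
Context {R : realType} (p : nat) (th : 'I_p -> 'cV[R]_p).

Definition specmx (f : 'I_p -> R) : 'M[R]_p := \sum_j f j *: (th j *m (th j)^T).

Hypothesis ho : forall i j, (th i)^T *m th j = (i == j)%:R%:M.

Lemma ortho_dot i j : dot (th i) (th j) = (i == j)%:R.
Proof. by rewrite /dot ho mxE eqxx mulr1n. Qed.

Lemma specmx_mul f x : specmx f *m x = \sum_j (f j * dot (th j) x) *: th j.
Proof.
rewrite mulmx_suml; apply: eq_bigr => j _.
by rewrite -scalemxAl outer_mul scalerA.
Qed.

Lemma specmx_eigen f j : specmx f *m th j = f j *: th j.
Proof.
rewrite specmx_mul (bigD1 j)//= ortho_dot eqxx mulr1 big1 ?addr0// => i ij.
by rewrite ortho_dot (negbTE ij) mulr0 scale0r.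
Qed.

(** The Gram matrix of the family gives a left inverse of a square matrix, which is also a right
    inverse. *)
Lemma specmx1 : specmx (fun=> 1) = 1%:M.
Proof.
pose Q : 'M[R]_p := \matrix_(i, j) th j i 0.
have QQ : Q^T *m Q = 1%:M.
  apply/matrixP => i j; rewrite !mxE -ortho_dot dotE.
  by apply: eq_bigr => k _; rewrite !mxE.
rewrite -(mulmx1C QQ); apply/matrixP => i j; rewrite summxE mxE.
by apply: eq_bigr => k _; rewrite scale1r !mxE big_ord1 !mxE.
Qed.

Lemma ortho_expand x : x = \sum_j dot (th j) x *: th j.
Proof.
rewrite -{1}[x]mul1mx -specmx1 specmx_mul; apply: eq_bigr => j _.
by rewrite mul1r.
Qed.

Lemma parseval x y : dot x y = \sum_j dot (th j) x * dot (th j) y.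
Proof.
rewrite {1}(ortho_expand y) dot_sumr; apply: eq_bigr => j _.
by rewrite dotZr mulrC (dotC x).
Qed.

Lemma sqnorm_parseval x : sqnorm x = \sum_j dot (th j) x ^+ 2.
Proof. by rewrite -dot_sqnorm parseval; apply: eq_bigr => j _; rewrite expr2. Qed.

Lemma eq_on_ortho (A B : 'M[R]_p) : (forall j, A *m th j = B *m th j) -> A = B.
Proof.
move=> h; rewrite -[A]mulmx1 -[B]mulmx1 -specmx1 !mulmx_sumr.
by apply: eq_bigr => j _; rewrite scale1r !mulmxA h.
Qed.

Lemma specmxM f g : specmx f *m specmx g = specmx (fun j => f j * g j).
Proof.
apply: eq_on_ortho => j; rewrite -mulmxA !specmx_eigen -scalemxAr specmx_eigen.
by rewrite scalerA mulrC.
Qed.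

Lemma specmx_tr f : (specmx f)^T = specmx f.
Proof.
rewrite /specmx linear_sum; apply: eq_bigr => j _.
by rewrite linearZ /= trmx_mul trmxK.
Qed.

Lemma eq_specmx f g : f =1 g -> specmx f = specmx g.
Proof. by move=> fg; rewrite /specmx; apply: eq_bigr => j _; rewrite fg. Qed.

Lemma quad_specmx f x : quad (specmx f) x = \sum_j f j * dot (th j) x ^+ 2.
Proof.
rewrite quad_dot specmx_mul dot_sumr; apply: eq_bigr => j _.
by rewrite dotZr (dotC x) expr2 mulrA.
Qed.

Lemma specmx_posdef f : (forall j, 0 < f j) -> posdef (specmx f).
Proof.
move=> f0; split; first exact: specmx_tr.
move=> x x0; rewrite -/(quad _ _) quad_specmx.
rewrite lt0r sumr_ge0 ?andbT => [|j _]; last by rewrite mulr_ge0 ?sqr_ge0// ltW.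
rewrite psumr_eq0 => [|j _]; last by rewrite mulr_ge0 ?sqr_ge0// ltW.
apply: contra x0 => /allP h; rewrite -sqnorm_eq0 sqnorm_parseval psumr_eq0 => [|j _]; last exact: sqr_ge0.
apply/allP => j jI; have := h j jI; rewrite /= mulf_eq0 gt_eqF//=.
Qed.

Lemma posdef_specmx f : posdef (specmx f) -> forall j, 0 < f j.
Proof.
move=> fp j; have := posdef_quad_gt0 fp (_ : th j != 0).
rewrite quad_dot specmx_eigen dotZr ortho_dot eqxx mulr1; apply.
by rewrite -sqnorm_gt0 -dot_sqnorm ortho_dot eqxx ltr01.
Qed.

Lemma invmx_specmx f : (forall j, 0 < f j) -> invmx (specmx f) = specmx (fun j => (f j)^-1).
Proof.
move=> f0.
have e : specmx (fun j => (f j)^-1) *m specmx f = 1%:M.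
  by rewrite specmxM -specmx1; apply: eq_specmx => j; rewrite mulVf// gt_eqF.
have [u1 u2] := mulmx1_unit e.
by rewrite -[LHS]mul1mx -e -mulmxA mulmxV// mulmx1.
Qed.

(** Uniqueness of the positive root: on an eigenvector [M^2] acts as [c^2], so [y = M th_j - c th_j]
    satisfies [M y = - c y], which for positive definite [M] forces [y = 0]. *)
Lemma is_isqrt_specmx f M : (forall j, 0 < f j) -> is_isqrt (specmx f) M ->
  M = specmx (fun j => (Num.sqrt (f j))^-1).
Proof.
move=> f0 [Mp ME]; apply: eq_on_ortho => j; rewrite specmx_eigen.
set c := (Num.sqrt (f j))^-1.
have c0 : 0 < c by rewrite invr_gt0 sqrtr_gt0.
have cc : c ^+ 2 = (f j)^-1 by rewrite exprVn sqr_sqrtr// ltW.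
have MM : M *m (M *m th j) = c ^+ 2 *: th j.
  have := congr1 (fun A => A *m th j) ME; rewrite /= -mulmxA specmx_eigen mul1mx -scalemxAr.
  by move=> h; rewrite cc -{2}h scalerA mulVf ?scale1r ?gt_eqF// mulmxA.
pose y := M *m th j - c *: th j.
have My : M *m y = - (c *: y).
  by rewrite /y mulmxBr MM -scalemxAr scalerBr scalerA -expr2 opprB.
have : quad M y = - (c * sqnorm y) by rewrite quad_dot My dotNr dotZr dot_sqnorm.
have := posdef_quad_ge0 y Mp; have := sqnorm_ge0 y => h1 h2 h3.
have : c * sqnorm y = 0.
  by apply/eqP; rewrite eq_le mulr_ge0 ?(ltW c0)// andbT -oppr_ge0 -h3.
move/eqP; rewrite mulf_eq0 gt_eqF//= sqnorm_eq0 /y subr_eq0 => /eqP.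
by [].
Qed.

Lemma isqrtmxP (V : 'M[R]_p) : posdef V -> is_isqrt V (isqrtmx V).
Proof.
move=> /posdef_isqrt Vp; rewrite /isqrtmx; case: pselect => // h.
exact: (projT2 (cid h)).
Qed.

Lemma isqrtmx_specmx f : (forall j, 0 < f j) ->
  isqrtmx (specmx f) = specmx (fun j => (Num.sqrt (f j))^-1).
Proof.
by move=> f0; apply: is_isqrt_specmx => //; apply: isqrtmxP; exact: specmx_posdef.
Qed.

End Spectral.

(** * A closed form for the Gram-Schmidt vectors *)

Section GramSchmidt.
Context {R : realType} (m : nat) (th0 : 'cV[R]_m.+1) (thh : 'I_m.+1 -> 'cV[R]_m.+1).
Hypothesis th01 : sqnorm th0 = 1.
Hypothesis ho : forall i j, (thh i)^T *m thh j = (i == j)%:R%:M.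

Let t (j : nat) := thh (inord j).
Let c (j : nat) := dot (t j) th0.
(** What remains of [th0] after projecting off the estimated eigenvectors of 0-based indices 1 to
    [j - 1]; [gs_len j] is its squared norm. The index 0, the leading eigenvector, is left out. *)
Definition gs_rem (j : nat) : 'cV[R]_m.+1 := th0 - \sum_(1 <= k < j) c k *: t k.
Definition gs_len (j : nat) : R := 1 - \sum_(1 <= k < j) c k ^+ 2.

Let t_dot i j : (i <= m)%N -> (j <= m)%N -> dot (t i) (t j) = (i == j)%:R.
Proof.
move=> im jm; rewrite /t (ortho_dot ho); congr (_%:R); congr nat_of_bool.
by apply/eqP/eqP => [/(congr1 val)|->//]; rewrite /= !inordK.
Qed.

Lemma gs_remS j : (0 < j)%N -> gs_rem j.+1 = gs_rem j - c j *: t j.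
Proof. by move=> j0; rewrite /gs_rem big_nat_recr//= opprD addrA. Qed.

Lemma gs_lenS j : (0 < j)%N -> gs_len j.+1 = gs_len j - c j ^+ 2.
Proof. by move=> j0; rewrite /gs_len big_nat_recr//= opprD addrA. Qed.

Lemma gs_rem1 : gs_rem 1 = th0.
Proof. by rewrite /gs_rem big_geq// subr0. Qed.

Lemma gs_len1 : gs_len 1 = 1.
Proof. by rewrite /gs_len big_geq// subr0. Qed.

Lemma dot_gs_rem i j : (i <= m)%N -> (j <= m.+1)%N ->
  dot (t i) (gs_rem j) = if (1 <= i < j)%N then 0 else c i.
Proof.
move=> im jm; rewrite /gs_rem dotBr dot_sumr -/(c i).
rewrite (eq_big_nat _ _ (F2 := fun k => if (k == i)%N then c i else 0)); last first.
  move=> k /andP[k1 kj]; rewrite dotZr t_dot//; last by rewrite -ltnS (leq_trans kj).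
  by rewrite eq_sym; case: eqP => [->|_]; rewrite ?mulr1 ?mulr0.
rewrite -big_mkcond /=; case: ifPn => [/andP[i1 ij]|h].
  by rewrite big_nat1_eq i1 ij subrr.
by rewrite big_nat1_eq (negbTE h) subr0.
Qed.

Lemma sqnorm_gs_rem j : (1 <= j <= m.+1)%N -> sqnorm (gs_rem j) = gs_len j.
Proof.
elim: j => // -[_ _|j IH /andP[_ jm]]; first by rewrite gs_rem1 gs_len1.
rewrite gs_remS// gs_lenS// sqnormBZ IH; last by rewrite /= ltnW.
have jm0 : (j.+1 <= m)%N := jm.
have jm1 : (j.+1 <= m.+1)%N by exact: ltnW.
rewrite (dotC (gs_rem _)) dot_gs_rem// ltnn andbF -dot_sqnorm t_dot// eqxx mulr1n.
ring.
Qed.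

Hypothesis len_gt0 : forall j, (1 <= j <= m.+1)%N -> 0 < gs_len j.

(** The Gram-Schmidt vector before normalisation. The space already spanned has the orthogonal basis
    [t 1, ..., t (j - 1), gs_rem j], and only the last of these vectors is not orthogonal to
    [t j]. *)
Definition gs_raw (j : nat) : 'cV[R]_m.+1 := t j - (c j / gs_len j) *: gs_rem j.

Lemma sqnorm_gs_raw j : (1 <= j <= m)%N -> sqnorm (gs_raw j) = gs_len j.+1 / gs_len j.
Proof.
move=> /andP[j1 jm]; have j1m : (1 <= j <= m.+1)%N by rewrite j1 ltnW.
have l0 := len_gt0 j1m.
have jm1 : (j <= m.+1)%N by exact: leqW.
rewrite /gs_raw sqnormBZ sqnorm_gs_rem// -dot_sqnorm t_dot// eqxx mulr1n gs_lenS//.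
rewrite (dotC (t j)) (dotC (gs_rem _)) dot_gs_rem// ltnn andbF.
by field; rewrite gt_eqF.
Qed.

(** The span of [th0] and the first [j] Gram-Schmidt vectors is also that of [t 1, ..., t j] and
    [gs_rem j.+1], which are orthogonal; the first conjunct equates the two expressions of the
    projector. It solves the recursion, and has to be proved together with the closed form of the
    vectors. *)
Lemma gs_list_proj j : (j <= m)%N ->
  th0 *m th0^T + \sum_(w <- gs_list th0 (fun k => thh (inord k)) j) w *m w^T =
  \sum_(1 <= k < j.+1) t k *m (t k)^T + (gs_len j.+1)^-1 *: (gs_rem j.+1 *m (gs_rem j.+1)^T)
  /\ (forall i, (1 <= i <= j)%N -> nth 0 (gs_list th0 (fun k => thh (inord k)) j) i.-1 =
       (vnorm (gs_raw i))^-1 *: gs_raw i).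
Proof.
elim: j => [_|j IH jm].
  rewrite /= big_nil addr0 big_geq// add0r gs_rem1 gs_len1 invr1 scale1r; split => //.
  by case.
have {IH}[IH1 IH2] := IH (ltnW jm).
have sz i : size (gs_list th0 (fun k => thh (inord k)) i) = i.
  by elim: i => //= i IHi; rewrite size_rcons IHi.
set l := gs_list _ _ j in IH1 IH2 *.
have l1 : 0 < gs_len j.+1 by apply: len_gt0; rewrite /= ltnW.
have l2 : 0 < gs_len j.+2 by apply: len_gt0.
have vE : (1%:M - th0 *m th0^T - \sum_(w <- l) w *m w^T) *m t j.+1 = gs_raw j.+1.
  rewrite -addrA -opprD IH1 mulmxBl mul1mx mulmxDl -scalemxAl outer_mul.
  have jm1 : (j.+1 <= m.+1)%N by rewrite ltnS ltnW.
  rewrite (dotC (gs_rem _)) dot_gs_rem// ltnn andbF scalerA (mulrC _^-1) /gs_raw.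
  rewrite mulmx_suml big_nat big1 ?add0r// => k /andP[k1 kj].
  by rewrite outer_mul t_dot// ?(ltn_eqF kj) ?scale0r// -ltnS (leq_trans kj)// ltnW.
have lE : gs_list th0 (fun k => thh (inord k)) j.+1 =
   rcons l ((vnorm (gs_raw j.+1))^-1 *: gs_raw j.+1) by rewrite -vE.
rewrite lE; split; last first.
  move=> i /andP[i1]; rewrite leq_eqVlt => /orP[/eqP ->|ij].
    by rewrite nth_rcons sz ltnn eqxx.
  rewrite nth_rcons sz ifT; first by apply: IH2; rewrite i1 -ltnS.
  by rewrite -ltnS prednK.
rewrite -cats1 big_cat big_seq1 addrA IH1 [in RHS]big_nat_recr//= -!addrA; congr (_ + _).
have aT (a : R) (z : 'cV[R]_m.+1) : (a *: z)^T = a *: z^T by rewrite linearZ.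
have bT (y z : 'cV[R]_m.+1) : (y - z)^T = y^T - z^T by rewrite linearB.
rewrite aT -scalemxAl -scalemxAr scalerA -expr2 exprVn vnorm_sq sqnorm_gs_raw ?jm//.
rewrite (@gs_remS j.+1)// /gs_raw (@gs_lenS j.+1)// !bT !aT.
have l2' : gs_len j.+1 - c j.+1 ^+ 2 != 0 by rewrite -gs_lenS// gt_eqF.
apply/matrixP => a b; rewrite !mxE !big_ord1 !mxE.
by field; rewrite l2' gt_eqF.
Qed.

Lemma gs_vecE (j : 'I_m.+1) : j != ord0 -> gs_vec th0 thh j = (vnorm (gs_raw j))^-1 *: gs_raw j.
Proof.
move=> j0; have j1 : (0 < j)%N by rewrite lt0n.
have [_ h] := gs_list_proj (ltn_ord j : (j <= m)%N).
have sz i : size (gs_list th0 (fun k => thh (inord k)) i) = i.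
  by elim: i => //= i IHi; rewrite size_rcons IHi.
by rewrite /gs_vec (last_nth 0) sz -[X in nth _ (_ :: _) X](prednK j1) /= h// j1 leqnn.
Qed.

Definition gs_basis (j : 'I_m.+1) := if j == ord0 then th0 else gs_vec th0 thh j.

(** No inner product is computed: the projectors on the basis vectors sum to the identity, and
    [Q *m Q^T = 1] for a square matrix gives [Q^T *m Q = 1]. *)
Lemma gs_basis_ortho i j : (gs_basis i)^T *m gs_basis j = (i == j)%:R%:M.
Proof.
have sz i' : size (gs_list th0 (fun k => thh (inord k)) i') = i'.
  by elim: i' => //= i' IHi; rewrite size_rcons IHi.
have [h hn] := gs_list_proj (leqnn m).
have full : \sum_j gs_basis j *m (gs_basis j)^T = 1%:M.
  transitivity (th0 *m th0^T + \sum_(w <- gs_list th0 (fun k => thh (inord k)) m) w *m w^T).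
    rewrite big_ord_recl /gs_basis eqxx; congr (_ + _).
    rewrite (big_nth 0) sz big_mkord; apply: eq_bigr => k _.
    have kF : (lift ord0 k == ord0) = false by rewrite eq_sym (negbTE (neq_lift _ _)).
    have := hn k.+1; rewrite /= ltn_ord => /(_ isT) ->.
    by rewrite gs_vecE// lift0.
  rewrite h.
  (* Once all the other eigenvectors are projected off, [th0] is left with its component along the
     leading one, so the projector is complete. *)
  have cE : gs_rem m.+1 = c 0 *: t 0.
    rewrite /gs_rem {1}(ortho_expand ho th0) big_ord_recl.
    have -> : \sum_(i < m) dot (thh (lift ord0 i)) th0 *: thh (lift ord0 i) = \sum_(1 <= k < m.+1) c k *: t k.
      rewrite big_add1 big_mkord; apply: eq_bigr => k _.
      have -> : thh (lift ord0 k) = t k.+1 by congr thh; apply: val_inj; rewrite /= inordK ?ltnS ?ltn_ord.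
      by [].
    rewrite addrK; have -> : thh ord0 = t 0 by congr thh; apply: val_inj; rewrite /= inordK ?ltnS ?ltn_ord.
    by [].
  have lE : gs_len m.+1 = c 0 ^+ 2.
    have hm : (1 <= m.+1 <= m.+1)%N by rewrite leqnn.
    by rewrite -(sqnorm_gs_rem hm) cE sqnormZ -dot_sqnorm t_dot// eqxx mulr1.
  have c0 : c 0 ^+ 2 != 0 by rewrite -lE gt_eqF// len_gt0//= leqnn.
  rewrite cE lE linearZ /= -scalemxAl -scalemxAr !scalerA -mulrA -expr2 mulVf// scale1r.
  rewrite -(specmx1 ho) /specmx big_ord_recl addrC; congr (_ + _).
    by rewrite scale1r; have -> : thh ord0 = t 0 by congr thh; apply: val_inj; rewrite /= inordK ?ltnS ?ltn_ord.
  rewrite big_add1 big_mkord; apply: eq_bigr => k _; rewrite scale1r.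
  by have -> : thh (lift ord0 k) = t k.+1 by congr thh; apply: val_inj; rewrite /= inordK ?ltnS ?ltn_ord.
pose Q : 'M[R]_m.+1 := \matrix_(a, b) gs_basis b a 0.
have QQ : Q *m Q^T = 1%:M.
  rewrite -full; apply/matrixP => a b; rewrite summxE mxE.
  by apply: eq_bigr => k _; rewrite !mxE big_ord1 !mxE.
rewrite [LHS]mx11_scalar; congr (_%:M).
have /matrixP/(_ i j) := mulmx1C QQ; rewrite !mxE => <-.
by apply: eq_bigr => k _; rewrite !mxE.
Qed.

Lemma Vtilde_specmx lamh : Vtilde th0 lamh thh = specmx gs_basis lamh.
Proof.
rewrite /Vtilde /specmx [RHS](bigD1 ord0)//= {1}/gs_basis eqxx; congr (_ + _).
by apply: eq_bigr => j j0; rewrite /gs_basis (negbTE j0).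
Qed.

End GramSchmidt.

(** * Second-order expansion of the two statistics *)

Section Expansion.
Context {R : realType}.

(** Here [y] and [h] are of first order, [u] and [t] of second order; all products collected in [N]
    are of second order, and the denominator is at least 1/2. *)
Lemma ratio_expansion (x y h u t P e al be : R) : 0 <= P -> 0 <= e -> e <= 1 -> 0 <= al -> 0 <= be ->
  `|x| <= 1 -> `|y| <= 2 * P * e -> `|h| <= 2 * P * e -> `|u| <= al * e ^+ 2 ->
  `|t| <= be * e ^+ 2 -> 4 * P * e + be * e ^+ 2 <= 1 / 2 ->
  `|(x + y + u) / (1 + 2 * h + t) - (x + y - 2 * h * x)| <=
    2 * (al + be + 24 * P ^+ 2 + 6 * P * be) * e ^+ 2.
Proof.
move=> P0 e0 e1 al0 be0 x1 y1 h1 u1 t1 small.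
have e2 : 0 <= e ^+ 2 := sqr_ge0 _.
have /andP[h2 _] : - (2 * P * e) <= h <= 2 * P * e by rewrite -ler_norml.
have /andP[t2 _] : - (be * e ^+ 2) <= t <= be * e ^+ 2 by rewrite -ler_norml.
have D2 : 1 / 2 <= 1 + 2 * h + t by lra.
have D0 : 0 < 1 + 2 * h + t by lra.
pose N := u - 2 * (h * y) + 4 * (h * h * x) - x * t - y * t + 2 * (h * x * t).
have -> : (x + y + u) / (1 + 2 * h + t) - (x + y - 2 * h * x) = N / (1 + 2 * h + t).
  by rewrite /N; field; rewrite gt_eqF.
have N1 : `|N| <= (al + be + 24 * P ^+ 2 + 6 * P * be) * e ^+ 2.
  have hy : `|h * y| <= 4 * P ^+ 2 * e ^+ 2.
    by rewrite normrM (_ : 4 * P ^+ 2 * e ^+ 2 = (2 * P * e) * (2 * P * e)) ?ler_pM//; ring.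
  have hh : `|h * h * x| <= 4 * P ^+ 2 * e ^+ 2.
    rewrite normrM normrM -[leRHS]mulr1.
    by rewrite (_ : 4 * P ^+ 2 * e ^+ 2 = (2 * P * e) * (2 * P * e)) ?ler_pM ?mulr_ge0//; ring.
  have xt : `|x * t| <= be * e ^+ 2.
    by rewrite normrM -[leRHS]mul1r ler_pM.
  have yt : `|y * t| <= 2 * P * be * e ^+ 2.
    rewrite normrM; apply: (@le_trans _ _ ((2 * P * e) * (be * e ^+ 2))); first by rewrite ler_pM.
    have : 0 <= 2 * P * be * e ^+ 2 by rewrite !mulr_ge0.
    move=> /(ler_wpM2l) /(_ _ _ e1); lra.
  have hxt : `|h * x * t| <= 2 * P * be * e ^+ 2.
    rewrite normrM normrM; apply: (@le_trans _ _ ((2 * P * e) * 1 * (be * e ^+ 2))).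
      by rewrite ler_pM ?mulr_ge0// ler_pM.
    have : 0 <= 2 * P * be * e ^+ 2 by rewrite !mulr_ge0.
    move=> /(ler_wpM2l) /(_ _ _ e1); lra.
  move: u1 hy hh xt yt hxt; rewrite /N !ler_norml.
  move=> /andP[? ?] /andP[? ?] /andP[? ?] /andP[? ?] /andP[? ?] /andP[? ?].
  by apply/andP; split; lra.
rewrite normrM normfV (gtr0_norm D0) ler_pdivrMr//.
apply: le_trans N1 _.
have : 0 <= (al + be + 24 * P ^+ 2 + 6 * P * be) * e ^+ 2.
  by rewrite mulr_ge0// !addr_ge0// !mulr_ge0// sqr_ge0.
move=> /(ler_wpM2l) /(_ _ _ D2); lra.
Qed.

Lemma ler_norm_subst2 (a b g h c1 c2 : R) : `|a - (b - 2 * h)| <= c1 -> `|h - g| <= c2 ->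
  `|a - (b - 2 * g)| <= c1 + 2 * c2.
Proof. by rewrite !ler_norml => /andP[? ?] /andP[? ?]; apply/andP; split; lra. Qed.

(** How the coefficient [1 / (P + 2)] arises: the second moment [1 / P] of the numerator minus twice
    the fourth moment brought in by the denominator. *)
Lemma trace_free_factor (f x : R) : x != 0 -> x + 2 != 0 ->
  f / (x + 2) = f / x - 2 * (f / (x * (x + 2))).
Proof. by move=> x0 x2; field; rewrite x0 x2. Qed.

Context (m n : nat) (z : 'I_n -> 'I_m.+1 -> R) (E Q : 'I_m.+1 -> 'I_m.+1 -> R).
Let P : R := m.+1%:R.
Variables (e K K1 : R).
Hypothesis z1 : forall i, \sum_k z i k ^+ 2 = 1.
Hypothesis z2 : forall j k, avg (fun i => z i j * z i k) = (j == k)%:R / P.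
Hypothesis z4 : forall j k, j != 0 -> k != 0 ->
  `|avg (fun i => z i 0 ^+ 2 * (z i j * z i k)) - (j == k)%:R / (P * (P + 2))| <= K1 * e.
Hypothesis E0 : forall j k, (j == 0) = (k == 0) -> E j k = 0.
Hypothesis Ee : forall j k, `|E j k| <= e.
Hypothesis Qe : forall j k, `|Q j k| <= K * e ^+ 2.

Let al : R := P ^+ 2 + 2 * P * K + 2 * P ^+ 2 * K + P ^+ 2 * K ^+ 2.
Let be : R := 2 * P ^+ 2 * K + P ^+ 3 * (1 + K) ^+ 2.
Hypotheses (e1 : e <= 1) (K0 : 0 <= K) (small : 4 * P * e + be * e ^+ 2 <= 1 / 2).

(** Coordinates of [(1 + E + Q) z]. The first-order part [E] couples the index 0 with the other ones
    only ([E0]), and [Q] is of second order. *)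
Definition perturbed i j : R := z i j + \sum_k E j k * z i k + \sum_k Q j k * z i k.

Let e0 : 0 <= e. Proof. exact: le_trans (Ee 0 0). Qed.
Let P1 : 1 <= P. Proof. by rewrite /P ler1n. Qed.

Let z_le i k : `|z i k| <= 1.
Proof.
rewrite -(@ler_sqr _ _ 1) ?nnegrE// expr1n real_normK ?num_real// -(z1 i).
by rewrite (bigD1 k)//= lerDl sumr_ge0// => l _; exact: sqr_ge0.
Qed.

Let sum_le (G : 'I_m.+1 -> R) c : 0 <= c -> (forall k, `|G k| <= c) -> `|\sum_k G k| <= P * c.
Proof.
move=> c0 Gc; apply: le_trans (ler_norm_sum _ _ _) _.
apply: (@le_trans _ _ (\sum_(k < m.+1) c)); first exact: ler_sum.
by rewrite sumr_const card_ord -[c *+ _]mulr_natl.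
Qed.

Let lin_le (G : 'I_m.+1 -> 'I_m.+1 -> R) c i j : 0 <= c -> (forall j k, `|G j k| <= c) ->
  `|\sum_k G j k * z i k| <= P * c.
Proof.
move=> c0 Gc; apply: sum_le => // k; rewrite normrM.
by rewrite -[leRHS]mulr1 ler_pM.
Qed.

Lemma sum_E (G : 'I_m.+1 -> R) j : j != 0 -> \sum_k E j k * G k = E j 0 * G 0.
Proof.
move=> j0; rewrite (bigD1 0)//= big1 ?addr0// => k k0.
by rewrite E0 ?mul0r// (negbTE j0) (negbTE k0).
Qed.

Lemma sum_E0 (G : 'I_m.+1 -> R) : \sum_k E 0 k * G k = \sum_(k | k != 0) E 0 k * G k.
Proof. by rewrite (bigD1 0)//= E0 ?mul0r ?add0r. Qed.

(** The zeroth-order term [z_j z_0] averages to 0 exactly, the second moments of [z] being exact. To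
    first order the numerator contributes [(E 0 j + E j 0) / P] and the norm in the denominator
    minus twice [(E 0 j + E j 0) / (P (P + 2))]. *)
Lemma avg_perturbed j : j != 0 ->
  `|avg (fun i => perturbed i j * perturbed i 0 / (\sum_k perturbed i k ^+ 2))
    - (E 0 j + E j 0) / (P + 2)| <=
  (2 * (al + be + 24 * P ^+ 2 + 6 * P * be) + 4 * P * K1) * e ^+ 2.
Proof.
move=> j0.
have e20 : 0 <= e ^+ 2 := sqr_ge0 _.
have P0 : 0 <= P by exact: ler0n.
have Ke0 : 0 <= K * e ^+ 2 by exact: mulr_ge0.
have ee : e ^+ 2 <= e by rewrite expr2 -[leRHS]mulr1 ler_wpM2l.
pose a i l := \sum_k E l k * z i k.
pose r i l := \sum_k Q l k * z i k.
have a_le i l : `|a i l| <= P * e by exact: lin_le.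
have r_le i l : `|r i l| <= P * (K * e ^+ 2) by exact: lin_le.
pose F k := E 0 k + E k 0.
pose h i := \sum_(k | k != 0) z i 0 * z i k * F k.
have hE i : \sum_k z i k * a i k = h i.
  rewrite /a (bigD1 0)//= sum_E0 mulr_sumr -big_split /=; apply: eq_bigr => k k0.
  by rewrite sum_E// /F; ring.
have h_le i : `|h i| <= 2 * P * e.
  rewrite -hE (_ : 2 * P * e = P * (2 * e)); last ring.
  rewrite hE /h big_mkcond; apply: sum_le => [|k]; first by rewrite mulr_ge0.
  case: ifP => _; last by rewrite normr0 mulr_ge0.
  rewrite normrM -[leRHS]mul1r ler_pM//; first by rewrite normrM mulr_ile1.
  by apply: le_trans (ler_normD _ _) _; have := Ee 0 k; have := Ee k 0; lra.
pose t i := 2 * \sum_k z i k * r i k + \sum_k (a i k + r i k) ^+ 2.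
have DE i : \sum_k perturbed i k ^+ 2 = 1 + 2 * h i + t i.
  rewrite /t -hE -[X in _ = X + _ + _](z1 i) !mulr_sumr -!big_split /=; apply: eq_bigr => k _.
  by rewrite /perturbed -/(a i k) -/(r i k); ring.
have t_le i : `|t i| <= be * e ^+ 2.
  have ar k : `|a i k + r i k| <= P * (1 + K) * e.
    apply: le_trans (ler_normD _ _) _; have := a_le i k; have := r_le i k.
    have : P * (K * e ^+ 2) <= P * (K * e) by rewrite ler_wpM2l// ler_wpM2l.
    lra.
  have s1 : `|\sum_k z i k * r i k| <= P * (P * (K * e ^+ 2)).
    apply: sum_le => [|k]; first by rewrite mulr_ge0.
    by rewrite normrM -[leRHS]mul1r ler_pM.
  have s2 : `|\sum_k (a i k + r i k) ^+ 2| <= P * (P * (1 + K) * e) ^+ 2.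
    apply: sum_le => [|k]; first exact: sqr_ge0.
    by rewrite normrX ler_sqr ?nnegrE// (le_trans _ (ar k)).
  rewrite /t /be; apply: le_trans (ler_normD _ _) _; rewrite normrM ger0_norm//.
  have -> : (2 * P ^+ 2 * K + P ^+ 3 * (1 + K) ^+ 2) * e ^+ 2 =
    2 * (P * (P * (K * e ^+ 2))) + P * (P * (1 + K) * e) ^+ 2 by ring.
  by rewrite lerD// ler_wpM2l.
pose y i := a i j * z i 0 + z i j * a i 0.
have y_le i : `|y i| <= 2 * P * e.
  apply: le_trans (ler_normD _ _) _; rewrite !normrM.
  have : `|a i j| * `|z i 0| <= P * e * 1 by rewrite ler_pM.
  have : `|z i j| * `|a i 0| <= 1 * (P * e) by rewrite ler_pM.
  lra.
pose u i := z i j * r i 0 + r i j * z i 0 + (a i j + r i j) * (a i 0 + r i 0).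
have nE i : perturbed i j * perturbed i 0 = z i j * z i 0 + y i + u i.
  by rewrite /perturbed -/(a i j) -/(r i j) -/(a i 0) -/(r i 0) /y /u; ring.
have u_le i : `|u i| <= al * e ^+ 2.
  have ar k : `|a i k + r i k| <= P * (1 + K) * e.
    apply: le_trans (ler_normD _ _) _; have := a_le i k; have := r_le i k.
    have : P * (K * e ^+ 2) <= P * (K * e) by rewrite ler_wpM2l// ler_wpM2l.
    lra.
  have u1 : `|z i j * r i 0| <= P * (K * e ^+ 2) by rewrite normrM -[leRHS]mul1r ler_pM.
  have u2 : `|r i j * z i 0| <= P * (K * e ^+ 2) by rewrite normrM -[leRHS]mulr1 ler_pM.
  have u3 : `|(a i j + r i j) * (a i 0 + r i 0)| <= (P * (1 + K) * e) * (P * (1 + K) * e).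
    by rewrite normrM ler_pM.
  apply: le_trans (ler_normD _ _) _; have := ler_normD (z i j * r i 0) (r i j * z i 0).
  have -> : al * e ^+ 2 = 2 * (P * (K * e ^+ 2)) + (P * (1 + K) * e) * (P * (1 + K) * e).
    by rewrite /al; ring.
  lra.
have al0 : 0 <= al by rewrite /al !addr_ge0// !mulr_ge0// sqr_ge0.
have P2 : 0 <= P ^+ 2 := sqr_ge0 _.
have P3 : 0 <= P ^+ 3 by exact: exprn_ge0.
have K2 : 0 <= (1 + K) ^+ 2 := sqr_ge0 _.
have be0 : 0 <= be.
  by apply: addr_ge0; [apply: mulr_ge0 => //; apply: mulr_ge0|apply: mulr_ge0].
pose g i := z i j * z i 0 + y i - 2 * h i * (z i j * z i 0).
set c := 2 * (al + be + 24 * P ^+ 2 + 6 * P * be).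
have lin : `|avg (fun i => perturbed i j * perturbed i 0 / (\sum_k perturbed i k ^+ 2)) - avg g| <= c * e ^+ 2.
  rewrite -avgB; apply: ler_norm_avg => [|i].
    by rewrite mulr_ge0// /c !(mulr_ge0, addr_ge0)// sqr_ge0.
  rewrite nE DE; apply: ratio_expansion => //.
  by rewrite normrM mulr_ile1.
have avh : `|avg (fun i => h i * (z i j * z i 0)) - F j / (P * (P + 2))| <= 2 * P * (K1 * e ^+ 2).
  have -> : avg (fun i => h i * (z i j * z i 0)) = \sum_(k | k != 0) F k * avg (fun i => z i 0 ^+ 2 * (z i j * z i k)).
    under [RHS]eq_bigr do rewrite -avgZ.
    rewrite -avg_sum; apply: eq_avg => i; rewrite /h mulr_suml; apply: eq_bigr => k _; ring.
  have -> : F j / (P * (P + 2)) = \sum_(k | k != 0) F k * ((j == k)%:R / (P * (P + 2))).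
    rewrite (bigD1 j)//= eqxx big1 ?addr0 ?mul1r// => k /andP[_ kj].
    by rewrite eq_sym (negbTE kj) mul0r mulr0.
  have K1e : 0 <= K1 * e by apply: le_trans (z4 j0 j0).
  rewrite -sumrB (_ : 2 * P * (K1 * e ^+ 2) = P * (2 * e * (K1 * e))); last ring.
  rewrite big_mkcond; apply: sum_le => [|k]; first by rewrite mulr_ge0// mulr_ge0.
  case: ifP => k0; last by rewrite normr0 mulr_ge0// mulr_ge0.
  rewrite -mulrBr normrM ler_pM//; last exact: z4.
  by apply: le_trans (ler_normD _ _) _; have := Ee 0 k; have := Ee k 0; lra.
have avy : avg y = F j / P.
  rewrite avgD.
  have -> : avg (fun i => a i j * z i 0) = E j 0 / P.
    rewrite (eq_avg (g := fun i => E j 0 * (z i 0 * z i 0))).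
      by rewrite avgZ z2 eqxx mul1r.
    by move=> i; rewrite /a sum_E//; ring.
  have -> : avg (fun i => z i j * a i 0) = E 0 j / P.
    rewrite (eq_avg (g := fun i => \sum_k E 0 k * (z i j * z i k))); last first.
      by move=> i; rewrite /a mulr_sumr; apply: eq_bigr => k _; ring.
    rewrite avg_sum (bigD1 j)//= big1 ?addr0 => [|k kj]; first by rewrite avgZ z2 eqxx mul1r.
    by rewrite avgZ z2 eq_sym (negbTE kj) mul0r mulr0.
  by rewrite -mulrDl addrC.
have avg_g : avg g = F j / P - 2 * avg (fun i => h i * (z i j * z i 0)).
  rewrite /g avgB avgD z2 (negbTE j0) mul0r add0r avy -avgZ; congr (_ - _).
  by apply: eq_avg => i; ring.
rewrite [leRHS]mulrDl.
have Pn0 : P != 0 by rewrite gt_eqF// (lt_le_trans ltr01 P1).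
have P2n0 : P + 2 != 0 by rewrite gt_eqF// ltr_wpDl.
have FE : F j / (P + 2) = F j / P - 2 * (F j / (P * (P + 2))).
  exact: trace_free_factor.
rewrite -/(F j) FE.
have -> : 4 * P * K1 * e ^+ 2 = 2 * (2 * P * (K1 * e ^+ 2)) by ring.
rewrite avg_g in lin.
exact: (ler_norm_subst2 lin avh).
Qed.

End Expansion.

(** * Coefficients of the Gram-Schmidt basis in the estimated eigenbasis *)

Section GsCoeff.
Context {R : realType} (m : nat) (th0 : 'cV[R]_m.+1) (thh : 'I_m.+1 -> 'cV[R]_m.+1).
Variables (u : 'I_m.+1 -> R) (e P q : R).
Hypothesis PE : P = m.+1%:R.
Hypothesis th01 : sqnorm th0 = 1.
Hypothesis ho : forall i j, (thh i)^T *m thh j = (i == j)%:R%:M.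
Hypothesis u0 : forall k, 0 < u k.
Hypothesis ud : forall j k : 'I_m.+1, (j <= k)%N -> u k <= u j.
Let c k := dot (thh k) th0.
Hypothesis c0 : 0 <= c ord0.
Hypothesis ce : forall k, k != ord0 -> `|c k| * (u ord0 / u k) <= e.
Hypotheses (e0 : 0 <= e) (e1 : e <= 1) (qE : q = P * e ^+ 2) (small : q <= 1 / 2).

Lemma ratio_le1 (a b : R) : 0 < b -> 0 <= a -> a <= b -> a / b <= 1.
Proof. by move=> b0 a0 ab; rewrite ler_pdivrMr// mul1r. Qed.

Lemma ratio_ge0 j k : 0 <= u j / u k.
Proof. exact: divr_ge0 (ltW (u0 _)) (ltW (u0 _)). Qed.

Lemma coeff_le k : k != ord0 -> `|c k| <= e.
Proof.
move=> k0; apply: le_trans (ce k0); rewrite -[leLHS]mulr1 ler_wpM2l// ler_pdivlMr// mul1r.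
exact: ud.
Qed.

Lemma gs_len_bounds j : (1 <= j <= m.+1)%N ->
  1 - q <= gs_len th0 thh j <= 1.
Proof.
move=> /andP[j1 jm]; rewrite /gs_len lerD2l lerN2 gerBl; apply/andP; split; last first.
  by apply: sumr_ge0 => k _; exact: sqr_ge0.
apply: (@le_trans _ _ (\sum_(1 <= k < j) e ^+ 2)).
  rewrite big_nat [leRHS]big_nat; apply: ler_sum => k /andP[k1 kj].
  rewrite -[leLHS]real_normK ?num_real// ler_sqr ?nnegrE//.
  apply: coeff_le; apply/eqP => /(congr1 val); rewrite /= inordK ?(leq_trans kj)// => k0.
  by rewrite k0 in k1.
rewrite sumr_const_nat -[_ *+ _]mulr_natl qE PE ler_wpM2r ?sqr_ge0// ler_nat.
by rewrite leq_subLR (leq_trans jm)// leq_addl.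
Qed.

Lemma gs_len_gt0 j : (1 <= j <= m.+1)%N -> 0 < gs_len th0 thh j.
Proof.
move=> /gs_len_bounds/andP[h _]; apply: lt_le_trans h; rewrite subr_gt0.
by apply: le_lt_trans small _; rewrite ltr_pdivrMr// mul1r ltr1n.
Qed.

Lemma coeff0_sq : c ord0 ^+ 2 = gs_len th0 thh m.+1.
Proof.
have := sqnorm_parseval ho th0; rewrite th01 big_ord_recl -/(c ord0) => h.
rewrite /gs_len {1}h big_add1 big_mkord.
rewrite [X in _ = _ - X](eq_bigr (fun k : 'I_m => dot (thh (lift ord0 k)) th0 ^+ 2)) ?addrK// => k _.
congr (dot (thh _) _ ^+ _); apply: val_inj.
by rewrite /= inordK ?ltnS ?ltn_ord.
Qed.

Lemma coeff0_bounds : 1 - q <= c ord0 <= 1.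
Proof.
have := gs_len_bounds (leqnn m.+1 : (1 <= m.+1 <= m.+1)%N); rewrite -coeff0_sq => /andP[h1 h2].
have c1 : c ord0 <= 1 by rewrite -(@ler_sqr _ _ 1) ?nnegrE// expr1n.
rewrite c1 andbT; apply: le_trans h1 _.
by rewrite expr2 -[leRHS]mulr1 ler_wpM2l.
Qed.

(** Matrix passing from the coordinates of an observation along [thh k] divided by [u k] to its
    coordinates along the Gram-Schmidt basis divided by [u j]. *)
Definition gs_coeff j k : R := dot (thh k) (gs_basis th0 thh j) * u k / u j.

(* First-order part of [gs_coeff j k - (j == k)%:R]. *)
Definition lin_coeff (j k : 'I_m.+1) : R :=
  if j == ord0 then (if k == ord0 then 0 else c k * u k / u ord0)
  else if k == ord0 then - (c j * u ord0 / u j) else 0.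

Lemma lin_coeff_le j k : `|lin_coeff j k| <= e.
Proof.
rewrite /lin_coeff; case: ifPn => j0; case: ifPn => k0; rewrite ?normr0//.
- apply: le_trans (ce k0); rewrite -mulrA normrM ler_wpM2l//.
  rewrite ger0_norm ?ratio_ge0//; apply: (@le_trans _ _ 1).
    by apply: ratio_le1 => //; [exact: ltW|exact: ud].
  by rewrite ler_pdivlMr// mul1r ud.
- rewrite normrN -mulrA normrM (ger0_norm (ratio_ge0 _ _)); exact: ce.
Qed.

(** By cases on whether [j] and [k] are 0, using the explicit Gram-Schmidt vectors. Lengths differ
    from 1 by [O(q)], and a product of two coefficients [c] is of order [e^2]. *)
Lemma gs_coeff_lin j k : `|gs_coeff j k - (j == k)%:R - lin_coeff j k| <= 4 * P * e ^+ 2.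
Proof.
have sm := small.
have P1 : 1 <= P by rewrite PE ler1n.
have [E2 E2E] : exists x, x = e ^+ 2 by exists (e ^+ 2).
have e20 : 0 <= E2 by rewrite E2E sqr_ge0.
have P0 : 0 <= P by rewrite PE.
have Pe0 : 0 <= q by rewrite qE -E2E mulr_ge0.
have eP : E2 <= q by rewrite qE -E2E -[leLHS]mul1r ler_wpM2r.
rewrite (_ : 4 * P * e ^+ 2 = 4 * q); last by rewrite qE mulrA.
rewrite /gs_coeff /gs_basis /lin_coeff.
have [->|j0] := eqVneq j ord0.
  have [->|k0] := eqVneq k ord0.
    rewrite mulr1n subr0 mulfK ?gt_eqF// -/(c ord0).
    by have /andP[? ?] := coeff0_bounds; rewrite ler_norml; apply/andP; split; lra.
  by rewrite mulr0n subr0 subrr normr0; lra.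
have j1 : (1 <= j)%N by rewrite lt0n.
have jm : (j <= m)%N by rewrite -ltnS.
have jb1 : (1 <= j <= m.+1)%N by rewrite j1 ltnW.
have jb2 : (1 <= j.+1 <= m.+1)%N by [].
have jj : inord j = j by exact: inord_val.
have len_pos := gs_len_gt0.
rewrite (gs_vecE th01 ho len_pos j0).
have [s sE] : exists s, s = gs_len th0 thh j by exists (gs_len th0 thh j).
have [s' sE'] : exists s, s = gs_len th0 thh j.+1 by exists (gs_len th0 thh j.+1).
have /andP[s1 s2] : 1 - q <= s <= 1 by rewrite sE; exact: gs_len_bounds.
have /andP[s1' s2'] : 1 - q <= s' <= 1 by rewrite sE'; exact: gs_len_bounds.
have ss' : s' = s - c j ^+ 2 by rewrite sE' sE gs_lenS// jj.
have sp : 0 < s by lra. have sp' : 0 < s' by lra.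
set nu := vnorm (gs_raw th0 thh j).
have nu2 : nu ^+ 2 = s' / s by rewrite sE sE' vnorm_sq (sqnorm_gs_raw th01 ho len_pos) ?j1.
have nu0 : 0 < nu.
  rewrite lt0r vnorm_ge0 andbT; apply/eqP => n0; move: nu2; rewrite n0 expr0n/= => /esym/eqP.
  by rewrite mulf_eq0 invr_eq0 !gt_eqF.
(* The common denominator of the entries; it is the geometric mean of two consecutive squared
   lengths. Such opaque names keep [lra] and [field] from unfolding the terms. *)
have [x xE] : exists x, x = s * nu by exists (s * nu).
have x2 : x ^+ 2 = s * s' by rewrite xE exprMn nu2; field; rewrite gt_eqF.
have x0 : 0 < x by rewrite xE mulr_gt0.
have x1 : x <= 1.
  rewrite -(@ler_sqr _ x 1) ?nnegrE//; last exact: ltW.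
  by rewrite x2 expr1n -[leRHS]mulr1 ler_pM// ltW.
have xs : x ^+ 2 <= x by rewrite expr2 -[leRHS]mulr1 ler_wpM2l// ltW.
have xlow : 1 - 2 * q <= x.
  apply: le_trans xs; rewrite x2.
  have : (1 - q) * (1 - q) <= s * s' by rewrite ler_pM//; lra.
  have : 0 <= q * q by rewrite mulr_ge0.
  lra.
have xhalf : 1 / 2 <= x.
  rewrite -(@ler_sqr _ _ x) ?nnegrE; [|lra|exact: ltW].
  rewrite x2.
  have : (1 / 2) * (1 / 2) <= s * s' by rewrite ler_pM//; lra.
  by rewrite expr2.
have dotE' : dot (thh k) (nu^-1 *: gs_raw th0 thh j) =
    nu^-1 * ((j == k)%:R - c j / s * (if (1 <= k < j)%N then 0 else c k)).
  rewrite dotZr /gs_raw dotBr dotZr jj -sE -/(c j) (ortho_dot ho) (eq_sym k).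
  have := @dot_gs_rem _ _ th0 _ ho k j; rewrite inord_val => -> //; [by rewrite -ltnS ltn_ord|exact: leqW].
rewrite dotE'.
have ckb k' : k' != ord0 -> `|c k'| <= e := @coeff_le k'.
have [kj|kj] := eqVneq j k.
  rewrite -kj ltnn andbF (negbTE j0) subr0 mulr1n mulfK ?gt_eqF//.
  have -> : nu^-1 * (1 - c j / s * c j) = nu.
    have -> : 1 - c j / s * c j = nu ^+ 2 by rewrite nu2 ss'; field; rewrite gt_eqF.
    by rewrite expr2 mulKf// gt_eqF.
  have nu1 : nu <= 1.
    rewrite -(@ler_sqr _ nu 1) ?nnegrE//; last exact: ltW.
    by rewrite nu2 expr1n ler_pdivrMr// mul1r ss' gerBl sqr_ge0.
  have : nu ^+ 2 <= nu by rewrite expr2 -[leRHS]mulr1 ler_wpM2l// ltW.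
  have cj2 : c j ^+ 2 <= E2.
    by rewrite E2E -[leLHS]real_normK ?num_real// ler_sqr ?nnegrE// ckb.
  have : 1 - 2 * E2 <= nu ^+ 2.
    rewrite nu2 ler_pdivlMr// ss'.
    have : E2 * (1 / 2) <= E2 * s by rewrite ler_wpM2l//; lra.
    lra.
  by rewrite ler_norml => ? ?; apply/andP; split; lra.
rewrite mulr0n sub0r !subr0.
have [k0|k0] := eqVneq k ord0.
  rewrite k0 /= opprK.
  (* The entry differs from its linear part only by the factor [c_0 / x]. The error is thus the
     weighted coefficient, bounded by [ce], times the relative deviation [(x - c_0) / x]. *)
  have -> : nu^-1 * - (c j / s * c ord0) * u ord0 / u j + c j * u ord0 / u j =
     (c j * (u ord0 / u j)) * ((x - c ord0) / x).
    by rewrite xE; field; rewrite !gt_eqF.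
  rewrite normrM normrM (ger0_norm (ratio_ge0 _ _)).
  have h1 := ce j0.
  have h2 : `|(x - c ord0) / x| <= 4 * q.
    rewrite normrM normfV (gtr0_norm x0) ler_pdivrMr//.
    have : 4 * q * (1 / 2) <= 4 * q * x by rewrite ler_wpM2l// mulr_ge0.
    have /andP[? ?] := coeff0_bounds.
    by rewrite ler_norml => ?; apply/andP; split; lra.
  have : `|c j| * (u ord0 / u j) * `|(x - c ord0) / x| <= 1 * (4 * q).
    apply: ler_pM => //; first by rewrite mulr_ge0// divr_ge0 ?ltW.
    exact: le_trans h1 e1.
  by rewrite mul1r.
rewrite subr0; case: ifPn => [_|h].
  by rewrite mulr0 oppr0 mulr0 mul0r mul0r normr0; lra.
(* Triangularity of Gram-Schmidt: the entries with [1 <= k < j], for which [u k / u j] could be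
   large, are zero, and the surviving ones have a ratio at most 1. *)
have jk : (j <= k)%N.
  move: h; rewrite negb_and -leqNgt => /orP[|]; last by rewrite -leqNgt.
  by rewrite leqn0 => /eqP k0'; move: k0; rewrite -val_eqE /= k0'.
have -> : nu^-1 * - (c j / s * c k) * u k / u j = - (c j * c k * (u k / u j) / x).
  by rewrite xE; field; rewrite !gt_eqF.
rewrite normrN normrM normfV (gtr0_norm x0) ler_pdivrMr// normrM normrM.
rewrite (ger0_norm (ratio_ge0 _ _)).
have h1 : `|c j| * `|c k| <= e * e by rewrite ler_pM// ckb.
have h2 : u k / u j <= 1 by apply: ratio_le1 => //; [exact: ltW|exact: ud].
have h3 : `|c j| * `|c k| * (u k / u j) <= e * e * 1.
  by apply: ler_pM => //; exact: ratio_ge0.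
have : 4 * q * (1 / 2) <= 4 * q * x by rewrite ler_wpM2l// mulr_ge0.
apply: le_trans; apply: le_trans h3 _; rewrite mulr1 -expr2 -E2E; lra.
Qed.

End GsCoeff.

(** In an orthonormal basis starting with [th0], the projection in [Tn] removes the coordinate 0,
    and Parseval rewrites the remaining norm and those in the denominators. *)
Lemma Tn_ortho {R : realType} n m (th0 : 'cV[R]_m.+1) (b : 'I_m.+1 -> 'cV[R]_m.+1)
    (U : 'I_n -> 'cV[R]_m.+1) V :
  (forall i j, (b i)^T *m b j = (i == j)%:R%:M) -> b ord0 = th0 ->
  Tn th0 U V = n%:R * m.+1%:R * (m.+1 + 2)%:R *
    \sum_(j | j != ord0) avg (fun i => dot (b j) (isqrtmx V *m U i) *
      dot (b ord0) (isqrtmx V *m U i) / \sum_k dot (b k) (isqrtmx V *m U i) ^+ 2) ^+ 2.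
Proof.
move=> ho b0; rewrite /Tn; congr (_ * _).
rewrite vnorm_sq (sqnorm_parseval ho) (bigD1 ord0)//= -mulmxA mulmxBl mul1mx outer_mul.
have d1 : dot (b ord0) (b ord0) = 1 by rewrite (ortho_dot ho) eqxx.
rewrite {1}dotBr dotZr -b0 d1 mulr1 subrr expr0n/= add0r; apply: eq_bigr => j j0.
rewrite dotBr dotZr (ortho_dot ho) (negbTE j0) mulr0 subr0; congr (_ ^+ 2).
rewrite /Sn /avg -scalemxAl dotZr; congr (_ * _).
rewrite mulmx_suml dot_sumr; apply: eq_bigr => i _.
rewrite -scalemxAl dotZr outer_mul dotZr vnorm_sq (sqnorm_parseval ho).
by rewrite (dotC _ (b ord0)) mulrC [in RHS]mulrC (mulrC (dot (b ord0) _)) mulrC.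
Qed.

Lemma Ln_spectral {R : realType} n m (th0 : 'cV[R]_m.+1) (thh : 'I_m.+1 -> 'cV[R]_m.+1)
    (lamh u : 'I_m.+1 -> R) :
  sqnorm th0 = 1 -> (forall i j, (thh i)^T *m thh j = (i == j)%:R%:M) ->
  (forall k, 0 < u k) -> (forall k, lamh k = u k ^+ 2) ->
  Ln n th0 (specmx thh lamh) lamh = n%:R * m.+1%:R / (m.+1 + 2)%:R *
    \sum_(k | k != ord0) (dot (thh k) th0 * (u k / u ord0 - u ord0 / u k)) ^+ 2.
Proof.
move=> th01 ho u0 lE; rewrite /Ln; congr (_ * _).
have l0 k : 0 < lamh k by rewrite lE exprn_gt0.
rewrite (invmx_specmx ho)// -!/(quad _ _) !(quad_specmx).
(* Splitting the constant 2 along the eigenbasis completes a square in each coordinate. *)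
have -> : 2 = 2 * \sum_k dot (thh k) th0 ^+ 2 :> R.
  by rewrite -(sqnorm_parseval ho) th01 mulr1.
rewrite !mulr_sumr -big_split -sumrB /= (bigD1 ord0)//=.
rewrite [X in X + _](_ : _ = 0) ?add0r; last first.
  by rewrite !mulrA divff ?mulVf ?gt_eqF//; ring.
apply: eq_bigr => k _; rewrite !lE.
by field; rewrite !gt_eqF.
Qed.

(** This and [expansion_const] are the constants of [avg_perturbed] for [K = 4 * P], the value
    supplied by [gs_coeff_lin]. *)
Definition expansion_be {R : realType} (P : R) : R :=
  2 * P ^+ 2 * (4 * P) + P ^+ 3 * (1 + 4 * P) ^+ 2.
Definition expansion_const {R : realType} (P K1 : R) : R :=
  2 * ((P ^+ 2 + 2 * P * (4 * P) + 2 * P ^+ 2 * (4 * P) + P ^+ 2 * (4 * P) ^+ 2)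
     + expansion_be P + 24 * P ^+ 2 + 6 * P * expansion_be P) + 4 * P * K1.

(** Origin of the cubic rate: the difference of squares is [2 (F / p2) r + r^2], with [F] of first
    and [r] of second order. *)
Lemma sqrB_le {R : realType} (S F r C e p2 : R) : 1 <= p2 -> S - F / p2 = r ->
  `|r| <= C * e ^+ 2 -> `|F| <= 2 * e -> 0 <= e -> e <= 1 -> 0 <= C ->
  `|S ^+ 2 - (F / p2) ^+ 2| <= (4 * C + C ^+ 2) * e ^+ 3.
Proof.
move=> p1 rE rl Fl e0 e1 C0.
have p0 : 0 < p2 by exact: lt_le_trans p1.
have -> : S ^+ 2 - (F / p2) ^+ 2 = 2 * (F / p2) * r + r ^+ 2.
  by rewrite -rE; ring.
have F2 : `|F / p2| <= 2 * e.
  apply: le_trans Fl; rewrite normrM normfV (gtr0_norm p0) ler_pdivrMr//.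
  by rewrite ler_peMr.
apply: le_trans (ler_normD _ _) _.
have -> : (4 * C + C ^+ 2) * e ^+ 3 = 2 * (2 * e) * (C * e ^+ 2) + C ^+ 2 * e ^+ 3 by ring.
apply: lerD.
  rewrite normrM; apply: ler_pM => //.
  by rewrite normrM ger0_norm// ler_pM2l.
rewrite normrX.
apply: (@le_trans _ _ ((C * e ^+ 2) ^+ 2)).
  by rewrite ler_sqr ?nnegrE// mulr_ge0// sqr_ge0.
rewrite exprMn -exprM ler_wpM2l ?sqr_ge0//.
by rewrite ler_wiXn2l.
Qed.

(** * Comparison of the two statistics *)

Section Comparison.
Context {R : realType} (m n : nat) (th0 : 'cV[R]_m.+1) (thh : 'I_m.+1 -> 'cV[R]_m.+1)
  (U : 'I_n -> 'cV[R]_m.+1) (z : 'I_n -> 'I_m.+1 -> R) (nu : 'I_n -> R).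
Variables (lamh u : 'I_m.+1 -> R) (e K1 : R).
Let P : R := m.+1%:R.

Lemma Tn_Ln_le :
  sqnorm th0 = 1 -> (forall i j, (thh i)^T *m thh j = (i == j)%:R%:M) ->
  (forall k, 0 < u k) -> (forall k, lamh k = u k ^+ 2) ->
  (forall j k : 'I_m.+1, (j <= k)%N -> u k <= u j) ->
  0 <= dot (thh ord0) th0 ->
  (forall k, k != ord0 -> `|dot (thh k) th0| * (u ord0 / u k) <= e) ->
  (forall i, nu i != 0) ->
  (forall i k, dot (thh k) (U i) / u k = nu i * z i k) ->
  (forall i, \sum_k z i k ^+ 2 = 1) ->
  (forall j k, avg (fun i => z i j * z i k) = (j == k)%:R / P) ->
  (forall j k, j != 0 -> k != 0 ->
     `|avg (fun i => z i 0 ^+ 2 * (z i j * z i k)) - (j == k)%:R / (P * (P + 2))| <= K1 * e) ->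
  0 <= e -> e <= 1 -> 0 <= K1 -> 4 * P * e + expansion_be P * e ^+ 2 <= 1 / 2 ->
  `|Tn th0 U (Vtilde th0 lamh thh) - Ln n th0 (specmx thh lamh) lamh| <=
    n%:R * (P ^+ 2 * (P + 2) * (4 * expansion_const P K1 + expansion_const P K1 ^+ 2)) * e ^+ 3.
Proof.
move=> th01 ho u0 lE ud c0 ce nu0 zE z1 z2 z4 e0 e1 K10 small.
have [q qE] : exists q, q = P * e ^+ 2 by exists (P * e ^+ 2).
have P1 : 1 <= P by rewrite /P ler1n.
have be0 : 0 <= expansion_be P.
  by rewrite /expansion_be addr_ge0// !mulr_ge0// ?exprn_ge0// ?addr_ge0// mulr_ge0.
have sq : q <= 1 / 2.
  apply: le_trans small; rewrite qE.
  have h1 : P * e ^+ 2 <= P * e.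
    by rewrite ler_wpM2l// expr2 ler_piMr.
  have h2 : 0 <= expansion_be P * e ^+ 2 by rewrite mulr_ge0// sqr_ge0.
  have h3 : 0 <= P * e by rewrite mulr_ge0.
  lra.
have l0 k : 0 < lamh k by rewrite lE exprn_gt0.
have lenpos := gs_len_gt0 erefl u0 ud ce e0 qE sq.
have bo := gs_basis_ortho th01 ho lenpos.
rewrite Vtilde_specmx (Tn_ortho _ _ bo); last by rewrite /gs_basis eqxx.
rewrite (Ln_spectral n th01 ho u0 lE).
pose E := lin_coeff th0 thh u.
pose Q j k := gs_coeff th0 thh u j k - (j == k)%:R - E j k.
have ptb i j : dot (gs_basis th0 thh j) (isqrtmx (specmx (gs_basis th0 thh) lamh) *m U i) =
    nu i * perturbed z E Q i j.
  have su k : Num.sqrt (lamh k) = u k by rewrite lE sqrtr_sqr gtr0_norm.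
  rewrite (isqrtmx_specmx bo l0) dot_mulmx specmx_tr (specmx_eigen bo) dotZl su.
  rewrite (parseval ho) mulr_sumr.
  rewrite /perturbed -(sum_delta (z i) j) -!big_split mulr_sumr; apply: eq_bigr => k _ /=.
  have uz : dot (thh k) (U i) = u k * (nu i * z i k).
    by rewrite -zE mulrC divfK// gt_eqF.
  rewrite uz /Q /gs_coeff; field; rewrite gt_eqF//.
pose S j := avg (fun i => perturbed z E Q i j * perturbed z E Q i 0 /
   (\sum_k perturbed z E Q i k ^+ 2)).
rewrite (eq_bigr (fun j => S j ^+ 2)); last first.
  move=> j _; congr (_ ^+ 2); apply: eq_avg => i.
  (* The scalars [nu i] cancel because each summand is homogeneous of degree 0 in the
     observation. *)
  rewrite (eq_bigr (fun k => nu i ^+ 2 * perturbed z E Q i k ^+ 2)) => [|k _]; last first.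
    by rewrite ptb exprMn.
  rewrite -mulr_sumr !ptb invfM.
  have n2 : nu i ^+ 2 != 0 by rewrite expf_neq0.
  by rewrite (mulrACA (nu i)) (mulrACA (nu i * _)) -expr2 divff// mul1r.
pose F j := E 0 j + E j 0.
rewrite [X in _ - _ * X](eq_bigr (fun j => F j ^+ 2)) => [|j j0]; last first.
  by rewrite /F /E /lin_coeff eqxx (negbTE j0); congr (_ ^+ 2); rewrite -!mulrA -mulrBr.
have C0 : 0 <= expansion_const P K1.
  rewrite /expansion_const.
  have P0 : 0 <= P := ler0n _ _.
  by do ?[exact: be0|exact: K10|exact: P0|apply: addr_ge0|apply: mulr_ge0|apply: exprn_ge0].
have key j : j != 0 -> `|S j - F j / (P + 2)| <= expansion_const P K1 * e ^+ 2.
  move=> j0; apply: avg_perturbed => //.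
  - by move=> a b; rewrite /E /lin_coeff; case: eqP => _; case: eqP.
  - by move=> a b; exact: (lin_coeff_le u0 ud ce e0).
  - by move=> a b; exact: (gs_coeff_lin erefl th01 ho u0 ud c0 ce e0 e1 qE sq).
  - by rewrite mulr_ge0.
have Fle j : `|F j| <= 2 * e.
  rewrite /F mulr_natl mulr2n; apply: le_trans (ler_normD _ _) _.
  by apply: lerD; exact: (lin_coeff_le u0 ud ce e0).
have p2E : (m.+1 + 2)%:R = P + 2 by rewrite natrD.
have p20 : 1 <= P + 2 by rewrite (le_trans P1)// lerDl.
rewrite p2E.
(* The prefactors agree: [P (P + 2)] times the square of [1 / (P + 2)] is the [P / (P + 2)] of [Ln],
   whose summands are exactly the [F j ^+ 2]. *)
have -> : n%:R * P * (P + 2) * (\sum_(j | j != ord0) S j ^+ 2) -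
   n%:R * P / (P + 2) * (\sum_(j | j != ord0) F j ^+ 2) =
   n%:R * P * (P + 2) * \sum_(j | j != ord0) (S j ^+ 2 - (F j / (P + 2)) ^+ 2).
  rewrite sumrB mulrBr; congr (_ - _).
  rewrite [in RHS](eq_bigr (fun j => (P + 2) ^- 2 * F j ^+ 2)) => [|j _]; last first.
    by rewrite exprMn exprVn mulrC.
  rewrite -mulr_sumr; field; rewrite gt_eqF// (lt_le_trans _ p20)//.
rewrite normrM ger0_norm; last by rewrite !mulr_ge0// addr_ge0.
have -> (C : R) : n%:R * (P ^+ 2 * (P + 2) * C) * e ^+ 3 =
  n%:R * P * (P + 2) * (P * (C * e ^+ 3)) by ring.
rewrite ler_wpM2l//; first by rewrite !mulr_ge0// addr_ge0.
apply: le_trans (ler_norm_sum _ _ _) _.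
set X := (X in _ * X).
have X0 : 0 <= X by rewrite /X mulr_ge0 ?exprn_ge0// addr_ge0 ?sqr_ge0// mulr_ge0.
apply: (@le_trans _ _ (\sum_(j < m.+1) X)); last first.
  by rewrite sumr_const card_ord -[X *+ _]mulr_natl.
rewrite [leRHS](bigID (fun j => j != ord0))/= -[leLHS]addr0.
apply: lerD; last exact: sumr_ge0.
apply: ler_sum => j j0.
apply: (sqrB_le p20 erefl (key _ j0) (Fle j) e0 e1 C0).
Qed.

End Comparison.

(** * The deterministic bound *)

Section TylerScatter.
Context {R : realType} (p n : nat).
Implicit Types (U W : 'I_n -> 'cV[R]_p) (V B X Y : 'M[R]_p).

(** Square-root-free form of [Sn], in terms of the inverse shape [B]; it transforms simply under
    linear maps and is homogeneous in [B]. *)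
Definition scatter B U : 'M[R]_p := \matrix_(a, b) avg (fun i => U i a 0 * U i b 0 / quad B (U i)).

Lemma scatter_sum B U :
  scatter B U = n%:R^-1 *: \sum_i (quad B (U i))^-1 *: (U i *m (U i)^T).
Proof.
apply/matrixP => a b; rewrite !mxE summxE /avg; congr (_ * _); apply: eq_bigr => i _.
by rewrite !mxE big_ord1 !mxE mulrC.
Qed.

Lemma is_isqrt_unit V M : is_isqrt V M -> [/\ M \in unitmx, M *m V *m M = 1%:M & M *m M = invmx V].
Proof.
move=> [Mp]; rewrite -mulmxA => h.
have [uM _] := mulmx1_unit h; have [_ uV] : M *m M \in unitmx /\ V \in unitmx.
  by apply: mulmx1_unit; rewrite -mulmxA.
split=> //; first exact: mulmx1C.
by rewrite -[LHS]mulmx1 -(mulmxV uV) !mulmxA -(mulmxA M) h mul1mx.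
Qed.

Lemma Sn_scatter U V : posdef V -> Sn U V = isqrtmx V *m scatter (invmx V) U *m isqrtmx V.
Proof.
move=> Vp; have sq := isqrtmxP Vp; have [_ _ MM] := is_isqrt_unit sq.
have Ms : (isqrtmx V)^T = isqrtmx V by case: sq => -[].
rewrite /Sn scatter_sum -scalemxAr -scalemxAl; congr (_ *: _).
rewrite mulmx_sumr mulmx_suml; apply: eq_bigr => i _.
rewrite -scalemxAr -scalemxAl trmx_mul Ms !mulmxA; congr (_^-1 *: _).
by rewrite vnorm_sq -MM -{2}Ms quad_gram.
Qed.

Lemma Sn_eq_scalar U V c : posdef V -> Sn U V = c%:M <-> scatter (invmx V) U = c *: V.
Proof.
move=> Vp; have sq := isqrtmxP Vp; have [uM MVM _] := is_isqrt_unit sq.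
rewrite Sn_scatter//; set M := isqrtmx V in uM MVM *; split => [h|->]; last first.
  by rewrite -scalemxAr -scalemxAl MVM scalemx1.
apply: (can_inj (mulKmx uM)); apply: (can_inj (mulmxK uM)).
by rewrite h -scalemxAr -scalemxAl MVM scalemx1.
Qed.

(** Affine equivariance; the lengths [nu i] drop out since the summands have degree 0. *)
Lemma scatter_pull B L W U (nu : 'I_n -> R) : (forall i, nu i != 0) ->
  (forall i, U i = nu i *: (L *m W i)) ->
  scatter B U = L *m scatter (L^T *m B *m L) W *m L^T.
Proof.
move=> nu0 UE; rewrite !scatter_sum -scalemxAr -scalemxAl; congr (_ *: _).
rewrite mulmx_sumr mulmx_suml; apply: eq_bigr => i _.
have aT (a : R) (y : 'cV[R]_p) : (a *: y)^T = a *: y^T by rewrite linearZ.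
rewrite UE aT -scalemxAr -!scalemxAl -scalemxAr -scalemxAl !scalerA trmx_mul !mulmxA; congr (_ *: _).
have -> : quad B (nu i *: (L *m W i)) = nu i ^+ 2 * quad (L^T *m B *m L) (W i).
  by rewrite !quad_dot dotZl -scalemxAr dotZr mulrA -expr2 -!mulmxA !dot_mulmx trmxK.
rewrite invfM; have n2 : nu i ^+ 2 != 0 by rewrite expf_neq0.
by rewrite mulrAC -[nu i * _]expr2 mulVf// mul1r.
Qed.

Lemma scatterZ B W c : c != 0 -> scatter (c *: B) W = c^-1 *: scatter B W.
Proof.
move=> c0; rewrite !scatter_sum scalerA mulrC -scalerA; congr (_ *: _).
rewrite scaler_sumr; apply: eq_bigr => i _.
by rewrite quadZ invfM scalerA.
Qed.

Lemma posdef_congr B L : L \in unitmx -> posdef B -> posdef (L^T *m B *m L).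
Proof.
move=> uL Bp; split; first by rewrite !trmx_mul trmxK Bp.1 mulmxA.
move=> x x0; have -> : (x^T *m (L^T *m B *m L) *m x) 0 0 = quad B (L *m x).
  by rewrite /quad trmx_mul !mulmxA.
apply: posdef_quad_gt0 => //; apply: contra x0 => /eqP h.
by rewrite -[x](mulKmx uL) h mulmx0.
Qed.

Lemma posdef_unit B : posdef B -> B \in unitmx.
Proof. by move=> Bp; have [M [_ /mulmx1_unit[]]] := posdef_isqrt Bp. Qed.

Lemma posdef_inv B : posdef B -> posdef (invmx B).
Proof.
move=> Bp; have uB := posdef_unit Bp.
have -> : invmx B = (invmx B)^T *m B *m invmx B.
  by rewrite trmx_inv Bp.1 mulVmx// mul1mx.
by apply: posdef_congr; rewrite // unitmx_inv.
Qed.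

Lemma posdefZ B c : 0 < c -> posdef B -> posdef (c *: B).
Proof.
move=> c0 Bp; split; first by rewrite linearZ /= Bp.1.
by move=> x x0; rewrite -/(quad _ _) quadZ mulr_gt0// posdef_quad_gt0.
Qed.

Lemma posdef_diag B a : posdef B -> 0 < B a a.
Proof.
move=> Bp; have := @posdef_quad_gt0 _ _ B (delta_mx a 0) Bp.
rewrite quad_dot dot_mulmx Bp.1 /dot.
have -> : ((B *m delta_mx a 0)^T *m delta_mx a 0 : 'M[R]_1) 0 0 = B a a.
  by rewrite trmx_mul Bp.1 trmx_delta -rowE -colE !mxE.
apply; apply/eqP => /matrixP/(_ a 0); rewrite !mxE !eqxx => /eqP; rewrite oner_eq0//.
Qed.

(** The quadratic form is nonnegative at [e_a + e_b] and [e_a - e_b]. *)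
Lemma posdef_entry B a b : posdef B -> `|B a b| <= (B a a + B b b) / 2.
Proof.
move=> Bp.
have q (s : R) : s ^+ 2 = 1 -> 0 <= B a a + 2 * s * B b a + B b b.
  move=> s1; have := posdef_quad_ge0 (delta_mx a 0 + s *: delta_mx b 0) Bp.
  rewrite bilin_quad ?Bp.1// s1 mul1r.
  have e (i j : 'I_p) : ((delta_mx i 0)^T *m B *m delta_mx j 0 : 'M[R]_1) 0 0 = B i j.
    by rewrite trmx_delta -rowE -colE !mxE.
  by rewrite /quad !e.
have := q 1 (expr1n _ _); have := q (-1) _; rewrite sqrrN expr1n => /(_ erefl).
have -> : B a b = B b a by rewrite -{1}Bp.1 mxE.
by rewrite ler_norml => h1 h2; apply/andP; split; lra.
Qed.

Lemma posdef_l1 B : posdef B -> l1 B <= p%:R * \tr B.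
Proof.
move=> Bp; rewrite /l1; apply: (@le_trans _ _ (\sum_a \sum_b (B a a + B b b) / 2)).
  by apply: ler_sum => a _; apply: ler_sum => b _; exact: posdef_entry.
under eq_bigr => a _ do rewrite -mulr_suml big_split /= sumr_const card_ord.
rewrite -mulr_suml big_split /= sumr_const card_ord sumrMnl -!/(\tr B).
by rewrite -[_ *+ _]mulr_natl add_halves.
Qed.

End TylerScatter.

Lemma posdef_tr_gt0 {R : realType} p (B : 'M[R]_p.+1) : posdef B -> 0 < \tr B.
Proof.
move=> Bp; rewrite /mxtrace big_ord_recl ltr_pwDl ?posdef_diag//.
by apply: sumr_ge0 => k _; exact: ltW (posdef_diag _ Bp).
Qed.

(** * Transfer of Tyler's equation between observed and standardised data *)

Section TylerTransfer.
Context {R : realType} (m n : nat).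
Variables (L : 'M[R]_m.+1) (W U : 'I_n -> 'cV[R]_m.+1) (nu : 'I_n -> R).
Hypotheses (uL : L \in unitmx) (nu0 : forall i, nu i != 0)
  (UE : forall i, U i = nu i *: (L *m W i)).
Let P : R := m.+1%:R.

Lemma invmx_left (A B : 'M[R]_m.+1) : A *m B = 1%:M -> invmx B = A.
Proof.
move=> AB; have [_ uB] := mulmx1_unit AB.
by rewrite -[LHS]mul1mx -AB -mulmxA mulmxV// mulmx1.
Qed.

Lemma avg_quad_ratio (A B : 'M[R]_m.+1) :
  avg (fun i => quad A (W i) / quad B (W i)) = \tr (A *m scatter B W).
Proof.
rewrite scatter_sum -scalemxAr mxtraceZ /avg; congr (_ * _).
rewrite mulmx_sumr raddf_sum; apply: eq_bigr => i _ /=.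
rewrite -scalemxAr mxtraceZ mulmxA mxtrace_mulC /quad -mulmxA trace_mx11.
by rewrite mulrC mulmxA.
Qed.

(** Discharges the existence premise of [tyler_spec]: the solution [X] for the [W i] is transported
    to [L X^-1 L'] and rescaled to trace [p], which the homogeneity of [scatter] allows. *)
Lemma tyler_solution X : posdef X -> scatter X W *m X = (P^-1)%:M ->
  exists V, shape_mx V /\ Sn U V = P^-1 *: 1%:M.
Proof.
move=> Xp XE; have uX := posdef_unit Xp.
have uLT : L^T \in unitmx by rewrite unitmx_tr.
pose V := L *m invmx X *m L^T.
have Vp : posdef V.
  rewrite /V -{1}(trmxK L); apply: posdef_congr => //; exact: posdef_inv.
have Vi : invmx V = invmx L^T *m X *m invmx L.
  apply: invmx_left; rewrite /V !mulmxA (mulmxKV uL) (mulmxK uX) mulVmx//.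
pose c := P / \tr V.
have c0 : 0 < c by rewrite divr_gt0 ?posdef_tr_gt0// /P ltr0n.
have cVi : invmx (c *: V) = c^-1 *: invmx V.
  apply: invmx_left; rewrite -scalemxAl -scalemxAr scalerA mulVf ?gt_eqF// scale1r.
  by rewrite mulVmx// posdef_unit.
have SX : scatter X W = P^-1 *: invmx X.
  by rewrite -[LHS](mulmxK uX) XE mul_scalar_mx.
exists (c *: V); split.
  split; first exact: posdefZ.
  by rewrite mxtraceZ /c divfK// gt_eqF// posdef_tr_gt0.
rewrite scalemx1; apply/Sn_eq_scalar; first exact: posdefZ.
rewrite cVi scatterZ ?invr_eq0 ?gt_eqF// invrK (scatter_pull _ nu0 UE).
have -> : L^T *m invmx V *m L = X.
  by rewrite Vi !mulmxA (mulmxV uLT) mul1mx mulmxKV.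
by rewrite SX -scalemxAr -scalemxAl !scalerA mulrC.
Qed.

Lemma tyler_pulled V : posdef V -> Sn U V = P^-1 *: 1%:M ->
  let Y := L^T *m invmx V *m L in posdef Y /\ scatter Y W *m Y = (P^-1)%:M.
Proof.
move=> Vp; rewrite scalemx1 => /(Sn_eq_scalar _ _ Vp) h Y.
have uLT : L^T \in unitmx by rewrite unitmx_tr.
have Yp : posdef Y by apply: posdef_congr => //; exact: posdef_inv.
split=> //.
have uV := posdef_unit Vp.
have SY : scatter Y W = invmx L *m (P^-1 *: V) *m invmx L^T.
  by rewrite -h (scatter_pull _ nu0 UE) -/Y !mulmxA mulVmx// mul1mx mulmxK.
rewrite SY /Y -scalemxAr -!scalemxAl !mulmxA (mulmxKV uLT) (mulmxK uV) mulVmx//.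
by rewrite scalemx1.
Qed.

(** Collects the hypotheses of [tyler_close]. The bound on [l1 X] needs only positivity and the
    trace, and the last average is the trace of Tyler's equation multiplied by [X]. *)
Lemma tyler_normalized Y : posdef Y -> scatter Y W *m Y = (P^-1)%:M ->
  let X := (P / \tr Y) *: Y in
  [/\ posdef X, \tr X = P, l1 X <= P ^+ 2, scatter X W *m X = (P^-1)%:M &
      avg (fun i => quad (X *m X) (W i) / quad X (W i)) = 1].
Proof.
move=> Yp YE X; have t0 := posdef_tr_gt0 Yp.
have c0 : 0 < P / \tr Y by rewrite divr_gt0 // /P ltr0n.
have Xp : posdef X by exact: posdefZ.
have tX : \tr X = P by rewrite mxtraceZ divfK// gt_eqF.
have XE : scatter X W *m X = (P^-1)%:M.
  rewrite /X scatterZ ?gt_eqF// -scalemxAr -scalemxAl scalerA divff ?gt_eqF//.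
  by rewrite scale1r.
split=> //.
  by apply: le_trans (posdef_l1 Xp) _; rewrite tX -/P expr2.
rewrite avg_quad_ratio -mulmxA mxtrace_mulC -mulmxA XE.
rewrite mxtrace_mulC mul_scalar_mx.
by rewrite mxtraceZ tX mulVf// /P pnatr_eq0.
Qed.

End TylerTransfer.

Lemma sqr_sum_mxtrace {R : realType} p (A : 'M[R]_p) : \sum_i \sum_j A i j ^+ 2 = \tr (A *m A^T).
Proof.
by apply: eq_bigr => i _; rewrite mxE; apply: eq_bigr => j _; rewrite mxE expr2.
Qed.

(* [N N'] and [N' N] have the same spectrum. *)
Lemma gram_frobenius {R : realType} p (N : 'M[R]_p) :
  \sum_i \sum_j (N *m N^T - 1%:M) i j ^+ 2 = \sum_i \sum_j (N^T *m N - 1%:M) i j ^+ 2.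
Proof.
have e (A : 'M[R]_p) : A^T = A -> \tr ((A - 1%:M) *m (A - 1%:M)^T) = \tr (A *m A) - 2 * \tr A + p%:R.
  move=> As; rewrite linearB /= As trmx1 mulmxBr mulmx1 mulmxBl mul1mx !raddfB /= mxtrace1; ring.
rewrite !sqr_sum_mxtrace !e ?trmx_mul ?trmxK//.
have -> : \tr (N *m N^T *m (N *m N^T)) = \tr (N^T *m N *m (N^T *m N)).
  by rewrite -mulmxA mxtrace_mulC !mulmxA.
by rewrite (mxtrace_mulC N).
Qed.

(** * Moments of the signs standardised by the estimator *)

Section GramMoments.
Context {R : realType} (m n : nat) (W : 'I_n -> 'cV[R]_m.+1) (N : 'M[R]_m.+1) (d delta : R).
Let P : R := m.+1%:R.
Hypothesis W1 : forall i, sqnorm (W i) = 1.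
Hypothesis Wd : forall a b c d, `|m4 W a b c d - kap a b c d| <= delta.
Hypothesis Nd : l1 (N^T *m N - 1%:M) <= d.
Hypotheses (d1 : d <= 1 / 2) (Np : posdef (N^T *m N)).
Hypothesis NW : scatter (N^T *m N) W *m (N^T *m N) = (P^-1)%:M.

(** The hypotheses concern [N^T *m N], whereas the coordinates of [N *m W] are governed by the Gram
    matrix of the rows of [N]. *)
Definition gram_dev : 'M[R]_m.+1 := N *m N^T - 1%:M.

Lemma gram_dev_le j k : `|gram_dev j k| <= d.
Proof.
have d0 : 0 <= d := le_trans (l1_ge0 _) Nd.
rewrite -(@ler_sqr _ _ d) ?nnegrE// real_normK ?num_real//.
have l1sq (A : 'M[R]_m.+1) : \sum_i \sum_j A i j ^+ 2 <= l1 A ^+ 2.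
  apply: (@le_trans _ _ (\sum_i \sum_j `|A i j| * l1 A)).
    apply: ler_sum => a _; apply: ler_sum => b _.
    by rewrite -[leLHS]real_normK ?num_real// expr2 ler_wpM2l// norm_le_l1.
  under eq_bigr => a _ do rewrite -mulr_suml.
  by rewrite -mulr_suml expr2.
apply: (@le_trans _ _ (\sum_i \sum_j gram_dev i j ^+ 2)).
  rewrite (bigD1 j)//= (bigD1 k)//= -addrA lerDl addr_ge0//.
    by apply: sumr_ge0 => b _; exact: sqr_ge0.
  by apply: sumr_ge0 => a _; apply: sumr_ge0 => b _; exact: sqr_ge0.
rewrite /gram_dev gram_frobenius; apply: le_trans (l1sq _) _.
by rewrite ler_sqr ?nnegrE// l1_ge0.
Qed.

Let q i := quad (N^T *m N) (W i).

Lemma gram_q i : `|q i - 1| <= d.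
Proof.
rewrite /q -(W1 i) -quad1 -quadB; apply: le_trans (quad_le_l1 _ (W1 i)) _; exact: Nd.
Qed.

Lemma gram_q_gt0 i : 0 < q i.
Proof.
have := gram_q i; have h := d1; rewrite ler_norml => /andP[h1 h2]; lra.
Qed.

Definition gram_z i k := (N *m W i) k 0 / Num.sqrt (q i).

Lemma gram_zM i j k : gram_z i j * gram_z i k = (N *m W i) j 0 * (N *m W i) k 0 / q i.
Proof.
by rewrite /gram_z mulrACA -invfM -expr2 sqr_sqrtr// ltW// gram_q_gt0.
Qed.

Lemma gram_z1 i : \sum_k gram_z i k ^+ 2 = 1.
Proof.
under eq_bigr => k _ do rewrite expr2 gram_zM -expr2.
rewrite -mulr_suml -/(sqnorm (N *m W i)) -quad_gram divff// gt_eqF//; exact: gram_q_gt0.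
Qed.

(** Exact, not approximate: Tyler's equation makes [scatter] equal to [(N'N)^-1 / P], and
    conjugation by [N] turns this into [1 / P]. *)
Lemma gram_z2 j k : avg (fun i => gram_z i j * gram_z i k) = (j == k)%:R / P.
Proof.
transitivity ((N *m scatter (N^T *m N) W *m N^T) j k).
  rewrite scatter_sum -scalemxAr -scalemxAl mxE /avg; congr (_ * _).
  rewrite mulmx_sumr mulmx_suml summxE; apply: eq_bigr => i _.
  rewrite -scalemxAr -scalemxAl (mulmxA N) -(mulmxA (N *m _)) -trmx_mul.
  by rewrite gram_zM [RHS]mxE [(N *m W i *m _) _ _]mxE big_ord1 [(N *m W i)^T _ _]mxE mulrC.
have uX := posdef_unit Np.
have uN : N \in unitmx by have := uX; rewrite unitmx_mul => /andP[].
have -> : scatter (N^T *m N) W = P^-1 *: invmx (N^T *m N).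
  by rewrite -[LHS](mulmxK uX) NW mul_scalar_mx.
have -> : invmx (N^T *m N) = invmx N *m invmx N^T.
  by apply: invmx_left; rewrite !mulmxA (mulmxKV (_ : N^T \in unitmx)) ?unitmx_tr// mulVmx.
rewrite -scalemxAr -scalemxAl !mulmxA mulmxV// mul1mx mulVmx ?unitmx_tr//.
by rewrite !mxE mulrC.
Qed.

Let v k := (row k N)^T.

Let NWE i k : (N *m W i) k 0 = dot (v k) (W i).
Proof. by rewrite dotE mxE; apply: eq_bigr => a _; rewrite !mxE. Qed.

Let vdot j k : dot (v j) (v k) = (j == k)%:R + gram_dev j k.
Proof.
rewrite dotE [gram_dev _ _]mxE [X in _ + (X + _)]mxE [X in _ + (_ + X)]mxE [X in _ - X]mxE addrC subrK.
by apply: eq_bigr => a _; rewrite !mxE.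
Qed.

Let v_le k a : `|v k a 0| <= 2.
Proof.
have h : v k a 0 ^+ 2 <= 2.
  apply: (@le_trans _ _ (dot (v k) (v k))).
    rewrite dotE (bigD1 a)//= -expr2 lerDl.
    by apply: sumr_ge0 => b _; rewrite -expr2 sqr_ge0.
  rewrite vdot eqxx; have := gram_dev_le k k; rewrite ler_norml => /andP[_ h].
  by have h' := d1; rewrite mulr1n; lra.
rewrite -(@ler_sqr _ _ 2) ?nnegrE// real_normK ?num_real//; lra.
Qed.

Let v_l1 j k : l1 (v j *m (v k)^T) <= 4 * P ^+ 2.
Proof.
rewrite /l1 (_ : 4 * P ^+ 2 = \sum_(a < m.+1) \sum_(b < m.+1) 2 * 2); last first.
  by rewrite !sumr_const card_ord -[_ *+ m.+1 in RHS]mulr_natl -[2 * 2 *+ m.+1]mulr_natl -/P; ring.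
apply: ler_sum => a _; apply: ler_sum => b _.
by rewrite mxE big_ord1 normrM; apply: ler_pM => //; rewrite -?[(v k)^T]/(row k N) ?trmxK; have := v_le k b; rewrite mxE.
Qed.

Let quad_outer j k x : quad (v j *m (v k)^T) x = dot (v j) x * dot (v k) x.
Proof. by rewrite quad_dot outer_mul dotZr (dotC x) mulrC. Qed.

(** Replacing the norms [q i] by 1 costs [3 d], the moments of the [W i] cost [16 P^4 delta] through
    the entrywise norms of two outer products, and the failure of the rows of [N] to be orthonormal
    costs [4 d]. *)
Lemma gram_z4 j k : j != 0 -> k != 0 ->
  `|avg (fun i => gram_z i 0 ^+ 2 * (gram_z i j * gram_z i k)) - (j == k)%:R / (P * (P + 2))|
  <= 16 * P ^+ 4 * delta + 8 * d.
Proof.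
move=> j0 k0.
have d0 : 0 <= d := le_trans (l1_ge0 _) Nd.
have d12 := d1.
have P1 : 1 <= P by rewrite /P ler1n.
have zle i l : `|gram_z i l| <= 1.
  rewrite -(@ler_sqr _ _ 1) ?nnegrE// expr1n real_normK ?num_real// -(gram_z1 i).
  by rewrite (bigD1 l)//= lerDl sumr_ge0// => ? _; exact: sqr_ge0.
pose A := v 0 *m (v 0)^T; pose B := v j *m (v k)^T.
have AB i : quad A (W i) * quad B (W i) =
    gram_z i 0 ^+ 2 * (gram_z i j * gram_z i k) * q i ^+ 2.
  rewrite /A /B !quad_outer -!NWE expr2 !gram_zM.
  have qn : q i != 0 by rewrite gt_eqF// gram_q_gt0.
  by field.
have e1 : `|avg (fun i => gram_z i 0 ^+ 2 * (gram_z i j * gram_z i k)) -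
    avg (fun i => quad A (W i) * quad B (W i))| <= 3 * d.
  rewrite -avgB; apply: ler_norm_avg => [|i]; first by rewrite mulr_ge0.
  rewrite AB; set y := _ * (_ * _).
  have -> : y - y * q i ^+ 2 = y * (1 - q i ^+ 2) by ring.
  have y1 : `|y| <= 1.
    have y1 : `|gram_z i 0 ^+ 2| <= 1 by rewrite normrX exprn_ile1.
    have y2 : `|gram_z i j * gram_z i k| <= 1 by rewrite normrM mulr_ile1.
    by rewrite /y normrM mulr_ile1.
  have := gram_q i; set t := q i - 1 => t1.
  have -> : 1 - q i ^+ 2 = - (2 * t + t ^+ 2) by rewrite /t; ring.
  rewrite normrM normrN -[leRHS]mul1r; apply: ler_pM => //.
  apply: le_trans (ler_normD _ _) _; rewrite normrM normrX ger0_norm//.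
  have : `|t| ^+ 2 <= d * 1 by rewrite expr2 ler_pM//; apply: le_trans t1 _; lra.
  lra.
have e2 := avg_quad4 Wd A B.
have e3 : delta * (l1 A * l1 B) <= 16 * P ^+ 4 * delta.
  have de0 : 0 <= delta by exact: le_trans (Wd 0 0 0 0).
  have : l1 A * l1 B <= (4 * P ^+ 2) * (4 * P ^+ 2) by apply: ler_pM; rewrite ?l1_ge0 ?v_l1.
  rewrite (_ : 16 * P ^+ 4 * delta = delta * ((4 * P ^+ 2) * (4 * P ^+ 2))); last by ring.
  by move=> h; rewrite ler_wpM2l.
have trA : \tr A = 1 + gram_dev 0 0.
  by rewrite /A mxtrace_mulC trace_mx11 -/(dot _ _) vdot eqxx.
have trB : \tr B = (j == k)%:R + gram_dev j k.
  by rewrite /B mxtrace_mulC trace_mx11 -/(dot _ _) dotC vdot.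
have sAB : \sum_a \sum_b A a b * B a b = gram_dev 0 j * gram_dev 0 k.
  have -> : gram_dev 0 j * gram_dev 0 k = dot (v 0) (v j) * dot (v 0) (v k).
    by rewrite !vdot !(eq_sym 0) (negbTE j0) (negbTE k0) !add0r.
  rewrite !dotE mulr_suml; apply: eq_bigr => a _; rewrite mulr_sumr; apply: eq_bigr => b _.
  by rewrite /A /B !mxE !big_ord1 !mxE mulrACA.
have sAB' : \sum_a \sum_b A a b * B b a = gram_dev 0 j * gram_dev 0 k.
  rewrite -sAB exchange_big; apply: eq_bigr => a _; apply: eq_bigr => b _ /=; congr (_ * _).
  by rewrite /A !mxE !big_ord1 !mxE mulrC.
move: e2; rewrite trA trB sAB sAB' => e2.
have [x xE] : exists x, x = gram_dev 0 0 by eexists.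
have [y yE] : exists y, y = gram_dev j k by eexists.
have [z zE] : exists z, z = gram_dev 0 j * gram_dev 0 k by eexists.
have x1 : `|x| <= d by rewrite xE gram_dev_le.
have y1 : `|y| <= d by rewrite yE gram_dev_le.
have dd : d * d <= d / 2 by rewrite ler_wpM2l//; lra.
have z1 : `|z| <= d / 2 by apply: le_trans dd; rewrite zE normrM ler_pM// gram_dev_le.
have xy1 : `|x * y| <= d / 2 by apply: le_trans dd; rewrite normrM ler_pM.
rewrite -xE -yE -zE in e2.
have [b bE] : exists b : R, b = (j == k)%:R by eexists.
have xb : `|x * b| <= d.
  by rewrite -[d]mulr1 normrM ler_pM// bE; case: (j == k); rewrite ?normr1 ?normr0.
rewrite -bE in e2 *.
have PP : 1 <= P * (P + 2) by rewrite -[leLHS]mulr1; apply: ler_pM => //; lra.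
have e4 : `|((1 + x) * (b + y) + z + z) / (P * (P + 2)) - b / (P * (P + 2))| <= 4 * d.
  rewrite -mulrBl normrM normfV (ger0_norm (le_trans ler01 PP)) ler_pdivrMr ?(lt_le_trans ltr01)//.
  apply: (@le_trans _ _ (4 * d)); last by rewrite ler_peMr// mulr_ge0.
  have -> : (1 + x) * (b + y) + z + z - b = y + x * b + x * y + z + z by ring.
  by move: y1 xb xy1 z1; rewrite !ler_norml => /andP[? ?] /andP[? ?] /andP[? ?] /andP[? ?]; apply/andP; split; lra.
rewrite -/P in e2; move: e1 e2 e3 e4.
set X4 := b / _; set X3 := (_ + z + z) / _; set X1 := avg _; set X2 := avg _ => e1 e2 e3 e4.
have -> : X1 - X4 = (X1 - X2) + (X2 - X3) + (X3 - X4) by ring.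
by move: e1 e2 e4; rewrite !ler_norml => /andP[? ?] /andP[? ?] /andP[? ?]; apply/andP; split; lra.
Qed.

End GramMoments.

(** * Consequences of the eigenvalue gap *)

Section EigenGap.
Context {R : realType} (m : nat).
Variables (th thh : 'I_m.+1 -> 'cV[R]_m.+1) (lam v : 'I_m.+1 -> R) (D : 'M[R]_m.+1) (d eta : R).
Let P : R := m.+1%:R.
Hypothesis ho : forall i j, (th i)^T *m th j = (i == j)%:R%:M.
Hypothesis hho : forall i j, (thh i)^T *m thh j = (i == j)%:R%:M.
Hypothesis v0 : forall k, 0 < v k.
Hypothesis vd : forall k, v k <= v ord0.
Hypothesis VD : forall j k, dot (thh j) (specmx th lam *m thh k) = v j * v k * ((j == k)%:R + D j k).
Hypothesis Dd : forall j k, `|D j k| <= d.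
Hypothesis eta0 : 0 < eta.
Hypothesis gap : forall j, j != ord0 -> lam j * (1 + eta) <= lam ord0.
Hypothesis lam0 : forall j, 0 < lam j.
Hypothesis dsmall : 4 * d * (1 + eta) <= eta.
Let c k := dot (thh k) (th ord0).

Let d0 : 0 <= d. Proof. exact: le_trans (Dd ord0 ord0). Qed.

Let d14 : d <= 1 / 4.
Proof.
have h := dsmall; have e0 := eta0; have h0 := d0.
have : (4 * d) * (1 + eta) <= 1 * (1 + eta) by lra.
by rewrite ler_pM2r; lra.
Qed.

(** The Rayleigh quotient of [thh ord0] is at most the top eigenvalue, and by [VD] it is
    [v ord0 ^+ 2] up to the factor [1 + D ord0 ord0]. *)
Lemma top_weight : v ord0 ^+ 2 <= 2 * lam ord0.
Proof.
have := VD ord0 ord0; rewrite eqxx mulr1n -expr2.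
rewrite -quad_dot (quad_specmx) => h.
have le : quad (specmx th lam) (thh ord0) <= lam ord0.
  rewrite quad_specmx -[leRHS]mulr1.
  have -> : 1 = sqnorm (thh ord0) by rewrite -dot_sqnorm (ortho_dot hho) eqxx.
  rewrite (sqnorm_parseval ho) mulr_sumr; apply: ler_sum => j _.
  rewrite ler_wpM2r ?sqr_ge0//; have [->//|j0] := eqVneq j ord0.
  by apply: le_trans (gap j0); rewrite ler_peMr ?(ltW (lam0 _))// lerDl (ltW eta0).
have := Dd ord0 ord0; rewrite ler_norml => /andP[h1 _].
rewrite quad_specmx h in le.
have h2 := d14; have : v ord0 ^+ 2 * (1 / 2) <= v ord0 ^+ 2 * (1 + D ord0 ord0).
  by rewrite ler_wpM2l ?sqr_ge0//; lra.
lra.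
Qed.

(* [c_k thh_0 - c_0 thh_k] is orthogonal to [th_0], so its Rayleigh quotient is
   at most [lam_0 / (1 + eta)]. *)
Lemma lower_weight k : k != ord0 -> c k != 0 ->
  v k ^+ 2 * ((1 - 2 * d) * (1 + eta)) <= lam ord0.
Proof.
move=> k0 ck; pose x := c k *: thh ord0 - c ord0 *: thh k.
have x0 : dot (th ord0) x = 0.
  by rewrite /x dotBr !dotZr !(dotC (th ord0)) -/(c k) -/(c ord0) mulrC subrr.
have xx : sqnorm x = c k ^+ 2 + c ord0 ^+ 2.
  rewrite /x -dot_sqnorm dotBr !dotBl !dotZr !dotZl !(ortho_dot hho) !eqxx (negbTE k0).
  by rewrite (eq_sym ord0) (negbTE k0) !mulr1n !mulr0n; ring.
have up : quad (specmx th lam) x * (1 + eta) <= lam ord0 * sqnorm x.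
  rewrite quad_specmx (sqnorm_parseval ho) mulr_suml mulr_sumr; apply: ler_sum => j _.
  have [->|j0] := eqVneq j ord0; first by rewrite x0 expr0n/= !mulr0 mul0r.
  by rewrite mulrAC ler_wpM2r ?sqr_ge0// gap.
have qE : quad (specmx th lam) x = c k ^+ 2 * (v ord0 ^+ 2 * (1 + D ord0 ord0))
   - c k * c ord0 * (v ord0 * v k * (D ord0 k + D k ord0)) + c ord0 ^+ 2 * (v k ^+ 2 * (1 + D k k)).
  rewrite quad_dot /x mulmxBr -!scalemxAr dotBr !dotBl !dotZr !dotZl !VD !eqxx.
  by rewrite (negbTE k0) (eq_sym ord0) (negbTE k0) !mulr1n !mulr0n; ring.
have e0 := eta0; have h2 := d14.
have xpos : 0 < sqnorm x by rewrite xx ltr_pwDl ?sqr_ge0// exprn_even_gt0.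
have Dn i j : - d <= D i j <= d by rewrite -ler_norml.
have /andP[a1 a2] := Dn ord0 ord0; have /andP[b1 b2] := Dn k k.
have /andP[c1 c2] := Dn ord0 k; have /andP[d1 d2] := Dn k ord0.
have [p pE] : exists p, p = `|c k| * v ord0 by eexists.
have [q qE'] : exists q, q = `|c ord0| * v k by eexists.
have p0 : 0 <= p by rewrite pE mulr_ge0// ltW.
have q0 : 0 <= q by rewrite qE' mulr_ge0// ltW.
have p2 : p ^+ 2 = c k ^+ 2 * v ord0 ^+ 2 by rewrite pE exprMn real_normK ?num_real.
have q2 : q ^+ 2 = c ord0 ^+ 2 * v k ^+ 2 by rewrite qE' exprMn real_normK ?num_real.
have cross : c k * c ord0 * (v ord0 * v k * (D ord0 k + D k ord0)) <= p * q * (2 * d).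
  apply: le_trans (ler_norm _) _; rewrite !normrM (gtr0_norm (v0 _)) (gtr0_norm (v0 k)).
  have -> : `|c k| * `|c ord0| * (v ord0 * v k * `|D ord0 k + D k ord0|) =
     p * q * `|D ord0 k + D k ord0| by rewrite pE qE'; ring.
  rewrite ler_wpM2l ?mulr_ge0//; apply: le_trans (ler_normD _ _) _.
  by rewrite mulr_natl mulr2n lerD.
have amgm : p * q * (2 * d) <= (p ^+ 2 + q ^+ 2) * d.
  have : 0 <= (p - q) ^+ 2 * d by rewrite mulr_ge0 ?sqr_ge0// d0.
  by rewrite sqrrB -[p * q *+ 2]mulr_natl => ?; lra.
(* The form at [x] is almost diagonal in [p] and [q], the cross term being absorbed by [amgm];
   replacing [v ord0] by the smaller [v k] in [p] yields the factor [sqnorm x]. *)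
have low : v k ^+ 2 * (1 - 2 * d) * sqnorm x <= quad (specmx th lam) x.
  have e1 : p ^+ 2 * (1 - d) <= p ^+ 2 * (1 + D ord0 ord0) by rewrite ler_wpM2l ?sqr_ge0//; lra.
  have e2 : q ^+ 2 * (1 - d) <= q ^+ 2 * (1 + D k k) by rewrite ler_wpM2l ?sqr_ge0//; lra.
  have e3 : (c k ^+ 2 * v k ^+ 2) * (1 - 2 * d) <= p ^+ 2 * (1 - 2 * d).
    rewrite p2 ler_wpM2r//; first lra.
    by rewrite ler_wpM2l ?sqr_ge0// ler_sqr ?nnegrE ?(ltW (v0 _)).
  set cr := c k * c ord0 * _ in cross qE.
  have -> : quad (specmx th lam) x = p ^+ 2 * (1 + D ord0 ord0) - cr + q ^+ 2 * (1 + D k k).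
    by rewrite qE p2 q2; ring.
  rewrite xx.
  have -> : v k ^+ 2 * (1 - 2 * d) * (c k ^+ 2 + c ord0 ^+ 2) =
     (c k ^+ 2 * v k ^+ 2) * (1 - 2 * d) + q ^+ 2 * (1 - 2 * d) by rewrite q2; ring.
  lra.
rewrite -(ler_pM2r xpos); apply: le_trans up.
have -> : v k ^+ 2 * ((1 - 2 * d) * (1 + eta)) * sqnorm x = v k ^+ 2 * (1 - 2 * d) * sqnorm x * (1 + eta) by ring.
by rewrite ler_wpM2r//; lra.
Qed.

(** Projecting the eigenvector equation of [th ord0] on [thh k] gives [(lam_0 - v_k^2) c_k = v_k
    sum_j c_j v_j D_kj]. The factor [v_k] on the right is what produces the weight [v_0 / v_k],
    however large it is, while the left factor is bounded below by a multiple of [v_0^2]. *)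
Lemma coeff_ratio k : k != ord0 ->
  `|c k| * (v ord0 / v k) <= 2 * P * (2 + eta) / eta * d.
Proof.
move=> k0; have e0 := eta0; have h0 := d0.
have [ck|ck] := eqVneq (c k) 0.
  by rewrite ck normr0 mul0r !mulr_ge0 ?invr_ge0//; lra.
have lw := lower_weight k0 ck.
have eig : (lam ord0 - v k ^+ 2) * c k = v k * \sum_j c j * v j * D k j.
  have : dot (thh k) (specmx th lam *m th ord0) = lam ord0 * c k.
    by rewrite (specmx_eigen ho) dotZr.
  rewrite (ortho_expand hho (th ord0)) mulmx_sumr dot_sumr => h.
  rewrite mulrBl -h mulr_sumr.
  rewrite (eq_bigr (fun j => (k == j)%:R * (v k ^+ 2 * c k) + v k * (c j * v j * D k j))).
    rewrite big_split /= (bigD1 k)//= eqxx mul1r big1 ?addr0; first by rewrite addrAC subrr add0r.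
    by move=> j jk; rewrite eq_sym (negbTE jk) mul0r.
  move=> j _; rewrite -scalemxAr dotZr VD -/(c j); have [<-|_] := eqVneq k j; rewrite ?mulr1n ?mulr0n; ring.
have c1 j : `|c j| <= 1.
  rewrite -(@ler_sqr _ _ 1) ?nnegrE// expr1n real_normK ?num_real//.
  have -> : 1 = sqnorm (th ord0) by rewrite -dot_sqnorm (ortho_dot ho) eqxx.
  rewrite (sqnorm_parseval hho) (bigD1 j)//= lerDl; apply: sumr_ge0 => i _; exact: sqr_ge0.
have sum_le : `|\sum_j c j * v j * D k j| <= P * (v ord0 * d).
  apply: le_trans (ler_norm_sum _ _ _) _.
  apply: (@le_trans _ _ (\sum_(j < m.+1) v ord0 * d)); last first.
    by rewrite sumr_const card_ord -[_ *+ _]mulr_natl.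
  apply: ler_sum => j _; rewrite !normrM (gtr0_norm (v0 j)); apply: ler_pM => //.
    by rewrite mulr_ge0// ltW.
  by rewrite -[leRHS]mul1r; apply: ler_pM => //; exact: ltW.
have gapk : lam ord0 * (eta / (2 + eta)) <= lam ord0 - v k ^+ 2.
  (* By [dsmall], [(1 - 2 d) (1 + eta)] is at least [1 + eta - eta / 2]. *)
  have : v k ^+ 2 * ((2 + eta) / 2) <= lam ord0.
    apply: le_trans lw; rewrite ler_wpM2l ?sqr_ge0//.
    have := dsmall; lra.
  have -> : lam ord0 * (eta / (2 + eta)) = lam ord0 - lam ord0 / ((2 + eta) / 2).
    by field; rewrite gt_eqF//; lra.
  rewrite lerD2l lerN2 ler_pdivlMr//; lra.
have tw := top_weight.
have vk0 := v0 k.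
have e2 : (0 : R) < 2 + eta by lra.
have main : `|c k| * (v ord0 ^+ 2 * (eta / (2 * (2 + eta)))) <= v k * (P * (v ord0 * d)).
  apply: (@le_trans _ _ (`|(lam ord0 - v k ^+ 2) * c k|)); last first.
    by rewrite eig normrM (gtr0_norm vk0) ler_wpM2l// ltW.
  rewrite normrM mulrC ler_wpM2r//; apply: le_trans (ler_norm _).
  apply: le_trans gapk.
  have -> : v ord0 ^+ 2 * (eta / (2 * (2 + eta))) = v ord0 ^+ 2 / 2 * (eta / (2 + eta)).
    by field; rewrite gt_eqF.
  by rewrite ler_wpM2r ?divr_ge0 ?(ltW e0) ?(ltW e2)//; lra.
have f0 : 0 < v ord0 * v k * (eta / (2 * (2 + eta))).
  by rewrite !mulr_gt0 ?invr_gt0 ?mulr_gt0.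
rewrite -(ler_pM2r f0).
have -> : `|c k| * (v ord0 / v k) * (v ord0 * v k * (eta / (2 * (2 + eta)))) =
   `|c k| * (v ord0 ^+ 2 * (eta / (2 * (2 + eta)))).
  by field; rewrite !gt_eqF.
have -> // : 2 * P * (2 + eta) / eta * d * (v ord0 * v k * (eta / (2 * (2 + eta)))) =
  v k * (P * (v ord0 * d)).
by field; rewrite !gt_eqF.
Qed.

End EigenGap.

(** Like [Vtilde] and [Ln], this statistic is even in [th0], so [th0] may be given a nonnegative
    inner product with the leading estimated eigenvector, whose sign is arbitrary. *)
Lemma Tn_opp {R : realType} p n (th0 : 'cV[R]_p) (U : 'I_n -> 'cV[R]_p) V :
  Tn (- th0) U V = Tn th0 U V.
Proof.
have e : - th0 *m (- th0)^T = th0 *m th0^T by rewrite linearN mulNmx mulmxN opprK.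
by rewrite /Tn e mulmxN -scaleN1r vnormZ normrN1 mul1r.
Qed.

Lemma Vtilde_opp {R : realType} p (th0 : 'cV[R]_p.+1) lamh thh :
  Vtilde (- th0) lamh thh = Vtilde th0 lamh thh.
Proof.
have e : - th0 *m (- th0)^T = th0 *m th0^T by rewrite linearN mulNmx mulmxN opprK.
have g (t : nat -> 'cV[R]_p.+1) j : gs_list (- th0) t j = gs_list th0 t j.
  by elim: j => //= j ->; rewrite e.
by rewrite /Vtilde /gs_vec e; congr (_ + _); apply: eq_bigr => j _; rewrite g.
Qed.

Lemma Ln_opp {R : realType} n p (th0 : 'cV[R]_p.+1) Vh lamh : Ln n (- th0) Vh lamh = Ln n th0 Vh lamh.
Proof.
have e (A : 'M[R]_p.+1) : ((- th0)^T *m A *m - th0) = th0^T *m A *m th0.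
  have -> : (- th0)^T = - th0^T by rewrite linearN.
  by rewrite !mulNmx mulmxN opprK.
by rewrite /Ln !e.
Qed.

(** * Constants and the bound off the exceptional event *)

Section CubicBound.
Context {R : realType} (m : nat) (eta : R).
Hypothesis eta0 : 0 < eta.
Let P : R := m.+1%:R.
(** This constant comes from [tyler_close]; the next two come from [coeff_ratio] and [gram_z4], both
    at [d = tyler_rate * delta]. *)
Definition tyler_rate : R := 2 * (P + 2) * P ^+ 5.
Definition coeff_rate : R := 2 * P * (2 + eta) / eta * tyler_rate.
Definition moment_rate : R := 16 * P ^+ 4 + 8 * tyler_rate.
(** In order: the smallness required by [tyler_close], the two conditions of [tyler_exists],
    [d <= 1 / 2] for [GramMoments], [dsmall] for [EigenGap], and the last two conditions on [e] in
    [Tn_Ln_le]. The final one is linearised through [e ^+ 2 <= e]. *)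
Definition moment_tol : R :=
  Num.min ((2 * (P + 1) * (P + 2) * P ^+ 2)^-1)
  (Num.min ((4 * (P + 2) * (P + 1) * P ^+ 2)^-1)
  (Num.min ((64 * (P + 2) * P ^+ 4)^-1 / 2 / ((P + 2) * P))
  (Num.min (1 / 2 / tyler_rate)
  (Num.min (eta / (4 * tyler_rate * (1 + eta)))
  (Num.min (1 / coeff_rate)
    (1 / 2 / ((4 * P + expansion_be P) * coeff_rate))))))).

Let P1 : 1 <= P. Proof. by rewrite /P ler1n. Qed.
Let P0 : 0 < P. Proof. exact: lt_le_trans P1. Qed.
Let P2 : 0 < P + 2. Proof. by rewrite addr_gt0. Qed.
Let P3 : 0 < P + 1. Proof. by rewrite addr_gt0. Qed.
Let e2 : 0 < 2 + eta. Proof. by rewrite addr_gt0. Qed.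
Let e1 : 0 < 1 + eta. Proof. by rewrite addr_gt0. Qed.

Lemma tyler_rate_ge1 : 1 <= tyler_rate.
Proof.
have h1 : 1 <= P ^+ 5 by rewrite exprn_ege1.
have h := P1; have : 1 <= 2 * (P + 2) by lra.
by move=> h2; rewrite -[leLHS]mulr1 /tyler_rate; apply: ler_pM.
Qed.

Let tr0 : 0 < tyler_rate. Proof. exact: lt_le_trans tyler_rate_ge1. Qed.

Lemma coeff_rate_ge1 : 1 <= coeff_rate.
Proof.
rewrite /coeff_rate -[leLHS]mulr1; apply: ler_pM => //; last exact: tyler_rate_ge1.
rewrite ler_pdivlMr// mul1r.
have h := eta0; have h1 := P1.
have : 1 * (2 + eta) <= (2 * P) * (2 + eta) by apply: ler_wpM2r; lra.
lra.
Qed.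

Let cr0 : 0 < coeff_rate. Proof. exact: lt_le_trans coeff_rate_ge1. Qed.

Let be0 : 0 < 4 * P + expansion_be P.
Proof.
rewrite /expansion_be ltr_pwDl ?mulr_gt0// addr_ge0 ?mulr_ge0 ?exprn_ge0 ?addr_ge0 ?mulr_ge0//;
 exact: ltW.
Qed.

Lemma moment_tol_gt0 : 0 < moment_tol.
Proof.
rewrite /moment_tol !lt_min.
by do ?[apply/andP; split]; do ?[exact: P0|exact: P2|exact: P3|exact: eta0|exact: e1|exact: tr0|exact: cr0|exact: be0|apply: divr_gt0|apply: mulr_gt0|apply: exprn_gt0|rewrite invr_gt0].
Qed.

Lemma moment_tolP delta : 0 <= delta -> delta <= moment_tol ->
  [/\ delta <= (2 * (P + 1) * (P + 2) * P ^+ 2)^-1,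
   delta <= (4 * (P + 2) * (P + 1) * P ^+ 2)^-1,
   (P + 2) * (P * delta) <= (64 * (P + 2) * P ^+ 4)^-1 / 2,
   tyler_rate * delta <= 1 / 2 & 4 * (tyler_rate * delta) * (1 + eta) <= eta] /\
  coeff_rate * delta <= 1 /\
  4 * P * (coeff_rate * delta) + expansion_be P * (coeff_rate * delta) ^+ 2 <= 1 / 2.
Proof.
move=> d0; rewrite /moment_tol !le_min => /and5P[h1 h2 h3 h4 /and3P[h5 h6 h7]].
have pp : 0 < (P + 2) * P by rewrite mulr_gt0.
have te : 0 < 4 * tyler_rate * (1 + eta) by rewrite !mulr_gt0.
have bc : 0 < (4 * P + expansion_be P) * coeff_rate by rewrite mulr_gt0.
rewrite (ler_pdivlMr _ _ pp) in h3; rewrite (ler_pdivlMr _ _ tr0) in h4.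
rewrite (ler_pdivlMr _ _ te) in h5; rewrite (ler_pdivlMr _ _ cr0) in h6.
rewrite (ler_pdivlMr _ _ bc) in h7.
split; [split=> //|split].
- by apply: le_trans h3; rewrite mulrA mulrC.
- by rewrite mulrC.
- by apply: le_trans h5; rewrite le_eqVlt; apply/orP; left; apply/eqP; ring.
- by rewrite mulrC.
apply: le_trans h7.
have [x xE] : exists x, x = coeff_rate * delta by eexists.
have x1 : x <= 1 by rewrite xE mulrC.
have x0 : 0 <= x by rewrite xE mulr_ge0// ltW.
have -> : delta * ((4 * P + expansion_be P) * coeff_rate) = 4 * P * x + expansion_be P * x.
  by rewrite xE; ring.
rewrite -xE lerD2l ler_wpM2l//; last by rewrite expr2 ler_piMl.
rewrite /expansion_be; have := P0 => p0.
by rewrite addr_ge0 ?mulr_ge0 ?exprn_ge0 ?addr_ge0 ?mulr_ge0// ltW.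
Qed.

Definition cubic_const : R :=
  P ^+ 2 * (P + 2) * (4 * expansion_const P moment_rate + expansion_const P moment_rate ^+ 2)
   * coeff_rate ^+ 3.

(** The data enter only through the bound on [m4]. The inverse of [Vh], pulled back by the root of
    the true shape and normalised to trace [p], is the matrix [X] close to the identity; a factor
    [N] of [X] adapted to the eigenbasis of [Vh] links all the estimates. *)
Lemma Tn_Ln_cubic n (th : 'I_m.+1 -> 'cV[R]_m.+1) (lam : 'I_m.+1 -> R)
    (nu : 'I_n -> R) (U W : 'I_n -> 'cV[R]_m.+1) (delta : R) Vh lamh thh :
  (0 < n)%N -> (forall i j, (th i)^T *m th j = (i == j)%:R%:M) -> (forall j, 0 < lam j) ->
  (forall j, j != ord0 -> lam j * (1 + eta) <= lam ord0) ->
  (forall i, sqnorm (W i) = 1) -> (forall i, nu i != 0) ->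
  (forall i, U i = nu i *: (specmx th (fun j => Num.sqrt (lam j)) *m W i)) ->
  (forall a b c d, `|m4 W a b c d - kap a b c d| <= delta) -> delta <= moment_tol ->
  tyler_spec U Vh lamh thh ->
  `|Tn (th ord0) U (Vtilde (th ord0) lamh thh) - Ln n (th ord0) Vh lamh| <=
  cubic_const * (n%:R * delta ^+ 3).
Proof.
move=> n0 ho lam0 gap W1 nu0 UE Wd dtol ts.
have d0 : 0 <= delta by exact: le_trans (Wd ord0 ord0 ord0 ord0).
have [[t1 t2 t3 t4 t5] [t6 t7]] := moment_tolP d0 dtol.
pose L := specmx th (fun j => Num.sqrt (lam j)).
have Lp : posdef L by apply: (specmx_posdef ho) => j; rewrite sqrtr_gt0.
have uL := posdef_unit Lp; have LT : L^T = L := Lp.1.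
have LL : L *m L = specmx th lam.
  by rewrite (specmxM ho); apply: eq_specmx => j; rewrite -expr2 sqr_sqrtr// ltW.
have [X0 [X0p X0E]] := tyler_exists W1 Wd n0 t2 t3.
have [Vs VS VhE hho dec] := ts (tyler_solution uL nu0 UE X0p X0E).
have Vp : posdef Vh by case: Vs.
have lamh0 : forall k, 0 < lamh k.
  by apply: (posdef_specmx hho); rewrite /specmx -VhE.
have [Yp YE] := tyler_pulled uL nu0 UE Vp VS.
set Y := L^T *m invmx Vh *m L in Yp YE.
have trY := posdef_tr_gt0 Yp.
have := tyler_normalized Yp YE; set X := (_ *: Y) => -[Xp trX Xl XE Xq].
have Xd := tyler_close W1 Wd n0 (ltn0Sn m) Xp.1 trX
  (fun i => posdef_quad_gt0 Xp (_ : W i != 0)) Xl Xq t1.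
have {}Xd : l1 (X - 1%:M) <= tyler_rate * delta.
  by apply: Xd => i; rewrite -sqnorm_gt0 W1.
pose u k := Num.sqrt (lamh k).
have u0 k : 0 < u k by rewrite sqrtr_gt0.
have uu k : lamh k = u k ^+ 2 by rewrite sqr_sqrtr// ltW.
pose s := Num.sqrt (\tr Y / P).
have s0 : 0 < s by rewrite sqrtr_gt0 divr_gt0.
have ss : s ^+ 2 = \tr Y / P by rewrite sqr_sqrtr// ltW// divr_gt0.
pose N : 'M[R]_m.+1 := \matrix_(k, a) ((s * u k)^-1 * (L *m thh k) a 0).
have NE x k : (N *m x) k 0 = (s * u k)^-1 * dot (thh k) (L *m x).
  rewrite dot_mulmx LT dotE mulr_sumr mxE; apply: eq_bigr => a _.
  by rewrite mxE mulrA.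
have NNE : N^T *m N = X.
  have -> : X = (s ^+ 2)^-1 *: (L *m specmx thh (fun k => (lamh k)^-1) *m L^T).
    have YL : Y = L *m invmx Vh *m L^T by rewrite /Y LT.
    by rewrite -(invmx_specmx hho lamh0) /specmx -VhE ss invf_div /X YL.
  rewrite /specmx mulmx_sumr mulmx_suml scaler_sumr.
  apply/matrixP => a b; rewrite summxE mxE; apply: eq_bigr => k _.
  rewrite -scalemxAr -scalemxAl (mulmxA L) -(mulmxA (L *m _)) -trmx_mul.
  have Nk c : N k c = (s * u k)^-1 * (L *m thh k) c 0 by rewrite mxE.
  rewrite [N^T _ _]mxE !Nk uu; move: (L *m thh k) => y.
  by rewrite !mxE big_ord1 !mxE; field; rewrite !gt_eqF.
rewrite -NNE in Xp Xd XE.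
pose D := gram_dev N.
have Dd : forall j k, `|D j k| <= tyler_rate * delta := gram_dev_le Xd.
have VD j k : dot (thh j) (specmx th lam *m thh k) = (s * u j) * (s * u k) * ((j == k)%:R + D j k).
  rewrite -LL -mulmxA dot_mulmx LT.
  have -> : D j k = (s * u j)^-1 * (s * u k)^-1 * dot (L *m thh j) (L *m thh k) - (j == k)%:R.
    rewrite /D /gram_dev mxE [X in _ + X]mxE [X in _ - X]mxE; congr (_ - _).
    rewrite mxE dotE mulr_sumr; apply: eq_bigr => a _.
    have Nk c l : N l c = (s * u l)^-1 * (L *m thh l) c 0 by rewrite mxE.
    by rewrite [N^T _ _]mxE !Nk mulrACA.
  by rewrite addrCA subrr addr0; field; rewrite !gt_eqF.
have ud (j k : 'I_m.+1) : (j <= k)%N -> u k <= u j.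
  by move=> jk; rewrite ler_sqrt ?dec// ltW.
have su0 k : 0 < s * u k by rewrite mulr_gt0.
have cr k : k != ord0 -> `|dot (thh k) (th ord0)| * (u ord0 / u k) <= coeff_rate * delta.
  move=> k0; have -> : u ord0 / u k = s * u ord0 / (s * u k) by field; rewrite !gt_eqF.
  rewrite /coeff_rate -(mulrA _ tyler_rate).
  apply: (coeff_ratio ho hho su0 _ VD Dd eta0 gap lam0 t5 k0) => j.
  by rewrite ler_wpM2l ?ud// ltW.
have Ww i : W i != 0 by rewrite -sqnorm_gt0 W1.
have t4' := t4.
pose mu i := nu i * s * Num.sqrt (quad (N^T *m N) (W i)).
have mu0 i : mu i != 0.
  by rewrite !mulf_neq0 ?nu0 ?gt_eqF// sqrtr_gt0 posdef_quad_gt0.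
have zE i k : dot (thh k) (U i) / u k = mu i * gram_z W N i k.
  rewrite UE dotZr /gram_z NE /mu.
  have q0 : Num.sqrt (quad (N^T *m N) (W i)) != 0.
    by rewrite gt_eqF// sqrtr_gt0 posdef_quad_gt0.
  by field; rewrite q0 !gt_eqF.
have K0 : 0 <= moment_rate.
  by rewrite /moment_rate addr_ge0// mulr_ge0 ?exprn_ge0 ?(ltW P0) ?(ltW tr0).
have K1 : 16 * P ^+ 4 * delta + 8 * (tyler_rate * delta) <= moment_rate * (coeff_rate * delta).
  have -> : 16 * P ^+ 4 * delta + 8 * (tyler_rate * delta) = moment_rate * (1 * delta).
    by rewrite /moment_rate; ring.
  by rewrite ler_wpM2l// ler_wpM2r// coeff_rate_ge1.
have main (th0 : 'cV[R]_m.+1) : th0 = th ord0 \/ th0 = - th ord0 -> 0 <= dot (thh ord0) th0 ->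
    `|Tn th0 U (Vtilde th0 lamh thh) - Ln n th0 Vh lamh| <= cubic_const * (n%:R * delta ^+ 3).
  move=> th0E c0.
  have n1 : sqnorm (th ord0) = 1 by rewrite -dot_sqnorm (ortho_dot ho) eqxx.
  have th01 : sqnorm th0 = 1.
    by case: th0E => ->; rewrite // -scaleN1r sqnormZ sqrrN expr1n mul1r.
  have cr' k : k != ord0 -> `|dot (thh k) th0| * (u ord0 / u k) <= coeff_rate * delta.
    by move=> k0; case: th0E => ->; rewrite ?dotNr ?normrN; exact: cr.
  have -> : cubic_const * (n%:R * delta ^+ 3) = n%:R * (P ^+ 2 * (P + 2) *
     (4 * expansion_const P moment_rate + expansion_const P moment_rate ^+ 2)) * (coeff_rate * delta) ^+ 3.
    by rewrite /cubic_const; ring.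
  rewrite VhE; apply: (Tn_Ln_le th01 hho u0 uu ud c0 cr' mu0 zE _ _ _ _ t6 K0 t7).
  - exact: (gram_z1 W1 Xd t4').
  - exact: (gram_z2 W1 Xd t4' Xp XE).
  - move=> j k j0 k0; apply: le_trans K1.
    exact: (gram_z4 W1 Wd Xd t4' j0 k0).
  - by rewrite mulr_ge0// ltW.
have [c0|c0] := leP 0 (dot (thh ord0) (th ord0)); first by apply: main => //; left.
rewrite -Tn_opp -Vtilde_opp -Ln_opp; apply: main; first by right.
by rewrite dotNr oppr_ge0 ltW.
Qed.

End CubicBound.

(** * Moments of the angular Gaussian distribution *)

(** [A *m B] and [B *m A] are both block triangular, with the two sides of the formula as
    determinants. *)
Lemma det_rank_one {R : realType} p (v : 'cV[R]_p) t :
  \det (1%:M + t *: (v *m v^T)) = 1 + t * sqnorm v.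
Proof.
pose A : 'M[R]_(p + 1) := block_mx 1%:M (- t *: v) v^T 1%:M.
pose B : 'M[R]_(p + 1) := block_mx 1%:M 0 (- v^T) 1%:M.
have detB : \det B = 1 by rewrite det_lblock !det1 mul1r.
have AB : A *m B = block_mx (1%:M + t *: (v *m v^T)) (- t *: v) 0 1%:M.
  rewrite mulmx_block !mulmx1 !mulmx0 !mul1mx add0r add0r subrr.
  by rewrite -scalemxAl mulmxN scalerN scaleNr opprK.
have BA : B *m A = block_mx 1%:M (- t *: v) 0 (1 + t * sqnorm v)%:M.
  rewrite mulmx_block !mul1mx !mul0mx !addr0 mulmx1 addNr -scalemxAr mulNmx.
  have -> : - t *: - (v^T *m v) = t *: (v^T *m v) by rewrite scalerN scaleNr opprK.
  congr block_mx.
  rewrite [v^T *m v]mx11_scalar -/(dot v v) dot_sqnorm scale_scalar_mx addrC.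
  by rewrite -raddfD.
have := congr1 (fun M => \det M) AB; rewrite det_mulmx detB mulr1 det_ublock det1 mulr1 => <-.
have := congr1 (fun M => \det M) BA.
by rewrite det_mulmx detB mul1r det_ublock det1 mul1r det_scalar expr1.
Qed.

(** * Taylor expansions and identification of coefficients *)

Section Taylor.
Context {R : realType}.
Implicit Types x t : R.

Lemma inv_sqrt_bounds x : 0 <= x -> 0 < (Num.sqrt (1 + x))^-1 <= 1.
Proof.
move=> x0; have h : 0 < Num.sqrt (1 + x) by rewrite sqrtr_gt0 ltr_pwDl.
rewrite invr_gt0 h invf_le1//= -{1}sqrtr1; apply: ler_wsqrtr; by rewrite lerDl.
Qed.

(** The squares of the two quantities are compared after multiplication by [1 + x], where the
    difference is a polynomial starting at [x^3]; their sum is at least 1/2. *)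
Lemma inv_sqrt_taylor x : 0 <= x -> x <= 1 ->
  `|(Num.sqrt (1 + x))^-1 - (1 - x / 2 + 3 / 8 * x ^+ 2)| <= 2 * x ^+ 3.
Proof.
move=> x0 x1; have /andP[y0 y1] := inv_sqrt_bounds x0.
have y2 : (Num.sqrt (1 + x))^-1 ^+ 2 * (1 + x) = 1.
  by rewrite exprVn sqr_sqrtr ?addr_ge0// mulVf// gt_eqF// ltr_pwDl.
move: y0 y1 y2; set y := (_)^-1 => y0 y1 y2.
set a := (X in y - X).
have x20 : 0 <= x ^+ 2 by exact: sqr_ge0.
have x30 : 0 <= x ^+ 3 by exact: exprn_ge0.
have a12 : 1 / 2 <= a by rewrite /a; lra.
have x4 : x ^+ 4 <= x ^+ 3 by rewrite exprS ler_piMl.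
have x40 : 0 <= x ^+ 4 by exact: exprn_ge0.
have x50 : 0 <= x ^+ 5 by exact: exprn_ge0.
have x5 : x ^+ 5 <= x ^+ 3.
  by apply: le_trans x4; rewrite exprS ler_piMl.
have dE : (y ^+ 2 - a ^+ 2) * (1 + x) = - (5 / 8 * x ^+ 3 - 15 / 64 * x ^+ 4 + 9 / 64 * x ^+ 5).
  by rewrite mulrBl y2 /a; field.
have d1 : `|y ^+ 2 - a ^+ 2| <= x ^+ 3.
  apply: (@le_trans _ _ (`|(y ^+ 2 - a ^+ 2) * (1 + x)|)).
    by rewrite normrM ler_peMr// ger0_norm ?lerDl// addr_ge0.
  by rewrite dE normrN ler_norml; apply/andP; split; lra.
have : `|y - a| * (1 / 2) <= `|y ^+ 2 - a ^+ 2|.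
  rewrite subr_sqr normrM ler_wpM2l//; apply: le_trans (ler_norm _); lra.
lra.
Qed.

Lemma inv_sqrt_pow_taylor p : exists2 C : R, 0 <= C & forall x, 0 <= x -> x <= 1 ->
  `|Num.sqrt (1 + x) ^- p - (1 - p%:R / 2 * x + p%:R * (p%:R + 2) / 8 * x ^+ 2)| <= C * x ^+ 3.
Proof.
elim: p => [|p [C C0 IH]].
  exists 0 => // x _ _; rewrite expr0 invr1.
  by rewrite (_ : _ - _ = 0) ?normr0 ?mul0r//; ring.
have [q qE] : exists q : R, q = p%:R by eexists.
have q0 : 0 <= q by rewrite qE.
have qq : 0 <= q * (q + 2) by rewrite mulr_ge0// addr_ge0.
exists (C + 2 * (1 + q / 2 + q * (q + 2) / 8) + (3 / 16 * q + q * (q + 2) / 16 + 3 / 64 * (q * (q + 2)))).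
  lra.
move=> x x0 x1; have {}IH := IH x x0 x1; have T := inv_sqrt_taylor x0 x1.
have /andP[y0 y1] := inv_sqrt_bounds x0.
rewrite -exprVn in IH; rewrite -exprVn exprS -natr1 -qE; rewrite -qE in IH.
move: IH T y0 y1; set y := (_)^-1; set A1 := (_ + 3 / 8 * _); set Ap := (_ + _ / 8 * _) => IH T y0 y1.
have x20 : 0 <= x ^+ 2 by exact: sqr_ge0.
have x30 : 0 <= x ^+ 3 by exact: exprn_ge0.
have x2 : x ^+ 2 <= 1 by rewrite exprn_ile1.
have x4 : x ^+ 4 <= x ^+ 3 by rewrite exprS ler_piMl.
have x40 : 0 <= x ^+ 4 by exact: exprn_ge0.
have -> : y * y ^+ p - (1 - (q + 1) / 2 * x + (q + 1) * (q + 1 + 2) / 8 * x ^+ 2) =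
  y * (y ^+ p - Ap) + (Ap * (y - A1) +
   (- (3 / 16 * q + q * (q + 2) / 16) * x ^+ 3 + 3 / 64 * (q * (q + 2)) * x ^+ 4)).
  by rewrite /Ap /A1; field.
set K := 1 + q / 2 + _; set K2 := 3 / 16 * q + q * (q + 2) / 16 + _.
have -> : (C + 2 * K + K2) * x ^+ 3 = C * x ^+ 3 + (K * (2 * x ^+ 3) + K2 * x ^+ 3) by ring.
apply: le_trans (ler_normD _ _) _; apply: lerD.
  by rewrite normrM -[leRHS]mul1r; apply: ler_pM => //; rewrite gtr0_norm.
apply: le_trans (ler_normD _ _) _; apply: lerD.
  rewrite normrM; apply: ler_pM => //.
  have h1 : q * x <= q by rewrite ler_piMr.
  have h1' : 0 <= q * x by rewrite mulr_ge0.
  have h2 : q * (q + 2) * x ^+ 2 <= q * (q + 2) by rewrite ler_piMr.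
  have h2' : 0 <= q * (q + 2) * x ^+ 2 by rewrite mulr_ge0.
  by rewrite /Ap /K ler_norml; apply/andP; split; lra.
rewrite /K2.
have h1 : 0 <= q * x ^+ 3 by rewrite mulr_ge0.
have h2 : 0 <= q * (q + 2) * x ^+ 3 by rewrite mulr_ge0.
have h3 : 0 <= q * (q + 2) * x ^+ 4 by rewrite mulr_ge0.
have h4 : q * (q + 2) * x ^+ 4 <= q * (q + 2) * x ^+ 3 by rewrite ler_wpM2l.
by rewrite ler_norml; apply/andP; split; lra.
Qed.

Lemma eq0_small_bound (b K t0 : R) : 0 < t0 -> 
  (forall t, 0 < t -> t <= t0 -> `|b| <= K * t) -> b = 0.
Proof.
move=> t00 h; apply/eqP/negPn/negP => b0.
have nb : 0 < `|b| by rewrite normr_gt0.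
have K0 : 0 <= K.
  by have := h t0 t00 (lexx _) => /(le_trans (normr_ge0 b)); rewrite pmulr_lge0.
pose t := Num.min t0 (`|b| / (2 * (K + 1))).
have K1 : 0 < 2 * (K + 1) by lra.
have t1 : 0 < t by rewrite lt_min t00 divr_gt0.
have := h t t1; rewrite ge_min lexx => /(_ isT) hb.
have : t * (2 * (K + 1)) <= `|b| by rewrite -ler_pdivlMr// ge_min lexx orbT.
have := mulr_ge0 K0 (ltW t1); lra.
Qed.

(** Uniqueness of Taylor coefficients: divide by [t], then by [t^2], and let [t] be small. *)
Lemma eq0_quad_bound (b c C t0 : R) : 0 < t0 -> t0 <= 1 ->
  (forall t, 0 < t -> t <= t0 -> `|b * t + c * t ^+ 2| <= C * t ^+ 3) -> b = 0 /\ c = 0.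
Proof.
move=> t00 t01 h.
have b0 : b = 0.
  apply: (@eq0_small_bound _ (`|c| + `|C|) t0) => // t t1 t2.
  have := h t t1 t2; have -> : b * t + c * t ^+ 2 = t * (b + c * t) by ring.
  rewrite normrM gtr0_norm// exprS mulrCA ler_pM2l// => h1.
  have h2 : `|b| <= `|b + c * t| + `|c| * t.
    rewrite -{2}(gtr0_norm t1) -normrM -{1}[b](addrK (c * t)).
    by apply: le_trans (ler_normD _ _) _; rewrite normrN.
  apply: le_trans h2 _; rewrite mulrDl addrC lerD2l; apply: le_trans h1 _.
  rewrite expr2 mulrA ler_wpM2r ?(ltW t1)//.
  apply: le_trans (ler_norm _) _; rewrite normrM ler_piMr// ger0_norm ?(ltW t1)//.
  exact: le_trans t2 t01.
split=> //; apply: (@eq0_small_bound _ C t0) => // t t1 t2.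
have := h t t1 t2; rewrite b0 mul0r add0r normrM (ger0_norm (sqr_ge0 t)).
have -> : C * t ^+ 3 = C * t * t ^+ 2 by ring.
by rewrite ler_pM2r// exprn_gt0.
Qed.

End Taylor.

(** * Expectations of bounded variables *)

Section Mean.
Context {R : realType} d (T : measurableType d) (Pr : probability T R).
Implicit Types X Y : T -> R.

Definition mean X : R := \int[Pr]_w X w.

Definition bounded_rv X := measurable_fun setT X /\ exists M : R, forall w, `|X w| <= M.

Lemma bounded_rv_integrable X : bounded_rv X -> Pr.-integrable setT (EFin \o X).
Proof.
move=> [mX [M XM]]; apply: measurable_bounded_integrable => //.
  exact: le_lt_trans (probability_le1 Pr measurableT) (ltry 1).
exists M; split; first by rewrite num_real.
by move=> r Mr w _; exact: le_trans (XM w) (ltW Mr).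
Qed.

Lemma bounded_rvD X Y : bounded_rv X -> bounded_rv Y -> bounded_rv (fun w => X w + Y w).
Proof.
move=> [mX [M XM]] [mY [N YN]]; split; first exact: measurable_funD.
by exists (M + N) => w; apply: le_trans (ler_normD _ _) _; exact: lerD.
Qed.

Lemma bounded_rvM X Y : bounded_rv X -> bounded_rv Y -> bounded_rv (fun w => X w * Y w).
Proof.
move=> [mX [M XM]] [mY [N YN]]; split; first exact: measurable_funM.
by exists (M * N) => w; rewrite normrM ler_pM.
Qed.

Lemma bounded_rv_cst c : bounded_rv (fun=> c).
Proof. by split=> //; exists `|c|. Qed.

Lemma bounded_rvZ c X : bounded_rv X -> bounded_rv (fun w => c * X w).
Proof. exact/bounded_rvM/bounded_rv_cst. Qed.

Lemma bounded_rv_sum I (r : seq I) (P : pred I) (F : I -> T -> R) :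
  (forall i, bounded_rv (F i)) -> bounded_rv (fun w => \sum_(i <- r | P i) F i w).
Proof.
move=> hF; elim: r => [|i r IH].
  have -> : (fun w => \sum_(i <- [::] | P i) F i w) = fun=> 0 by apply/funext => w; rewrite big_nil.
  exact: bounded_rv_cst.
have -> : (fun w => \sum_(j <- i :: r | P j) F j w) =
   fun w => (if P i then F i w else 0) + \sum_(j <- r | P j) F j w.
  by apply/funext => w; rewrite big_cons; case: ifP => //; rewrite add0r.
by apply: bounded_rvD => //; case: (P i) => //; exact: bounded_rv_cst.
Qed.

Lemma meanD X Y : bounded_rv X -> bounded_rv Y -> mean (fun w => X w + Y w) = mean X + mean Y.
Proof. by move=> hX hY; rewrite /mean RintegralD//; exact: bounded_rv_integrable. Qed.

Lemma meanZ c X : bounded_rv X -> mean (fun w => c * X w) = c * mean X.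
Proof. by move=> hX; rewrite /mean RintegralZl//; exact: bounded_rv_integrable. Qed.

Lemma mean_cst c : mean (fun=> c) = c.
Proof.
transitivity (c * fine (Pr setT)); first exact: Rintegral_cst.
by rewrite (probability_setT Pr) mulr1.
Qed.

Lemma mean_sum I (r : seq I) (P : pred I) (F : I -> T -> R) : (forall i, bounded_rv (F i)) ->
  mean (fun w => \sum_(i <- r | P i) F i w) = \sum_(i <- r | P i) mean (F i).
Proof.
move=> hF; elim: r => [|i r IH].
  by under eq_fun do rewrite big_nil; rewrite mean_cst big_nil.
under eq_fun do rewrite big_cons; rewrite big_cons; case: ifP => // _.
by rewrite meanD// ?IH//; exact: bounded_rv_sum.
Qed.

Lemma ler_mean X Y : bounded_rv X -> bounded_rv Y -> (forall w, X w <= Y w) -> mean X <= mean Y.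
Proof.
by move=> hX hY h; apply: le_Rintegral => //; exact: bounded_rv_integrable.
Qed.

Lemma markov_mean X (c : R) : bounded_rv X -> (forall w, 0 <= X w) -> 0 < c ->
  (Pr [set w | (c < X w)%R] <= (mean X / c)%:E)%E.
Proof.
move=> hX X0 c0; have mX := hX.1.
have mA : measurable [set w | c < X w].
  by rewrite -[X in measurable X]setTI; exact: measurable_fun_ltr.
rewrite EFinM lee_pdivlMr// muleC /mean /Rintegral fineK; last first.
  exact: integrable_fin_num (bounded_rv_integrable hX).
rewrite -integral_cst//.
apply: (@le_trans _ _ (\int[Pr]_(w in [set w | (c < X w)%R]) (X w)%:E)%E).
  apply: ge0_le_integral => //=.
  - by move=> w _; rewrite lee_fin ltW.
  - by apply/measurable_EFinP; exact: measurable_funS mX.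
  - by move=> w /= cX; rewrite lee_fin ltW.
apply: ge0_subset_integral => //; first exact/measurable_EFinP.
by move=> w _; rewrite lee_fin.
Qed.

Lemma norm_mean_le X (M : R) : bounded_rv X -> (forall w, `|X w| <= M) -> `|mean X| <= M.
Proof.
move=> hX XM; apply: le_trans (le_normr_Rintegral _ (bounded_rv_integrable hX)) _ => //.
rewrite -[leRHS]mean_cst; apply: ler_mean => //; last exact: bounded_rv_cst.
case: hX => mX [N XN]; split; first exact: measurableT_comp.
by exists N => w; rewrite normr_id.
Qed.

End Mean.

Lemma sph_int_ge0 {R : realType} p (g : 'cV[R]_p -> R) : (forall x, 0 <= g x) -> 0 <= sph_int g.
Proof.
move=> g0; rewrite /sph_int fine_ge0// mule_ge0//; apply: iint_ge0 => y.
by case: ifP; rewrite ?lee_fin.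
Qed.

Lemma sph_int_scale_quad {R : realType} m (B : 'M[R]_m.+1) K : 0 < K ->
  sph_int (fun u => K * quad_weight B u) = K * sph_int (quad_weight B).
Proof.
move=> K0; have mq := measurable_quad_weight B.
rewrite !sph_int_homogeneous; do ?[by move=> x; rewrite ?mulr_ge0 ?quad_weight_ge0 ?(ltW K0)|exact: mq|
  by move=> a x _; rewrite quad_weightZ// mulrCA].
- rewrite (_ : (fun z => (K * _)%:E) = fun z => (K%:E * (quad_weight B (hplane z))%:E)%E)//.
  rewrite ge0_iintZl.
  + by rewrite !(muleCA _ K%:E) fine_mull.
  + by rewrite lee_fin ltW.
  + by move=> z; rewrite lee_fin quad_weight_ge0.
  + exact: (cyl_measurable_fcons 1 mq).
- move=> d T y my; apply/measurable_EFinP; apply: measurable_funM => //.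
  by apply/measurable_EFinP; exact: mq.
Qed.

(** * Marginal expectations of the sample *)

Section Marginals.
Context {R : realType} d (T : measurableType d) (Pr : probability T R) (p n : nat).
Variables (U : 'I_n -> T -> 'cV[R]_p) (V : 'M[R]_p).
Hypothesis n0 : (0 < n)%N.
Hypothesis hU : iid_angular_gaussian Pr U V.

Lemma ang_dens_ge0 (u : 'cV[R]_p) : 0 <= ang_dens V u.
Proof.
by rewrite /ang_dens !mulr_ge0// invr_ge0 ?sqrtr_ge0 ?exprn_ge0 ?sqrtr_ge0//; exact: sph_int_ge0.
Qed.

Definition test_fun (f : 'cV[R]_p -> R) :=
  [/\ continuous f, forall x, 0 <= f x & exists M : R, forall x, f x <= M].

Lemma test_fun1 : test_fun (fun=> 1).
Proof. by split=> //; [exact: cst_continuous|exists 1]. Qed.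

Lemma iid_mean_prod (f : 'I_n -> 'cV[R]_p -> R) : (forall i, test_fun (f i)) ->
  mean Pr (fun w => \prod_i f i (U i w)) = \prod_i sph_int (fun u => f i u * ang_dens V u).
Proof.
move=> hf; rewrite /mean /Rintegral hU.2//.
- by move=> i; case: (hf i).
- by move=> i; case: (hf i).
- by move=> i; case: (hf i).
Qed.

(** The density is not integrated: with all test functions equal to 1, the law of the sample says
    that the [n]-th power of this nonnegative number is 1. *)
Lemma sph_int_dens : sph_int (fun u => 1 * ang_dens V u) = 1.
Proof.
have := @iid_mean_prod (fun _ _ => 1) (fun=> test_fun1).
under eq_fun do rewrite big1//; rewrite mean_cst prodr_const card_ord => /esym/eqP.
rewrite pexpr_eq1//; first by move/eqP.
by apply: sph_int_ge0 => u; rewrite mul1r ang_dens_ge0.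
Qed.

Lemma iid_mean i f : test_fun f ->
  mean Pr (fun w => f (U i w)) = sph_int (fun u => f u * ang_dens V u).
Proof.
move=> hf; pose F (j : 'I_n) := if j == i then f else fun=> 1.
have Fi : F i = f by rewrite /F eqxx.
have Fk k : k != i -> F k = fun=> 1 by rewrite /F => /negbTE ->.
have := @iid_mean_prod F; rewrite (bigD1 i)//=.
rewrite Fi [X in _ * X]big1 ?mulr1 => [|k kk]; last by rewrite Fk// sph_int_dens.
move=> <-; last by move=> k; rewrite /F; case: ifP => // _; exact: test_fun1.
congr (mean _ _); apply/funext => w.
by rewrite (bigD1 i)//= Fi big1 ?mulr1// => k kk; rewrite Fk.
Qed.

Lemma iid_mean_pair i j f : i != j -> test_fun f ->
  mean Pr (fun w => f (U i w) * f (U j w)) = sph_int (fun u => f u * ang_dens V u) ^+ 2.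
Proof.
move=> ij hf; pose F (k : 'I_n) := if (k == i) || (k == j) then f else fun=> 1.
have Fi : F i = f by rewrite /F eqxx.
have Fj : F j = f by rewrite /F eqxx orbT.
have Fk k : (k != i) && (k != j) -> F k = fun=> 1.
  by rewrite /F -negb_or => /negbTE ->.
have := @iid_mean_prod F; rewrite (bigD1 i)//= (bigD1 j)//=; last by rewrite eq_sym.
rewrite Fi Fj [X in _ * (_ * X)]big1 ?mulr1 => [|k kk]; last by rewrite Fk// sph_int_dens.
rewrite expr2 => <-; last by move=> k; rewrite /F; case: ifP => // _; exact: test_fun1.
congr (mean _ _); apply/funext => w.
rewrite (bigD1 i)//= (bigD1 j)//=; last by rewrite eq_sym.
by rewrite Fi Fj big1 ?mulr1// => k kk; rewrite Fk.
Qed.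

End Marginals.

(** * Test functions of the standardised direction *)

Section DirectionTest.
Context {R : realType} (p : nat).
Implicit Types (A B M : 'M[R]_p) (v x : 'cV[R]_p) (r t : R).

(** Measurability tested along coordinatewise measurable vectors, the only measurability that
    [iid_angular_gaussian] provides. *)
Definition coord_measurable (f : 'cV[R]_p -> R) := forall d (T : measurableType d) (y : T -> 'cV[R]_p),
  (forall a b, measurable_fun setT (fun w => y w a b)) -> measurable_fun setT (f \o y).

Lemma continuous_quad A : continuous (quad A).
Proof.
rewrite (_ : quad A = fun x : 'cV[R]_p => \sum_i \sum_j A i j * (x i 0 * x j 0)); last first.
  by apply/funext => x; rewrite quad_sum.
apply: continuous_sumr => i; apply: continuous_sumr => j x.
have ci l : {for x, continuous (fun y : 'cV[R]_p => y l 0)} by exact: coord_continuous.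
exact: (cvgM (cvg_cst (A i j)) (cvgM (ci i) (ci j))).
Qed.

Lemma coord_measurable_quad A : coord_measurable (quad A).
Proof.
move=> d T y my; rewrite (_ : _ \o _ = fun w => \sum_i \sum_j A i j * (y w i 0 * y w j 0)); last first.
  by apply/funext => w; rewrite /= quad_sum.
apply: measurable_sum => i; apply: measurable_sum => j.
by apply: measurable_funM => //; apply: measurable_funM.
Qed.

(* [max (quad B x) r], written so that continuity is immediate *)
Definition quad_floor B r x : R := (quad B x + r + `|quad B x - r|) / 2.

Lemma quad_floor_id B r x : r <= quad B x -> quad_floor B r x = quad B x.
Proof. by move=> h; rewrite /quad_floor ger0_norm ?subr_ge0//; field. Qed.

Lemma quad_floor_ge B r x : quad B x <= quad_floor B r x.
Proof.
have : quad B x - r <= `|quad B x - r| := ler_norm _.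
by rewrite /quad_floor => h; lra.
Qed.

Lemma quad_floor_ger B r x : r <= quad_floor B r x.
Proof.
have : - (quad B x - r) <= `|quad B x - r| by rewrite -normrN ler_norm.
by rewrite /quad_floor => h; lra.
Qed.

Lemma continuous_quad_floor B r : continuous (quad_floor B r).
Proof.
move=> x; have h : quad B y @[y --> x] --> quad B x := @continuous_quad B x.
have h1 : quad B y + r @[y --> x] --> quad B x + r by exact: (cvgD h (cvg_cst r)).
have h2 : `|quad B y - r| @[y --> x] --> `|quad B x - r|.
  exact: (cvg_norm (cvgB h (cvg_cst r))).
exact: (cvgM (cvgD h1 h2) (cvg_cst (2^-1 : R))).
Qed.

Lemma coord_measurable_quad_floor B r : coord_measurable (quad_floor B r).
Proof.
move=> d T y my; have h := coord_measurable_quad B my.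
apply: measurable_funM => //; apply: measurable_funD; first exact: measurable_funD.
by apply: measurableT_comp => //; exact: measurable_funB.
Qed.

(** The squared component along [v] of the direction of [M x]. Flooring the denominator at [r] makes
    it continuous on the whole space; for small [r] the floor is inactive on the unit sphere. *)
Definition dir_sq M r v x : R := dot v (M *m x) ^+ 2 / quad_floor (M^T *m M) r x.

Section Dir.
Variables (M : 'M[R]_p) (r : R).
Hypothesis r0 : 0 < r.

Lemma floor_gt0 x : 0 < quad_floor (M^T *m M) r x.
Proof. exact: lt_le_trans (quad_floor_ger _ _ _). Qed.

Lemma dir_sq_ge0 v x : 0 <= dir_sq M r v x.
Proof. by rewrite mulr_ge0 ?sqr_ge0// invr_ge0 ltW// floor_gt0. Qed.

Lemma dir_sq_le v x : dir_sq M r v x <= sqnorm v.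
Proof.
rewrite ler_pdivrMr ?floor_gt0//; apply: le_trans (cauchy_schwarz_dot _ _) _.
by rewrite ler_wpM2l ?sqnorm_ge0// -quad_gram quad_floor_ge.
Qed.

Let num_quad v x : dot v (M *m x) ^+ 2 = quad (M^T *m (v *m v^T) *m M) x.
Proof.
have -> : quad (M^T *m (v *m v^T) *m M) x = quad (v *m v^T) (M *m x).
  by rewrite /quad trmx_mul !mulmxA.
by rewrite quad_dot outer_mul dotZr expr2 (dotC _ v).
Qed.

Lemma continuous_dir_sq v : continuous (dir_sq M r v).
Proof.
move=> x; rewrite /dir_sq; under eq_fun do rewrite num_quad.
have q0 : quad_floor (M^T *m M) r x != 0 by rewrite gt_eqF// floor_gt0.
have h1 := @continuous_quad (M^T *m (v *m v^T) *m M) x.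
exact: (cvgM h1 (cvgV q0 (@continuous_quad_floor (M^T *m M) r x))).
Qed.

Lemma coord_measurable_dir_sq v : coord_measurable (dir_sq M r v).
Proof.
move=> d T y my; rewrite /dir_sq.
have -> : (fun x => dot v (M *m x) ^+ 2 / quad_floor (M^T *m M) r x) \o y =
  fun w => quad (M^T *m (v *m v^T) *m M) (y w) * (quad_floor (M^T *m M) r (y w))^-1.
  by apply/funext => w; rewrite /= num_quad.
apply: measurable_funM; first exact: (coord_measurable_quad _ my).
apply: measurable_fun_invr; last exact: (coord_measurable_quad_floor _ _ my).
by move=> w; rewrite ltW// floor_gt0.
Qed.

Lemma test_fun_dir_sq2 v : test_fun (fun x => dir_sq M r v x ^+ 2).
Proof.
split; first by move=> x; exact: (cvgM (@continuous_dir_sq v x) (@continuous_dir_sq v x)).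
- by move=> x; exact: sqr_ge0.
- by exists (sqnorm v ^+ 2) => x; rewrite ler_sqr ?nnegrE ?dir_sq_ge0 ?sqnorm_ge0 ?dir_sq_le.
Qed.

Lemma dir_pow_bounds t v x : 0 <= t -> 0 <= Num.sqrt (1 + t * dir_sq M r v x) ^- p <= 1.
Proof.
move=> t0; have /inv_sqrt_bounds/andP[h1 h2] : 0 <= t * dir_sq M r v x.
  by rewrite mulr_ge0 ?dir_sq_ge0.
by rewrite -exprVn exprn_ge0 ?exprn_ile1// ltW.
Qed.

Lemma test_fun_dir_pow t v : 0 <= t -> test_fun (fun x => Num.sqrt (1 + t * dir_sq M r v x) ^- p).
Proof.
move=> t0; split.
- move=> x; have q0 : Num.sqrt (1 + t * dir_sq M r v x) ^+ p != 0.
    by rewrite gt_eqF// exprn_gt0// sqrtr_gt0 ltr_pwDl// mulr_ge0 ?dir_sq_ge0.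
  have c1 : 1 + t * dir_sq M r v y @[y --> x] --> 1 + t * dir_sq M r v x.
    exact: (cvgD (cvg_cst (1 : R)) (cvgM (cvg_cst t) (@continuous_dir_sq v x))).
  have cs : Num.sqrt (1 + t * dir_sq M r v y) @[y --> x] --> Num.sqrt (1 + t * dir_sq M r v x).
    exact: (cvg_comp _ _ c1 (@sqrt_continuous R _)).
  exact: (cvgV q0 (cvg_comp _ _ cs (@exprn_continuous R p _))).
- by move=> x; have /andP[] := dir_pow_bounds v x t0.
- by exists 1 => x; have /andP[] := dir_pow_bounds v x t0.
Qed.

Lemma coord_measurable_dir_pow t v : coord_measurable (fun x => Num.sqrt (1 + t * dir_sq M r v x) ^- p).
Proof.
move=> d T y my; apply: (@measurable_fun_invr _ _ _ (fun w => Num.sqrt (1 + t * dir_sq M r v (y w)) ^+ p)).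
  by move=> w; rewrite exprn_ge0// sqrtr_ge0.
apply: measurable_funX; apply: measurable_fun_sqrtr; apply: measurable_funD => //.
by apply: measurable_funM => //; exact: (coord_measurable_dir_sq v my).
Qed.

End Dir.
End DirectionTest.

Lemma sph_int0 {R : realType} p : sph_int (fun _ : 'cV[R]_p => 0 : R) = 0.
Proof.
rewrite /sph_int (_ : iint _ = 0%E) ?mule0//.
rewrite (_ : (fun _ => _) = fun y => (0%E * (cst 0%E : ('I_p -> R) -> \bar R) y)%E); last first.
  by apply/funext => y; rewrite mul0e; case: ifP.
by rewrite ge0_iintZl ?mul0e// => d' T' y my; exact: measurable_cst.
Qed.

(** * Fourth moments of a standardised direction *)

Section FourthMoment.
Context {R : realType} d (T : measurableType d) (Pr : probability T R) (m n : nat).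
Variables (U : 'I_n -> T -> 'cV[R]_m.+1) (V : 'M[R]_m.+1) (i : 'I_n) (r : R).
Hypothesis hU : iid_angular_gaussian Pr U V.
Hypothesis Vp : posdef V.
Let M := isqrtmx V.
Hypothesis r0 : 0 < r.
Hypothesis rM : forall u, vnorm u = 1 -> r <= quad (M^T *m M) u.
Let P : R := m.+1%:R.

Let n0 : (0 < n)%N. Proof. exact: leq_trans (ltn_ord i). Qed.

Let MT : M^T = M. Proof. by case: (isqrtmxP Vp) => -[]. Qed.
Let MM : M *m M = invmx V. Proof. by case: (is_isqrt_unit (isqrtmxP Vp)). Qed.
Let uM : M \in unitmx. Proof. by case: (is_isqrt_unit (isqrtmxP Vp)). Qed.

Let detV : \det M ^+ 2 * \det V = 1.
Proof. by rewrite expr2 -!det_mulmx MM mulVmx ?det1// posdef_unit. Qed.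

Let detV_gt0 : 0 < \det V.
Proof.
have M2 : 0 < \det M ^+ 2.
  rewrite exprn_even_gt0//=; apply/eqP => h; have := detV.
  by rewrite h expr0n mul0r => /eqP; rewrite eq_sym oner_eq0.
by rewrite -(pmulr_rgt0 _ M2) detV.
Qed.

(** If the area were 0, its inverse and hence [ang_dens] would be 0 by convention, contradicting
    total mass 1. *)
Lemma sph_area_gt0 : 0 < sph_int (fun _ : 'cV[R]_m.+1 => 1 : R).
Proof.
rewrite lt0r sph_int_ge0// andbT; apply/eqP => h0.
have := sph_int_dens n0 hU.
have -> : sph_int (fun u => 1 * ang_dens V u) = sph_int (fun _ : 'cV[R]_m.+1 => 0 : R).
  by apply: eq_sph_int => u _; rewrite /ang_dens h0 invr0 !mul0r mulr0.
rewrite sph_int0.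
by move/eqP; rewrite eq_sym oner_eq0.
Qed.

Lemma mean_dir_pow v t : 0 <= t ->
  mean Pr (fun w => Num.sqrt (1 + t * dir_sq M r v (U i w)) ^- m.+1) =
  (Num.sqrt (1 + t * sqnorm v))^-1.
Proof.
move=> t0; rewrite (iid_mean n0 hU i (test_fun_dir_pow M r0 v t0)).
pose K : R := (sph_int (fun _ : 'cV[R]_m.+1 => 1 : R))^-1 * (Num.sqrt (\det V))^-1.
have K0 : 0 < K by rewrite mulr_gt0 ?invr_gt0 ?sph_area_gt0 ?sqrtr_gt0.
pose G : 'M[R]_m.+1 := 1%:M + t *: (v *m v^T).
have qG y : quad G y = sqnorm y + t * dot v y ^+ 2.
  by rewrite quadD quad1 quadZ quad_dot outer_mul dotZr (dotC _ v) expr2.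
have Gp : posdef G.
  split; first by rewrite linearD linearZ /= trmx1 trmx_mul trmxK.
  by move=> y y0; rewrite -/(quad _ _) qG ltr_pwDl ?sqnorm_gt0// mulr_ge0// sqr_ge0.
pose B := M^T *m G *m M.
have Bp : posdef B by exact: posdef_congr.
have qB y : quad B y = sqnorm (M *m y) + t * dot v (M *m y) ^+ 2.
  by rewrite -qG /B /quad trmx_mul !mulmxA.
transitivity (sph_int (fun u => K * quad_weight B u)).
  (* On the sphere the floor is inactive, and the power of [1 + t (v'W)^2] turns the weight of
     [invmx V] into that of [B]. *)
  apply: eq_sph_int => u u1; rewrite /ang_dens -/K mulrCA; congr (_ * _).
  have q1 : quad (M^T *m M) u = sqnorm (M *m u) by rewrite quad_gram.
  have s0 : 0 < sqnorm (M *m u) by rewrite -q1; exact: lt_le_trans (rM u1).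
  have q2 : quad (invmx V) u = sqnorm (M *m u) by rewrite -q1 MT MM.
  rewrite /dir_sq quad_floor_id ?rM// -/(quad (invmx V) u) q1 q2 -invfM -exprMn.
  rewrite -sqrtrM; last by rewrite addr_ge0// mulr_ge0// divr_ge0 ?sqr_ge0 ?ltW.
  rewrite /quad_weight -/(quad B u) qB; congr (Num.sqrt _ ^- _).
  by field; rewrite gt_eqF.
rewrite sph_int_scale_quad// sph_int_quad//.
have detB : \det B = (\det V)^-1 * (1 + t * sqnorm v).
  rewrite /B !det_mulmx det_tr det_rank_one mulrAC -expr2; congr (_ * _).
  by apply: (mulIf (lt0r_neq0 detV_gt0)); rewrite detV mulVf// gt_eqF.
have s0 := sph_area_gt0.
rewrite detB sqrtrM ?invr_ge0 ?(ltW detV_gt0)// sqrtrV ?(ltW detV_gt0)// invfM invrK /K.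
have sV : Num.sqrt (\det V) != 0 by rewrite gt_eqF// sqrtr_gt0.
have sT : Num.sqrt (1 + t * sqnorm v) != 0.
  by rewrite gt_eqF// sqrtr_gt0 ltr_pwDl// mulr_ge0 ?sqnorm_ge0.
by field; rewrite sV sT gt_eqF.
Qed.

Lemma bounded_rv_dir_sq v : bounded_rv (fun w => dir_sq M r v (U i w)).
Proof.
split; first exact: (coord_measurable_dir_sq M r0 v (hU.1 i)).
by exists (sqnorm v) => w; rewrite ger0_norm ?dir_sq_ge0 ?dir_sq_le.
Qed.

(** Comparison of the coefficients of [t^2] in [mean_dir_pow]: [P (P + 2) / 8] times the fourth
    moment against [3/8 |v|^4]. The remainders are uniform because [dir_sq] is at most [|v|^2]. *)
Lemma mean_dir_sq2 v : mean Pr (fun w => dir_sq M r v (U i w) ^+ 2) = 3 * sqnorm v ^+ 2 / (P * (P + 2)).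
Proof.
have [C C0 hC] := @inv_sqrt_pow_taylor R m.+1.
have [s sE] : exists s, s = sqnorm v by eexists.
have s0 : 0 <= s by rewrite sE sqnorm_ge0.
have P0 : 0 < P by rewrite /P ltr0n.
pose Q w := dir_sq M r v (U i w).
have Q0 w : 0 <= Q w by rewrite dir_sq_ge0.
have Qs w : Q w <= s by rewrite sE dir_sq_le.
have bQ : bounded_rv Q := bounded_rv_dir_sq v.
have bQ2 : bounded_rv (fun w => Q w ^+ 2).
  by under eq_fun do rewrite expr2; exact: bounded_rvM.
pose q1 := mean Pr Q; pose q2 := mean Pr (fun w => Q w ^+ 2).
(* Keeps both [t * s] and [t * Q w] below 1, the range of the Taylor bounds. *)
pose t0 := (1 + s)^-1.
have s1 : 0 < 1 + s by rewrite ltr_pwDl.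
have t00 : 0 < t0 by rewrite invr_gt0.
have t01 : t0 <= 1 by rewrite invf_le1// lerDl.
have key t : 0 < t -> t <= t0 ->
  `|(s / 2 - P / 2 * q1) * t + (P * (P + 2) / 8 * q2 - 3 / 8 * s ^+ 2) * t ^+ 2| <=
   (C * s ^+ 3 + 2 * s ^+ 3) * t ^+ 3.
  move=> tp tt.
  have ts : t * s <= 1.
    have : t * s <= t0 * (1 + s) by apply: ler_pM => //; [exact: ltW|rewrite lerDr].
    by rewrite mulVf// gt_eqF.
  have h1 := inv_sqrt_taylor (mulr_ge0 (ltW tp) s0) ts.
  pose A w := 1 + (- (P / 2 * t) * Q w + P * (P + 2) / 8 * t ^+ 2 * Q w ^+ 2).
  have bA : bounded_rv A.
    apply: bounded_rvD; first exact: bounded_rv_cst.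
    by apply: bounded_rvD; exact: bounded_rvZ.
  pose H w := Num.sqrt (1 + t * Q w) ^- m.+1.
  have bH : bounded_rv H.
    split; first exact: (coord_measurable_dir_pow M r0 t v (hU.1 i)).
    exists 1 => w; have /andP[h2 h3] := dir_pow_bounds M r0 v (U i w) (ltW tp).
    by rewrite ger0_norm.
  have h2 : `|mean Pr (fun w => H w + (-1) * A w)| <= C * (t * s) ^+ 3.
    apply: norm_mean_le; first by apply: bounded_rvD => //; exact: bounded_rvZ.
    move=> w; have tQ : t * Q w <= t * s by rewrite ler_pM2l.
    have tQ0 : 0 <= t * Q w by rewrite mulr_ge0// ltW.
    have := hC (t * Q w) tQ0 (le_trans tQ ts).
    rewrite -/P -/(H w) (_ : 1 - _ + _ = A w); last by rewrite /A; ring.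
    rewrite mulN1r => /le_trans; apply; rewrite ler_wpM2l// lerXn2r ?nnegrE//.
    exact: le_trans tQ.
  rewrite meanD// ?meanZ// in h2; last exact: bounded_rvZ.
  rewrite mean_dir_pow ?(ltW tp)// -sE in h2.
  have mA : mean Pr A = 1 + (- (P / 2 * t) * q1 + P * (P + 2) / 8 * t ^+ 2 * q2).
    rewrite meanD ?mean_cst ?meanD ?meanZ//; do ?[exact: bounded_rv_cst|exact: bounded_rvZ|
      apply: bounded_rvD].
  rewrite mA in h2; move: h1 h2; set y := (Num.sqrt _)^-1.
  have -> : (C * s ^+ 3 + 2 * s ^+ 3) * t ^+ 3 = C * (t * s) ^+ 3 + 2 * (t * s) ^+ 3 by ring.
  set c1 := C * _; set c2 := 2 * _.
  rewrite !ler_norml => /andP[a1 a2] /andP[b1 b2].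
  have [ts2 ts2E] : exists z, z = t ^+ 2 * s ^+ 2 by eexists.
  rewrite exprMn in a1 a2; rewrite -ts2E in a1 a2.
  have -> : (s / 2 - P / 2 * q1) * t + (P * (P + 2) / 8 * q2 - 3 / 8 * s ^+ 2) * t ^+ 2 =
    (t * s) / 2 - 3 / 8 * ts2 + (- (P / 2 * t) * q1 + P * (P + 2) / 8 * t ^+ 2 * q2).
    by rewrite ts2E; ring.
  by apply/andP; split; lra.
have [_ /eqP] := eq0_quad_bound t00 t01 key.
rewrite subr_eq0 -/q2 -sE => /eqP h.
apply: (mulfI (_ : P * (P + 2) / 8 != 0)).
  by rewrite gt_eqF// !mulr_gt0 ?invr_gt0 ?addr_gt0.
by rewrite h; field; rewrite !gt_eqF// addr_gt0.
Qed.

End FourthMoment.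

(** * The exceptional event *)

Section Polarization.
Context {R : realType} (p n : nat).
Implicit Types (a b c e : 'I_p) (x y z : bool).

Definition sg x : R := (-1) ^+ x.

Definition polar_vec a b c e x y z : 'cV[R]_p :=
  delta_mx a 0 + sg x *: delta_mx b 0 + sg y *: delta_mx c 0 + sg z *: delta_mx e 0.

Lemma dot_deltal a (w : 'cV[R]_p) : dot (delta_mx a 0) w = w a 0.
Proof. by rewrite /dot trmx_delta -rowE mxE. Qed.

Lemma dot_polar_vec a b c e x y z w :
  dot (polar_vec a b c e x y z) w = w a 0 + sg x * w b 0 + sg y * w c 0 + sg z * w e 0.
Proof. by rewrite /polar_vec !dotDl !dotZl !dot_deltal. Qed.

Lemma sqnorm_polar_vec a b c e x y z : sqnorm (polar_vec a b c e x y z) =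
  4 + 2 * (sg x * (a == b)%:R + sg y * (a == c)%:R + sg z * (a == e)%:R
   + sg x * sg y * (b == c)%:R + sg x * sg z * (b == e)%:R + sg y * sg z * (c == e)%:R).
Proof.
have pE k : polar_vec a b c e x y z k 0 =
    (a == k)%:R + sg x * (b == k)%:R + sg y * (c == k)%:R + sg z * (e == k)%:R.
  by rewrite -dot_deltal dotC dot_polar_vec !mxE !eqxx !andbT.
rewrite -dot_sqnorm dot_polar_vec !pE !eqxx (eq_sym b a) (eq_sym c a) (eq_sym e a)
  (eq_sym c b) (eq_sym e b) (eq_sym e c).
clear pE; rewrite mulr1n.
by move: x y z => [] [] []; rewrite /sg /= ?expr0 ?expr1; ring.
Qed.

Lemma sqnorm_polar_vec_le a b c e x y z : sqnorm (polar_vec a b c e x y z) <= 16.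
Proof.
rewrite sqnorm_polar_vec.
have h (i j : 'I_p) : 0 <= ((i == j)%:R : R) <= 1 by rewrite ler0n lern1 leq_b1.
have /andP[? ?] := h a b; have /andP[? ?] := h a c; have /andP[? ?] := h a e.
have /andP[? ?] := h b c; have /andP[? ?] := h b e; have /andP[? ?] := h c e.
by move: x y z => [] [] []; rewrite /sg /= ?expr0 ?expr1; lra.
Qed.

(* Polarisation of a quartic form: [192 = 2^3 * 4!]. *)
Definition polar_sum (f : bool -> bool -> bool -> R) : R :=
  192^-1 * \sum_(x : bool) \sum_(y : bool) \sum_(z : bool) sg x * sg y * sg z * f x y z.

Lemma polar_sum_le f (delta : R) : 0 <= delta -> (forall x y z, `|f x y z| <= delta) ->
  `|polar_sum f| <= delta.
Proof.
move=> d0 fd; rewrite /polar_sum !big_bool /sg /= expr0 expr1.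
have h x y z : - delta <= f x y z <= delta by rewrite -ler_norml.
have /andP[? ?] := h true true true; have /andP[? ?] := h true true false.
have /andP[? ?] := h true false true; have /andP[? ?] := h true false false.
have /andP[? ?] := h false true true; have /andP[? ?] := h false true false.
have /andP[? ?] := h false false true; have /andP[? ?] := h false false false.
by rewrite ler_norml; apply/andP; split; lra.
Qed.

Lemma polar_sumB f g : polar_sum f - polar_sum g = polar_sum (fun x y z => f x y z - g x y z).
Proof. by rewrite /polar_sum !big_bool /=; ring. Qed.

Lemma polar_sum_avg (F : bool -> bool -> bool -> 'I_n -> R) :
  avg (fun i => polar_sum (fun x y z => F x y z i)) = polar_sum (fun x y z => avg (F x y z)).
Proof.
rewrite /polar_sum avgZ avg_sum; congr (_ * _); apply: eq_bigr => x _.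
rewrite avg_sum; apply: eq_bigr => y _; rewrite avg_sum; apply: eq_bigr => z _.
by rewrite avgZ.
Qed.

Lemma polar_fourth a b c e (w : 'cV[R]_p) : w a 0 * w b 0 * (w c 0 * w e 0) =
  polar_sum (fun x y z => (dot (polar_vec a b c e x y z) w ^+ 2) ^+ 2).
Proof.
rewrite /polar_sum !big_bool !dot_polar_vec /sg /= expr0 expr1.
by field.
Qed.

Lemma polar_kap a b c e : (0 < p)%N -> kap a b c e =
  polar_sum (fun x y z => 3 * sqnorm (polar_vec a b c e x y z) ^+ 2 / (p%:R * (p%:R + 2))).
Proof.
move=> p0; have P0 : p%:R != 0 :> R by rewrite pnatr_eq0 -lt0n.
have P2 : p%:R + 2 != 0 :> R by rewrite -natrD pnatr_eq0 addn2.
rewrite /polar_sum !big_bool !sqnorm_polar_vec /sg /= expr0 expr1 /kap.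
by field; rewrite P0 P2.
Qed.

(** All mixed fourth moments follow from those in finitely many fixed directions. No precision is
    lost, since eight terms are divided by 192. *)
Lemma m4_polar_le (W : 'I_n -> 'cV[R]_p) (delta : R) a b c e : (0 < p)%N -> 0 <= delta ->
  (forall x y z, `|avg (fun i => (dot (polar_vec a b c e x y z) (W i) ^+ 2) ^+ 2) -
     3 * sqnorm (polar_vec a b c e x y z) ^+ 2 / (p%:R * (p%:R + 2))| <= delta) ->
  `|m4 W a b c e - kap a b c e| <= delta.
Proof.
move=> p0 d0 h; rewrite polar_kap// /m4.
have -> : avg (fun i => W i a 0 * W i b 0 * (W i c 0 * W i e 0)) =
  polar_sum (fun x y z => avg (fun i => (dot (polar_vec a b c e x y z) (W i) ^+ 2) ^+ 2)).
  by rewrite -polar_sum_avg; apply: eq_avg => i; exact: polar_fourth.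
by rewrite polar_sumB; exact: polar_sum_le.
Qed.

End Polarization.

Section SecondMomentBound.
Context {R : realType} d (T : measurableType d) (Pr : probability T R) (n : nat).

Lemma bounded_rv_avg (F : 'I_n -> T -> R) : (forall i, bounded_rv (F i)) ->
  bounded_rv (fun w => avg (fun i => F i w)).
Proof. by move=> hF; apply: bounded_rvZ; exact: bounded_rv_sum. Qed.

Lemma bounded_rvX2 (X : T -> R) : bounded_rv X -> bounded_rv (fun w => X w ^+ 2).
Proof. by move=> hX; under eq_fun do rewrite expr2; exact: bounded_rvM. Qed.

(** In the expanded square the [n (n - 1)] cross terms vanish and the [n] diagonal ones are at most
    [b^2]. *)
Lemma mean_avg_sq (F : 'I_n -> T -> R) (b : R) : (0 < n)%N ->
  (forall i, bounded_rv (F i)) -> (forall i w, `|F i w| <= b) ->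
  (forall i j, i != j -> mean Pr (fun w => F i w * F j w) = 0) ->
  mean Pr (fun w => avg (fun i => F i w) ^+ 2) <= b ^+ 2 / n%:R.
Proof.
move=> n0 hF Fb Fij.
have hn : 0 < n%:R :> R by rewrite ltr0n.
have E w : avg (fun i => F i w) ^+ 2 = n%:R ^- 2 * \sum_i \sum_j F i w * F j w.
  rewrite /avg exprMn exprVn; congr (_ * _).
  by rewrite expr2 mulr_suml; apply: eq_bigr => i _; rewrite mulr_sumr.
under eq_fun do rewrite E.
have hij i j : bounded_rv (fun w => F i w * F j w) by exact: bounded_rvM.
have hi i : bounded_rv (fun w => \sum_j F i w * F j w) by exact: bounded_rv_sum.
rewrite meanZ; last exact: bounded_rv_sum.
rewrite mean_sum// (eq_bigr (fun i => mean Pr (fun w => F i w * F i w))) => [|i _]; last first.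
  rewrite mean_sum// (bigD1 i)//= big1 ?addr0// => j ji.
  by rewrite Fij// eq_sym.
rewrite mulrC expr2 invfM mulrA ler_pM2r ?invr_gt0// ler_pdivrMr//.
apply: (@le_trans _ _ (\sum_(i < n) b ^+ 2)); last by rewrite sumr_const card_ord -[_ *+ _]mulr_natr.
apply: ler_sum => i _; apply: le_trans (ler_norm _) _.
apply: norm_mean_le => // w; rewrite normrM expr2; exact: ler_pM.
Qed.

End SecondMomentBound.

(** * Control of all fourth moments on one event *)

Section MomentEvent.
Context {R : realType} d (T : measurableType d) (Pr : probability T R) (m n : nat).
Variables (U : 'I_n -> T -> 'cV[R]_m.+1) (V : 'M[R]_m.+1).
Hypothesis n0 : (0 < n)%N.
Hypothesis hU : iid_angular_gaussian Pr U V.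
Hypothesis Vp : posdef V.
Let M := isqrtmx V.
Let P : R := m.+1%:R.

(** [|x|] is bounded by [|M x|] times a norm of the inverse of [M]. The constant depends on [V], but
    it only serves to fix the floor of [dir_sq] and enters no rate. *)
Lemma isqrt_lower_bound : exists2 c : R, 0 < c & forall x, c * sqnorm x <= quad (M^T *m M) x.
Proof.
have [uM _ _] := is_isqrt_unit (isqrtmxP Vp).
pose A := (invmx M)^T *m invmx M; pose c := (1 + l1 A)^-1.
have l0 : 0 < 1 + l1 A by rewrite ltr_pwDl// l1_ge0.
exists c; first by rewrite invr_gt0.
move=> x; rewrite /c mulrC ler_pdivrMr// quad_gram.
have {1}-> : x = invmx M *m (M *m x) by rewrite mulKmx.
rewrite -(quad_gram (invmx M)) -/A mulrC; apply: le_trans (ler_norm _) _.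
apply: le_trans (quad_le_l1_gen _ _) _.
by rewrite ler_wpM2r ?sqnorm_ge0// lerDr.
Qed.

(* vanishes on the sphere and exceeds 1/2 close to the origin *)
Definition inner_bump (x : 'cV[R]_m.+1) : R := ((1 - sqnorm x) + `|1 - sqnorm x|) / 2.

Lemma inner_bump_ge0 x : 0 <= inner_bump x.
Proof.
have := ler_norm (- (1 - sqnorm x)); rewrite normrN /inner_bump => h; lra.
Qed.

Lemma inner_bump_ge x : 1 - sqnorm x <= inner_bump x.
Proof. have := ler_norm (1 - sqnorm x); rewrite /inner_bump => h; lra. Qed.

Lemma inner_bump_le1 x : inner_bump x <= 1.
Proof.
have s0 := sqnorm_ge0 x; rewrite /inner_bump.
have [h|h] := leP 0 (1 - sqnorm x); first by rewrite ger0_norm//; lra.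
by rewrite ltr0_norm//; lra.
Qed.

Lemma test_fun_inner_bump : test_fun inner_bump.
Proof.
split; [|exact: inner_bump_ge0|by exists 1; exact: inner_bump_le1].
move=> x; have h : quad 1%:M y @[y --> x] --> quad 1%:M x := @continuous_quad _ _ 1%:M x.
have h1 : 1 - quad 1%:M y @[y --> x] --> 1 - quad 1%:M x by exact: (cvgB (cvg_cst (1 : R)) h).
have h2 : `|1 - quad 1%:M y| @[y --> x] --> `|1 - quad 1%:M x| by exact: (cvg_norm h1).
have -> : inner_bump = fun y => (1 - quad 1%:M y + `|1 - quad 1%:M y|) / 2.
  by apply/funext => y; rewrite /inner_bump quad1.
exact: (cvgM (cvgD h1 h2) (cvg_cst (2^-1 : R))).
Qed.

Lemma coord_measurable_inner_bump : coord_measurable inner_bump.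
Proof.
move=> d' T' y my; have h := coord_measurable_quad 1%:M my.
have -> : inner_bump \o y = fun w => (1 - (quad 1%:M \o y) w + `|1 - (quad 1%:M \o y) w|) / 2.
  by apply/funext => w; rewrite /= /inner_bump quad1.
have h1 : measurable_fun setT (fun w => 1 - (quad 1%:M \o y) w) by exact: measurable_funB.
apply: measurable_funM => //; apply: measurable_funD => //.
exact: measurableT_comp.
Qed.

Lemma bounded_rv_inner_bump i : bounded_rv (fun w => inner_bump (U i w)).
Proof.
split; first exact: (coord_measurable_inner_bump (hU.1 i)).
by exists 1 => w; rewrite ger0_norm ?inner_bump_ge0 ?inner_bump_le1.
Qed.

(** How the support on the sphere is exploited: the assumed law speaks of expectations of continuous
    functions, and this one keeps the [U i] away from the origin almost surely. *)
Lemma mean_inner_bump i : mean Pr (fun w => inner_bump (U i w)) = 0.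
Proof.
rewrite (iid_mean n0 hU i test_fun_inner_bump) -[RHS](@sph_int0 R m.+1).
apply: eq_sph_int => u u1; rewrite /inner_bump -vnorm_sq u1 expr1n subrr normr0.
by rewrite addr0 mul0r mul0r.
Qed.

Let J : finType := ('I_m.+1 * 'I_m.+1 * 'I_m.+1 * 'I_m.+1 * (bool * bool * bool))%type.
Let vec (j : J) : 'cV[R]_m.+1 :=
  let: (a, b, c, e, (x, y, z)) := j in polar_vec a b c e x y z.
Let kappa j : R := 3 * sqnorm (vec j) ^+ 2 / (P * (P + 2)).
(** Number of polarisation directions times the square of 256, a bound for each centred variable:
    the squared norms of the directions are at most 16. *)
Definition moment_event_const : R :=
  #|{: 'I_m.+1 * 'I_m.+1 * 'I_m.+1 * 'I_m.+1 * (bool * bool * bool)}|%:R * 256 ^+ 2.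

Let vec_le j : sqnorm (vec j) ^+ 2 <= 256.
Proof.
have h : sqnorm (vec j) <= 16.
  by move: j => [[[[a b] c] e] [[x y] z]]; exact: sqnorm_polar_vec_le.
have -> : 256 = 16 ^+ 2 :> R by ring.
by rewrite ler_sqr ?nnegrE ?sqnorm_ge0.
Qed.

Let kappa_bounds j : 0 <= kappa j <= 256.
Proof.
have P1 : 1 <= P by rewrite /P ler1n.
have PP : 3 <= P * (P + 2).
  by rewrite -[leLHS]mul1r; apply: ler_pM => //; lra.
have P0 : 0 < P * (P + 2) by exact: lt_le_trans PP.
have s0 := sqr_ge0 (sqnorm (vec j)).
apply/andP; split; first by apply: divr_ge0; [exact: mulr_ge0|exact: ltW].
rewrite ler_pdivrMr//; have := vec_le j => h.
have := ler_wpM2l (ler0n R 256) PP; lra.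
Qed.

Lemma moment_event (delta : R) : 0 < delta -> exists E : set T, [/\ measurable E,
  (Pr E <= (moment_event_const / (n%:R * delta ^+ 2))%:E)%E &
  forall w, ~ E w -> (forall i, vnorm (M *m U i w) != 0) /\
   forall a b c e, `|m4 (fun i => (vnorm (M *m U i w))^-1 *: (M *m U i w)) a b c e - kap a b c e| <= delta].
Proof.
move=> d0; have [cc cc0 cM] := isqrt_lower_bound.
(* Small enough for the floor to be inactive both on the sphere and at every vector of squared norm
   at least 1/2, which is what the bump guarantees off the event. *)
pose r := cc / 4; have r0 : 0 < r by rewrite divr_gt0.
have rM u : vnorm u = 1 -> r <= quad (M^T *m M) u.
  move=> u1; apply: le_trans (cM u); rewrite -vnorm_sq u1 expr1n /r; lra.
pose X j i w := dir_sq M r (vec j) (U i w) ^+ 2.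
have bX j i : bounded_rv (X j i) by apply: bounded_rvX2; exact: (bounded_rv_dir_sq i hU r0).
have mX j i : mean Pr (X j i) = kappa j by exact: (mean_dir_sq2 i hU Vp r0 rM).
pose F j i w := X j i w + - kappa j.
have bF j i : bounded_rv (F j i) by apply: bounded_rvD => //; exact: bounded_rv_cst.
have Fle j i w : `|F j i w| <= 256.
  have /andP[k0 k1] := kappa_bounds j.
  have x0 : 0 <= X j i w := sqr_ge0 _.
  have x1 : X j i w <= 256.
    apply: le_trans (vec_le j).
    by rewrite ler_sqr ?nnegrE ?dir_sq_ge0 ?sqnorm_ge0 ?dir_sq_le.
  by rewrite /F ler_norml; apply/andP; split; lra.
have Fij j i i' : i != i' -> mean Pr (fun w => F j i w * F j i' w) = 0.
  move=> ii'; have e w : F j i w * F j i' w =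
      X j i w * X j i' w + ((- kappa j) * X j i w + ((- kappa j) * X j i' w + kappa j ^+ 2)).
    by rewrite /F; ring.
  under eq_fun do rewrite e.
  have b1 : bounded_rv (fun w => X j i w * X j i' w) by exact: bounded_rvM.
  have b2 k : bounded_rv (fun w => (- kappa j) * X j k w) by exact: bounded_rvZ.
  have b3 := @bounded_rv_cst R _ T (kappa j ^+ 2).
  have b4 := bounded_rvD (b2 i') b3.
  rewrite (meanD Pr b1 (bounded_rvD (b2 i) b4)) (meanD Pr (b2 i) b4) (meanD Pr (b2 i') b3).
  rewrite (meanZ Pr _ (bX j i)) (meanZ Pr _ (bX j i')) mean_cst !mX.
  have -> : mean Pr (fun w => X j i w * X j i' w) = kappa j ^+ 2.
    have tf := test_fun_dir_sq2 M r0 (vec j).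
    rewrite (iid_mean_pair n0 hU ii' tf); congr (_ ^+ 2).
    by rewrite -(iid_mean n0 hU i tf); exact: mX.
  ring.
pose D w := \sum_j avg (fun i => F j i w) ^+ 2.
have bD : bounded_rv D.
  by apply: bounded_rv_sum => j; apply: bounded_rvX2; exact: bounded_rv_avg.
have D0 w : 0 <= D w by apply: sumr_ge0 => j _; exact: sqr_ge0.
have mD : mean Pr D <= moment_event_const / n%:R.
  rewrite /D mean_sum => [|j]; last by apply: bounded_rvX2; exact: bounded_rv_avg.
  rewrite /moment_event_const -mulrA mulr_natl -sumr_const.
  rewrite [leRHS](eq_bigl xpredT)//; apply: ler_sum => j _.
  exact: (mean_avg_sq n0 (bF j) (Fle j) (Fij j)).
pose S w := \sum_i inner_bump (U i w).
have bS : bounded_rv S by apply: bounded_rv_sum; exact: bounded_rv_inner_bump.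
have S0 w : 0 <= S w by apply: sumr_ge0 => i _; exact: inner_bump_ge0.
have mS : mean Pr S = 0.
  rewrite mean_sum => [|i]; last exact: bounded_rv_inner_bump.
  by rewrite big1// => i _; exact: mean_inner_bump.
have meas (Y : T -> R) c : bounded_rv Y -> measurable [set w | c < Y w].
  by move=> [mY _]; rewrite -[X in measurable X]setTI; exact: measurable_fun_ltr.
have d2 : 0 < delta ^+ 2 by rewrite exprn_gt0.
have h2 : 0 < 1 / 2 :> R by lra.
(* [E1] carries the whole probability bound. [E2] is a null set, since [S] is nonnegative with mean
   0. *)
pose E1 := [set w | delta ^+ 2 < D w]; pose E2 := [set w | 1 / 2 < S w].
have m1 : measurable E1 by exact: meas.
have m2 : measurable E2 by exact: meas.
exists (E1 `|` E2); split; first exact: measurableU.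
- have p1 := markov_mean Pr bD D0 d2; have p2 := markov_mean Pr bS S0 h2.
  rewrite mS mul0r in p2.
  apply: le_trans (measureU2 _ m1 m2) _; rewrite -[leRHS]adde0; apply: leeD => //.
  apply: le_trans p1 _; rewrite lee_fin.
  have -> : moment_event_const / (n%:R * delta ^+ 2) = moment_event_const / n%:R / delta ^+ 2.
    by rewrite -mulrA -invfM.
  by rewrite ler_pM2r ?invr_gt0.
move=> w nE; have nE1 : D w <= delta ^+ 2.
  by rewrite leNgt; apply/negP => h; apply: nE; left.
have nE2 : S w <= 1 / 2.
  by rewrite leNgt; apply/negP => h; apply: nE; right.
have Ui i : 1 / 2 <= sqnorm (U i w).
  have : inner_bump (U i w) <= S w.
    by rewrite /S (bigD1 i)//= lerDl sumr_ge0// => *; exact: inner_bump_ge0.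
  have := inner_bump_ge (U i w); lra.
have Mi i : r <= quad (M^T *m M) (U i w).
  apply: le_trans (cM _); have := ler_wpM2l (ltW cc0) (Ui i); rewrite /r; lra.
have Mi0 i : 0 < sqnorm (M *m U i w) by rewrite -quad_gram; exact: lt_le_trans (Mi i).
split=> [i|a b c e].
  by rewrite gt_eqF// vnorm_gt0 -sqnorm_gt0.
apply: m4_polar_le => //; first exact: ltW.
move=> x y z; pose j : J := (a, b, c, e, (x, y, z)).
have -> : avg (fun i => (dot (polar_vec a b c e x y z) ((vnorm (M *m U i w))^-1 *: (M *m U i w)) ^+ 2) ^+ 2)
   - 3 * sqnorm (polar_vec a b c e x y z) ^+ 2 / (m.+1%:R * (m.+1%:R + 2)) = avg (fun i => F j i w).
  rewrite /F avgD avg_cst//; congr (_ - _); apply: eq_avg => i; rewrite /X; congr (_ ^+ 2).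
  by rewrite dotZr /dir_sq quad_floor_id// quad_gram exprMn exprVn vnorm_sq mulrC.
rewrite -(@ler_sqr _ _ delta) ?nnegrE// ?(ltW d0)// real_normK ?num_real//.
apply: le_trans nE1; rewrite /D (bigD1 j)//= lerDl.
by apply: sumr_ge0 => k _; exact: sqr_ge0.
Qed.

End MomentEvent.

(** * The rate and the conclusion *)

Section Rate.
Context {R : realType}.

(* With [delta = root8 n ^- 3], both [n delta^3] and [1 / (n delta^2)] tend to 0. *)
Definition root8 (n : nat) : R := Num.sqrt (Num.sqrt (Num.sqrt n%:R)).

Lemma root8_ge0 n : 0 <= root8 n. Proof. exact: sqrtr_ge0. Qed.

Lemma root8X n : root8 n ^+ 8 = n%:R.
Proof.
rewrite (_ : root8 n ^+ 8 = ((root8 n ^+ 2) ^+ 2) ^+ 2); last by rewrite -!exprM.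
by rewrite /root8 !sqr_sqrtr ?sqrtr_ge0.
Qed.

Lemma root8_ge K : \forall n \near \oo, K <= root8 n.
Proof.
near=> n; apply: le_trans (ler_norm _) _.
rewrite -(@ler_pXn2r _ 8) ?nnegrE ?root8_ge0// root8X.
near: n; exact: nbhs_infty_ger.
Unshelve. all: by end_near. Qed.

Lemma cvg_inv_root8 (C : R) : (C / root8 n ^+ 2) @[n --> \oo] --> 0.
Proof.
rewrite -[X in _ --> X](mulr0 C); apply: cvgMl_tmp => //.
apply/gtr0_cvgV0.
  near=> n; rewrite exprn_gt0//; apply: lt_le_trans ltr01 _.
  by near: n; exact: root8_ge.
apply/cvgryPge => A; near=> n.
have h : 1 + `|A| <= root8 n by near: n; exact: root8_ge.
have A0 := normr_ge0 A; have AA := ler_norm A.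
have : (1 + `|A|) * (1 + `|A|) <= root8 n * root8 n by apply: ler_pM => //; lra.
have : 0 <= `|A| * `|A| by rewrite mulr_ge0.
rewrite expr2; lra.
Unshelve. all: by end_near. Qed.

End Rate.

(* The dimension is p = k.+2 (so p >= 2); index ord0 is the paper's j = 1,
   index (inord 1) the paper's j = 2. *)
Theorem theorem3 (R : realType) (k : nat)
  (th0 : 'cV[R]_k.+2) (hth0 : vnorm th0 = 1)
  (lam : nat -> 'I_k.+2 -> R) (th : nat -> 'I_k.+2 -> 'cV[R]_k.+2)
  (V0 : nat -> 'M[R]_k.+2)
  (hV0 : forall n, V0 n = \sum_(j < k.+2) lam n j *: (th n j *m (th n j)^T))
  (hV0shape : forall n, shape_mx (V0 n))
  (hth_first : forall n, th n ord0 = th0)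
  (hth_orth : forall n (i j : 'I_k.+2), (th n i)^T *m th n j = (i == j)%:R%:M)
  (hlam12 : forall n, lam n (inord 1) < lam n ord0)
  (hlam_dec : forall n (i j : 'I_k.+2), (1 <= i)%N -> (i <= j)%N -> lam n j <= lam n i)
  (hlam_pos : forall n, 0 < lam n ord_max)
  (eta : R) (heta : 0 < eta)
  (hgap : exists N, forall n, (N <= n)%N -> 1 + eta <= lam n ord0 / lam n (inord 1))
  (d : nat -> measure_display) (Omega : forall n, measurableType (d n))
  (P : forall n, probability (Omega n) R)
  (U : forall n, 'I_n -> Omega n -> 'cV[R]_k.+2)
  (hU : forall n, iid_angular_gaussian (P n) (U n) (V0 n))
  (Vh : forall n, Omega n -> 'M[R]_k.+2)
  (lamh : forall n, Omega n -> 'I_k.+2 -> R)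
  (thh : forall n, Omega n -> 'I_k.+2 -> 'cV[R]_k.+2)
  (htyler : forall n w, tyler_spec (fun i => U n i w) (Vh n w) (lamh n w) (thh n w)) :
  oP1 P (fun n w =>
    Tn th0 (fun i => U n i w) (Vtilde th0 (lamh n w) (thh n w))
    - Ln n th0 (Vh n w) (lamh n w)).
Proof.
move=> eps eps0.
have lam_pos n j : 0 < lam n j.
  have pos (i : 'I_k.+2) : (1 <= i)%N -> 0 < lam n i.
    by move=> i1; apply: lt_le_trans (hlam_pos n) _; apply: hlam_dec => //; exact: leq_ord.
  have [->|j0] := eqVneq j ord0; last by apply: pos; rewrite lt0n.
  by apply: lt_trans (hlam12 n); apply: pos; rewrite inordK.
have [N0 gap0] := hgap.
have gap n j : (N0 <= n)%N -> j != ord0 -> lam n j * (1 + eta) <= lam n ord0.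
  move=> nN j0; have := gap0 n nN; rewrite ler_pdivlMr// mulrC; apply: le_trans.
  rewrite ler_wpM2r ?addr_ge0 ?(ltW heta)//; apply: hlam_dec; rewrite inordK//.
  by rewrite lt0n.
pose tol : R := moment_tol k.+1 eta.
have tol0 : 0 < tol by exact: moment_tol_gt0.
pose C : R := cubic_const k.+1 eta.
pose B : R := moment_event_const k.+1.
(* The three summands ensure that [root8 n] is at least 1, that [delta] is below the tolerance, and
   that [C n delta^3 = C / root8 n] is at most [eps]. *)
pose K : R := 1 + tol^-1 + `|C| / eps.
have C0 : 0 <= `|C| / eps by rewrite divr_ge0// ltW.
have K1 : 1 <= K by rewrite /K -addrA lerDl addr_ge0// invr_ge0 ltW.
have [N1 _ hN1] := @root8_ge R K.
(* For the finitely many [n] below [N0] or [N1] the event is the whole space; only the limit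
   matters. *)
have claim n : exists E : set (Omega n), [/\ measurable E,
   [set w | eps < `|Tn th0 (fun i => U n i w) (Vtilde th0 (lamh n w) (thh n w))
     - Ln n th0 (Vh n w) (lamh n w)|] `<=` E &
   ((N0 <= n)%N -> (N1 <= n)%N -> (P n E <= (B / root8 n ^+ 2)%:E)%E)].
  have [nN0|nN0] := leqP N0 n; last by exists setT; split.
  have [nN1|nN1] := leqP N1 n; last by exists setT; split.
  have Kr : K <= root8 n := hN1 n nN1.
  have r1 : (1 : R) <= root8 n := le_trans K1 Kr.
  have r0 : (0 : R) < root8 n := lt_le_trans ltr01 r1.
  have n0 : (0 < n)%N.
    by rewrite lt0n; apply/eqP => n0; move: r0; rewrite n0 /root8 !sqrtr0 ltxx.
  pose delta : R := root8 n ^- 3; have d0 : 0 < delta by rewrite invr_gt0 exprn_gt0.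
  have Vp : posdef (V0 n) by case: (hV0shape n).
  have [E [mE PE hE]] := moment_event n0 (hU n) Vp d0.
  exists E; split=> //; last first.
    move=> _ _; apply: le_trans PE _; rewrite lee_fin -/B.
    have -> // : n%:R * delta ^+ 2 = root8 n ^+ 2.
    by rewrite -root8X /delta exprVn -exprM; field; rewrite gt_eqF.
  move=> w /= ew; apply: contrapT => /hE[M0 m4le].
  have VE : V0 n = specmx (th n) (lam n) := hV0 n.
  (* The square root of [V0 n], inverse to [isqrtmx (V0 n)]; it writes each [U n i w] as a positive
     length times [L] applied to a unit vector. *)
  pose L := specmx (th n) (fun j => Num.sqrt (lam n j)).
  have LM : L *m isqrtmx (V0 n) = 1%:M.
    rewrite VE (isqrtmx_specmx (hth_orth n))// (specmxM (hth_orth n)).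
    rewrite -(specmx1 (hth_orth n)); apply: eq_specmx => j.
    by rewrite divff// gt_eqF// sqrtr_gt0.
  have dtol : delta <= tol.
    have h1 : tol^-1 <= root8 n.
      apply: le_trans Kr; rewrite /K -addrA addrCA lerDl addr_ge0//.
    have h2 : (root8 n : R) <= root8 n ^+ 3 by rewrite exprS ler_peMr ?exprn_ege1// ltW.
    rewrite /delta -[tol]invrK lef_pV2 ?posrE ?invr_gt0 ?exprn_gt0//.
    exact: le_trans h1 h2.
  have := @Tn_Ln_cubic R k.+1 eta heta n (th n) (lam n) (fun i => vnorm (isqrtmx (V0 n) *m U n i w))
    (fun i => U n i w) (fun i => (vnorm (isqrtmx (V0 n) *m U n i w))^-1 *: (isqrtmx (V0 n) *m U n i w))
    delta (Vh n w) (lamh n w) (thh n w) n0 (hth_orth n) (lam_pos n) (gap n ^~ nN0).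
  rewrite hth_first => bound; move: ew; apply/negP; rewrite -leNgt.
  apply: le_trans (bound _ _ _ _ _ _) _ => //.
  - move=> i; rewrite sqnormZ -vnorm_sq exprVn mulVf// expf_neq0//.
  - move=> i; rewrite -scalemxAr mulmxA LM mul1mx scalerA divff// scale1r//.
  - have -> : n%:R * delta ^+ 3 = (root8 n)^-1 :> R.
      by rewrite -root8X /delta exprVn -exprM; field; rewrite gt_eqF.
    rewrite -/C ler_pdivrMr//; apply: le_trans (ler_norm _) _.
    rewrite mulrC -ler_pdivrMr//; apply: le_trans Kr.
    by rewrite /K lerDr addr_ge0// invr_ge0 ltW.
pose E n := projT1 (cid (claim n)).
have EP n := projT2 (cid (claim n)).
exists E; split; first by move=> n; case: (EP n).
split; first by move=> n; case: (EP n).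
apply: (@squeeze_cvge _ _ _ _ (cst 0%E) _ (fun n => (B / root8 n ^+ 2)%:E)).
- near=> n; rewrite measure_ge0 /=; case: (EP n) => _ _; apply.
    by near: n; exists N0.
  by near: n; exists N1.
- exact: cvg_cst.
- by apply: cvg_EFin; [near=> n|exact: cvg_inv_root8].
Unshelve. all: by end_near. Qed.
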